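(* When the category $\mathcal{C}\mathrm{onvMan}$ of convenient manifolds is viewed as a subcategory of the category $\mathcal{E}\mathrm{lst}$ of elastic diffeological spaces, its (Kriegl–Michor) tangent structure coincides with the restriction of the tangent structure of $\mathcal{E}\mathrm{lst}$: every convenient manifold $M$ is elastic as a diffeological space, and there is a natural identification of the Kriegl–Michor tangent bundle $SM$ with the diffeological tangent bundle $TM$ under which the footprint projections, zero sections, scalar multiplications, additions, canonical flips and vertical lifts correspond.
   Context: Convenient setting: for a separated locally convex topological vector space (lctvs) $E$ with continuous dual $L^*(E)$, let $\Pi L^*(E)$ be the diffeology of maps $p\colon U\to E$ ($U$ open in some $\mathbb{R}^n$) with $l\circ p$ smooth for all $l\in L^*(E)$, and $\mathscr{D}_c(E)$ the diffeology of maps $p$ such that for every smooth curve $c$ in $U$ all iterated derivatives (limits of difference quotients) of $p\circ c$ exist. $E$ is convenient if $\mathscr{D}_c(E)=\Pi L^*(E)$. Smooth maps between convenient lctvs are the $\mathscr{D}_c$-smooth maps (those sending plots to plots). A convenient manifold is defined as usual by charts in subsets of convenient lctvs that are open in the $c^\infty$-topology (the final topology for smooth curves, which is the D-topology of $\mathscr{D}_c(E)$), with $\mathscr{D}_c$-smooth transition functions and Hausdorff final topology induced by the charts. Assigning to $M$ the diffeology of all $\mathscr{D}_c$-smooth maps $U\to M$ gives a fully faithful functor from $\mathcal{C}\mathrm{onvMan}$ to diffeological spaces. Kriegl–Michor tangent structure: on $c^\infty$-open $U\subseteq E$, $\hat S(U)=U\times E$ and $\hat Sf(u,v)=(f(u),[t\mapsto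 f(u+tv)]'(0))$; $S$ on $\mathcal{C}\mathrm{onvMan}$ is obtained by gluing over charts. Its structure maps are, in charts: footprint $(u,v)\mapsto u$, zero $u\mapsto(u,0)$, scalar multiplication $(t,u,v)\mapsto(u,tv)$, addition $((u,v_0),(u,v_1))\mapsto(u,v_0+v_1)$, flip $(u,v_0,v_1,v_{01})\mapsto(u,v_1,v_0,v_{01})$ on $S^2$, vertical lift $(u,v)\mapsto(u,0,0,v)$. Diffeological tangent functor: for a functor $\hat F$ from the category of open subsets of Euclidean spaces to itself, $(\mathbb{L}\hat F)X$ is the quotient (with quotient diffeology) of $\coprod_{p\colon U\to X\text{ plot}}\hat FU$ by the equivalence relation generated by $(p,u)\sim(p',\hat Ff(u))$ whenever $f\colon U\to U'$ is smooth with $p=p'\circ f$; the class of $(p,u)$ is $p_*u$; a natural transformation $\hat\alpha$ induces $(\mathbb{L}\hat\alpha)_X(p_*u)=p_*(\hat\alpha_U(u))$. Let $\hat TU=U\times\mathbb{R}^n$, $\hat Tf(u,v)=(f(u),D_uf(v))$, $T=\mathbb{L}\hat T$; $\pi_X(p_*(u,v))=p(u)$, $0_X(p(u))=p_*(u,0)$, $t\cdot p_*(u,v)=p_*(u,tv)$, $T_kX=TX\times_X\cdots\times_XTX$. Elasticity: let $\hat T_kU=U\times(\mathbb{R}^n)^k$, $\hat T^2U=U\times(\mathbb{R}^n)^3$, $\hat\tau(u,v_0,v_1,v_{01})=(u,v_1,v_0,v_{01})$, $\hat\lambda(u,v)=(u,0,0,v)$, $\hat+(u,v_0,v_1)=(u,v_0+v_1)$.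 Natural maps: $\theta_{k,X}\colon(\mathbb{L}\hat T_k)X\to T_kX$, $p_*(u,v_0,\dots,v_{k-1})\mapsto(p_*(u,v_0),\dots,p_*(u,v_{k-1}))$; $\theta^2_X\colon(\mathbb{L}\hat T^2)X\to T^2X$, $p_*(\xi)\mapsto T^2p(\xi)$; $\nu_{k,X}\colon T(T_kX)\to T^2X\times_{TX}\cdots\times_{TX}T^2X$ (along $T\pi_X$), $(p_1,\dots,p_k)_*v\mapsto((p_1)_*v,\dots,(p_k)_*v)$. $X$ is elastic if: (E1) $\theta_{k,X}$ is an isomorphism for all $k\ge1$; (E2) there is a smooth $\tau_X\colon T^2X\to T^2X$ with $\tau_X\circ\theta^2_X=\theta^2_X\circ(\mathbb{L}\hat\tau)_X$; (E3) $\lambda_X:=\theta^2_X\circ(\mathbb{L}\hat\lambda)_X$ is an induction (diffeomorphism onto its image with subspace diffeology); (E4) $\nu_{k,X}$ is injective for all $k\ge1$; (E5) all $T_{k_1}\cdots T_{k_n}X$ satisfy (E1)–(E4). The tangent structure on $\mathcal{E}\mathrm{lst}$ consists of $T$, $\pi$, $0$, $\cdot$, $+=\mathbb{L}\hat+\circ\theta_2^{-1}$, the canonical flip $\tau$ and the vertical lift $\lambda$. *)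

(* Defs.v *)
From Stdlib Require Import Relation_Operators.
From mathcomp Require Import all_boot all_order all_algebra.
From mathcomp Require Import all_classical all_reals all_analysis.

Set Implicit Arguments.
Unset Strict Implicit.
Unset Printing Implicit Defensive.

Import Order.TTheory GRing.Theory Num.Theory.
Import numFieldNormedType.Exports.

Local Open Scope classical_set_scope.
Local Open Scope ring_scope.

Section Smooth.
Context {R : realType}.
Implicit Types V W : normedModType R.

(* All iterated directional derivatives of order < k are Frechet
   differentiable at the points of A; for finite-dimensional V this is k-fold
   Frechet differentiability of f on the open set A. *)
Fixpoint kdiff V W (k : nat) (A : set V) (f : V -> W) : Prop :=
  if k is k'.+1 then
    (forall x, A x -> differentiable f x) /\
    (forall v, kdiff k' A (fun x => 'D_v f x))
  else True.

Definition smooth_on V W (A : set V) (f : V -> W) : Prop :=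
  forall k, kdiff k A f.

Lemma near_eq_differentiable V W (f g : V -> W) x :
  (\forall y \near x, f y = g y) -> differentiable f x -> differentiable g x.
Proof.
move=> fg df; apply/diff_locallyP.
have fgx : f x = g x by exact: nbhs_singleton fg.
have e : g \o shift x = cst (g x) + 'd f x +o_ 0 id.
  have [_ H] := proj1 (diff_locallyP _ _) df.
  apply/eqaddoP => _/posnumP[e].
  move/eqaddoP: H => /(_ e%:num [gt0 of e%:num]).
  have fg0 : \forall h \near 0, f (h + x) = g (h + x).
    by move: fg; rewrite (near_shift 0) /= => H; apply: filterS H => h /=; rewrite subr0.
  move=> H; apply: filterS2 fg0 H => h fgh.
  have -> // : (f \o shift x - (cst (f x) + 'd f x)) h =
               (g \o shift x - (cst (g x) + 'd f x)) h.
  by rewrite !fctE /= fgx fgh.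
have -> : 'd g x = 'd f x :> (V -> W).
  by apply: diff_unique => //; exact: diff_continuous.
by split=> //; exact: diff_continuous.
Qed.

Lemma kdiff_eq V W k (A : set V) (f g : V -> W) : open A ->
  (forall x, A x -> f x = g x) -> kdiff k A f -> kdiff k A g.
Proof.
move=> oA; elim: k f g => [//|k IH] f g fg [df dkf].
have near_fg x : A x -> \forall y \near x, f y = g y.
  by move=> Ax; apply: filterS (open_nbhs_nbhs (conj oA Ax)) => y /fg.
split=> [x Ax|v]; first by apply: near_eq_differentiable (df x Ax); exact: near_fg.
apply: IH (dkf v) => x Ax.
have [->|v0] := eqVneq v 0; first by rewrite !derive0.
by apply: near_eq_derive => //; exact: near_fg.
Qed.

Lemma kdiff_sub V W k (A B : set V) (f : V -> W) :
  B `<=` A -> kdiff k A f -> kdiff k B f.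
Proof.
move=> BA; elim: k f => [//|k IH] f [df dkf].
by split=> [x Ax|v]; [exact/df/BA|exact/IH/dkf].
Qed.

Lemma kdiffW V W k (A : set V) (f : V -> W) : kdiff k.+1 A f -> kdiff k A f.
Proof.
elim: k f => [//|k IH] f [df dkf].
by split=> // v; exact/IH/dkf.
Qed.

Lemma kdiff_cst V W k (A : set V) (a : W) : kdiff k A (fun=> a).
Proof.
elim: k a => [//|k IH] a; split=> [x _|v]; first exact: differentiable_cst.
have -> : (fun x : V => 'D_v (fun=> a) x) = (fun=> 0).
  by apply/funext => x; rewrite derive_cst.
exact: IH.
Qed.

Lemma kdiff_lin V W k (A : set V) (f : {linear V -> W}) :
  continuous f -> kdiff k A f.
Proof.
move=> cf; case: k => [//|k]; split=> [x _|v]; first exact: linear_differentiable.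
have -> : (fun x : V => 'D_v f x) = (fun=> f v).
  by apply/funext => x; rewrite deriveE ?diff_lin//; exact: linear_differentiable.
exact: kdiff_cst.
Qed.

Lemma kdiffD V k (A : set V) (f g : V -> R) : open A ->
  kdiff k A f -> kdiff k A g -> kdiff k A (fun x => f x + g x).
Proof.
move=> oA; elim: k f g => [//|k IH] f g [df dkf] [dg dkg].
split=> [x Ax|v].
  by apply: (@differentiableD _ _ _ f g); [exact: df|exact: dg].
apply: kdiff_eq (IH _ _ (dkf v) (dkg v)) => // x Ax.
rewrite [RHS]deriveE; last by apply: (@differentiableD _ _ _ f g); [exact: df|exact: dg].
rewrite (@diffD _ _ _ f g) /=; [|exact: df|exact: dg].
by rewrite !deriveE //; [exact: dg|exact: df].
Qed.

Lemma kdiffM V k (A : set V) (f g : V -> R) : open A ->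
  kdiff k A f -> kdiff k A g -> kdiff k A (fun x => f x * g x).
Proof.
move=> oA; elim: k f g => [//|k IH] f g hf hg.
have [df dkf] := hf; have [dg dkg] := hg.
have dfg x : A x -> differentiable (fun x => f x * g x) x.
  by move=> Ax; apply: (@differentiableM _ _ f g); [exact: df|exact: dg].
split=> // v.
apply: kdiff_eq (kdiffD oA (IH _ _ (kdiffW hf) (dkg v)) (IH _ _ (kdiffW hg) (dkf v))) => // x Ax.
rewrite [RHS]deriveE; last exact: dfg.
rewrite (@diffM _ _ f g) /=; [|exact: df|exact: dg].
by rewrite !deriveE //; [exact: df|exact: dg].
Qed.

Lemma kdiff_sum V k (A : set V) n (f : 'I_n -> V -> R) : open A ->
  (forall i, kdiff k A (f i)) -> kdiff k A (fun x => \sum_i f i x).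
Proof.
move=> oA; elim: n f => [|n IH] f hf.
  apply: (kdiff_eq oA) (kdiff_cst k A (0 : R)) => x _; by rewrite big_ord0.
apply: (kdiff_eq oA) (kdiffD oA (hf ord0) (IH (fun i => f (lift ord0 i)) _)) => [x _|i].
  by rewrite big_ord_recl.
exact: hf.
Qed.

Lemma derive_coord V n (f : V -> 'rV[R]_n) x v i : differentiable f x ->
  'D_v (fun y => f y ord0 i) x = 'D_v f x ord0 i.
Proof.
move=> df; pose c := (fun N : 'rV[R]_n => N ord0 i : R).
have dc y : differentiable c y by exact: differentiable_coord.
rewrite -[LHS]/('D_v (c \o f) x) deriveE; last exact: differentiable_comp.
rewrite diff_comp //= deriveE //.
have @l : {linear 'rV[R]_n -> R}.
  by exists c; do 2![eexists]; do ?[constructor];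
     rewrite /c ?mxE// => ? *; rewrite ?mxE//; move=> ?; rewrite !mxE.
by rewrite -[c]/(l : _ -> _) diff_lin //; exact: coord_continuous.
Qed.

Lemma row_coord n (u : 'rV[R]_n) :
  u = \sum_(i < n) u ord0 i *: delta_mx ord0 i.
Proof. exact: row_sum_delta. Qed.

Lemma kdiff_coord V n k (A : set V) (f : V -> 'rV[R]_n) : open A ->
  kdiff k A f <-> forall i, kdiff k A (fun x => f x ord0 i).
Proof.
move=> oA; elim: k f => [//|k IH] f; split=> [[df dkf] i|H].
  split=> [x Ax|v].
    apply: (@differentiable_comp _ _ _ _ f (fun N : 'rV[R]_n => N ord0 i)).
      exact: df.
    exact: differentiable_coord.
  apply: kdiff_eq (proj1 (IH _) (dkf v) i) => // x Ax.
  by rewrite derive_coord//; exact: df.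
have df x : A x -> differentiable f x.
  move=> Ax; rewrite (_ : f = \sum_(i < n) (fun y => f y ord0 i *: delta_mx ord0 i)).
    by apply: differentiable_sum => i; apply: differentiableZl; exact: (H i).1.
  by apply/funext => y; rewrite fct_sumE -row_coord.
split=> // v; apply/IH => i; apply: kdiff_eq ((H i).2 v) => // x Ax.
by rewrite derive_coord//; exact: df.
Qed.

Lemma kdiff_comp_scalar V n k (A : set V) (B : set 'rV[R]_n) (f : V -> 'rV[R]_n)
    (g : 'rV[R]_n -> R) : open A -> (forall x, A x -> B (f x)) ->
  kdiff k B g -> kdiff k A f -> kdiff k A (g \o f).
Proof.
move=> oA AB; elim: k g => [//|k IH] g hg hf.
have [dg dkg] := hg; have [df dkf] := hf.
have dgf x : A x -> differentiable (g \o f) x.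
  by move=> Ax; apply: (@differentiable_comp _ _ _ _ f g); [exact: df|exact/dg/AB].
split=> // v.
pose h x := \sum_(i < n) 'D_v f x ord0 i * 'D_(delta_mx ord0 i) g (f x).
apply: (kdiff_eq oA (f := h)) => [x Ax|].
  rewrite deriveE; last exact: dgf.
  rewrite diff_comp /=; [|exact: df|exact/dg/AB].
  have -> : 'd f x v = 'D_v f x by rewrite deriveE//; exact: df.
  rewrite /h [in RHS](row_coord ('D_v f x)) linear_sum; apply: eq_bigr => i _.
  by rewrite linearZ /= (deriveE _ (dg _ (AB _ Ax))).
apply: kdiff_sum => // i; apply: kdiffM => //.
  exact: (proj1 (kdiff_coord k (fun x => 'D_v f x) oA) (dkf v) i).
by move: (IH _ (dkg (delta_mx ord0 i)) (kdiffW hf)).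
Qed.

Lemma smooth_on_comp V m n (A : set V) (B : set 'rV[R]_m) (f : V -> 'rV[R]_m)
    (g : 'rV[R]_m -> 'rV[R]_n) : open A -> open B ->
  (forall x, A x -> B (f x)) ->
  smooth_on B g -> smooth_on A f -> smooth_on A (g \o f).
Proof.
move=> oA oB AB sg sf k; apply/kdiff_coord => // i.
exact: (kdiff_comp_scalar oA AB (proj1 (kdiff_coord k g oB) (sg k) i) (sf k)).
Qed.

Lemma smooth_on_continuous V W (A : set V) (f : V -> W) x :
  smooth_on A f -> A x -> {for x, continuous f}.
Proof. by move=> /(_ 1%N)[df _] Ax; apply: differentiable_continuous; exact: df. Qed.

End Smooth.

Section Domains.
Context {R : realType}.

Definition mkset T (A : set T) (x : T) (h : A x) : set_type A :=
  exist _ x (mem_set h).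

Record edom := Edom {
  edim : nat;
  eset : set 'rV[R]_edim;
  eopen : open eset }.

Arguments eset : clear implicits.
Arguments eopen : clear implicits.

Definition ept (U : edom) : Type := set_type (eset U).
Coercion ept : edom >-> Sortclass.

Definition epoint (U : edom) (u : U) : 'rV[R]_(edim U) := val u.

Lemma epointP (U : edom) (u : U) : eset U (epoint u).
Proof. exact: set_valP. Qed.

Lemma epoint_inj (U : edom) : injective (@epoint U).
Proof. exact: val_inj. Qed.

(* Differentiation in the library is for functions on the whole space: a
   function on an open set is extended by 0. *)
Definition ext (U : edom) (W : normedModType R) (f : U -> W)
    (x : 'rV[R]_(edim U)) : W :=
  if insub x is Some u then f u else 0.

Lemma extE (U : edom) (W : normedModType R) (f : U -> W) (u : U) : ext f (epoint u) = f u.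
Proof. by rewrite /ext /epoint valK. Qed.

Lemma extP (U : edom) (W : normedModType R) (f : U -> W) x (h : eset U x) :
  ext f x = f (mkset h).
Proof. by rewrite -extE. Qed.

Definition vsmooth (U : edom) (W : normedModType R) (f : U -> W) : Prop :=
  smooth_on (eset U) (ext f).

Definition esmooth (U V : edom) (f : U -> V) : Prop :=
  vsmooth (fun u => epoint (f u)).

Definition curve_smooth n (c : R -> 'rV[R]_n) : Prop := smooth_on setT c.

Lemma smooth_on_eq (V W : normedModType R) (A : set V) (f g : V -> W) : open A ->
  (forall x, A x -> f x = g x) -> smooth_on A f -> smooth_on A g.
Proof. by move=> oA fg sf k; exact: kdiff_eq fg (sf k). Qed.

Lemma vsmooth_on (U : edom) (W : normedModType R) (F : 'rV[R]_(edim U) -> W) :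
  smooth_on (eset U) F -> vsmooth (fun u : U => F (epoint u)).
Proof.
apply: smooth_on_eq; first exact: eopen.
by move=> x Ux; rewrite (extP _ Ux).
Qed.

Lemma vsmooth_comp (U V : edom) n (f : U -> V) (g : V -> 'rV[R]_n) :
  esmooth f -> vsmooth g -> vsmooth (g \o f).
Proof.
move=> sf sg; rewrite /vsmooth.
apply: (@smooth_on_eq _ _ _ (ext g \o ext (fun u => epoint (f u))) _ (eopen U)).
  by move=> x Ux /=; rewrite !(extP _ Ux) /= extE.
apply: (smooth_on_comp (eopen U) (eopen V) _ sg sf) => x Ux.
by rewrite (extP _ Ux); exact: epointP.
Qed.

Lemma esmooth_comp (U V W : edom) (f : U -> V) (g : V -> W) :
  esmooth f -> esmooth g -> esmooth (g \o f).
Proof. by move=> sf sg; exact: vsmooth_comp sf sg. Qed.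

Lemma vsmooth_cst (U : edom) n (a : 'rV[R]_n) : vsmooth (fun _ : U => a).
Proof. by apply: (@vsmooth_on U _ (fun=> a)) => k; exact: kdiff_cst. Qed.

Lemma curve_smooth_comp (U V : edom) (f : U -> V) (c : R -> U) :
  esmooth f -> curve_smooth (fun t => epoint (c t)) ->
  curve_smooth (fun t => epoint (f (c t))).
Proof.
move=> sf sc.
apply: (@smooth_on_eq _ _ _
  (ext (fun u => epoint (f u)) \o (fun t => epoint (c t))) _ openT).
  by move=> t _ /=; rewrite extE.
apply: (smooth_on_comp openT (eopen U) _ sf sc) => t _; exact: epointP.
Qed.

Definition restr (U : edom) (A : set 'rV[R]_(edim U)) (oA : open A) : edom :=
  Edom (openI (eopen U) oA).

Definition rincl (U : edom) (A : set 'rV[R]_(edim U)) (oA : open A)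
    (w : restr oA) : U :=
  mkset (proj1 (epointP w)).

Lemma epoint_rincl (U : edom) A (oA : open A) (w : @restr U A oA) :
  epoint (rincl w) = epoint w.
Proof. by []. Qed.

Lemma esmooth_rincl (U : edom) A (oA : open A) : esmooth (@rincl U A oA).
Proof.
apply: (@vsmooth_on (restr oA) _ id) => k.
by apply: (@kdiff_lin R 'rV[R]_(edim U) 'rV[R]_(edim U) k _ idfun) => x; exact: cvg_id.
Qed.

Lemma kdiff_local (V W : normedModType R) k (A : set V) (f : V -> W) :
  (forall x, A x -> exists B, [/\ open B, B x & kdiff k (A `&` B) f]) ->
  kdiff k A f.
Proof.
elim: k f => [//|k IH] f H; split=> [x Ax|v].
  by have [B [_ Bx [df _]]] := H x Ax; exact: df.
by apply: IH => x /H [B [oB Bx [_ dkf]]]; exists B; split=> //; exact: dkf.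
Qed.

Lemma vsmooth_local (U : edom) n (f : U -> 'rV[R]_n) :
  (forall u : U, exists (A : set 'rV[R]_(edim U)) (oA : open A),
    A (epoint u) /\ vsmooth (fun w : restr oA => f (rincl w))) ->
  vsmooth f.
Proof.
move=> H k; apply: kdiff_local => x Ux.
have [A [oA [Ax sf]]] := H (mkset Ux).
exists A; split=> //; apply: kdiff_eq (sf k); first exact: openI (eopen U) oA.
move=> y [Uy Ay]; rewrite (extP _ Uy).
rewrite (@extP (restr oA) _ _ y (conj Uy Ay)).
by congr f; exact: epoint_inj.
Qed.

Lemma esmooth_lift (U V : edom) (f : U -> V) (A : set 'rV[R]_(edim V))
    (oA : open A) : esmooth f ->
  exists (B : set 'rV[R]_(edim U)) (oB : open B) (g : restr oB -> restr oA),
    [/\ forall u, A (epoint (f u)) -> B (epoint u), esmooth g &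
        forall w, rincl (g w) = f (rincl w)].
Proof.
move=> sf; pose F := ext (fun u => epoint (f u)).
pose B := eset U `&` F @^-1` A.
have oB : open B.
  rewrite openE => x [Ux Ax]; apply: filterI.
    by apply: open_nbhs_nbhs; split=> //; exact: eopen.
  apply: (smooth_on_continuous sf Ux); apply: open_nbhs_nbhs; split=> //.
have gA (w : restr oB) : (eset V `&` A) (epoint (f (rincl w))).
  split; first exact: epointP.
  by have [_ [_]] := epointP w; rewrite /F /= -(epoint_rincl w) extE.
exists B, oB, (fun w => mkset (gA w)); split.
- by move=> u Au; split; [exact: epointP|rewrite /F /= extE].
- exact: esmooth_comp (@esmooth_rincl _ _ oB) sf.
- by move=> w; exact: epoint_inj.
Qed.

End Domains.
Arguments edom : clear implicits.
Arguments eset {R} e _.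
Arguments eopen {R} e.

Section Diffeology.
Context {R : realType}.
Local Notation edom := (edom R).

Record diffspace := Diffspace {
  dcar :> Type;
  plot : forall U : edom, (U -> dcar) -> Prop;
  plot_cst : forall (U : edom) (x : dcar), plot (fun _ : U => x);
  plot_comp : forall (U V : edom) (f : U -> V) (p : V -> dcar),
    esmooth f -> plot p -> plot (p \o f);
  plot_local : forall (U : edom) (p : U -> dcar),
    (forall u : U, exists (A : set 'rV[R]_(edim U)) (oA : open A),
      A (epoint u) /\ plot (fun w : restr oA => p (rincl w))) ->
    plot p }.

Definition dsmooth (X Y : diffspace) (f : X -> Y) : Prop :=
  forall (U : edom) (p : U -> X), plot p -> plot (f \o p).

Record dmap (X Y : diffspace) := Dmap {
  dfun :> X -> Y;
  dmapP : dsmooth dfun }.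

Lemma dsmooth_comp (X Y Z : diffspace) (f : X -> Y) (g : Y -> Z) :
  dsmooth f -> dsmooth g -> dsmooth (g \o f).
Proof. by move=> sf sg U p /sf /sg. Qed.

Definition diffeo (X Y : diffspace) (f : X -> Y) : Prop :=
  exists g : Y -> X, [/\ cancel f g, cancel g f, dsmooth f & dsmooth g].

(* The diffeology of the maps that are locally of the form P. *)
Section Generated.
Context (X : Type) (P : forall U : edom, (U -> X) -> Prop).
Context (P_cst : forall (U : edom) (x : X), P (fun _ : U => x)).
Context (P_comp : forall (U V : edom) (f : U -> V) (p : V -> X),
  esmooth f -> P p -> P (p \o f)).

Definition gen_plot (U : edom) (p : U -> X) : Prop :=
  forall u : U, exists (A : set 'rV[R]_(edim U)) (oA : open A),
    A (epoint u) /\ P (fun w : restr oA => p (rincl w)).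

Fact gen_plot_cst (U : edom) (x : X) : gen_plot (fun _ : U => x).
Proof. by move=> u; exists setT, openT; split=> //; exact: P_cst. Qed.

Fact gen_plot_comp (U V : edom) (f : U -> V) (p : V -> X) :
  esmooth f -> gen_plot p -> gen_plot (p \o f).
Proof.
move=> sf gp u; have [A [oA [Au Pp]]] := gp (f u).
have [B [oB [g [Bu sg gE]]]] := esmooth_lift oA sf.
exists B, oB; split; first exact: Bu.
rewrite (_ : (fun w => _) = (fun w => p (rincl w)) \o g).
  exact: P_comp sg Pp.
by apply/funext => w /=; rewrite gE.
Qed.

Fact gen_plot_local (U : edom) (p : U -> X) :
  (forall u : U, exists (A : set 'rV[R]_(edim U)) (oA : open A),
    A (epoint u) /\ gen_plot (fun w : restr oA => p (rincl w))) ->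
  gen_plot p.
Proof.
move=> H u; have [A [oA [Au gp]]] := H u.
have [B [oB [Bu Pp]]] := gp (@mkset _ (eset (restr oA)) _ (conj (epointP u) Au)).
exists (A `&` B), (openI oA oB); split=> //.
have hB (w : restr (openI oA oB)) : eset (restr (U := restr oA) oB) (epoint w).
  by have [Uw [Aw Bw]] := epointP w.
pose h (w : restr (openI oA oB)) : restr (U := restr oA) oB := mkset (hB w).
rewrite (_ : (fun w => _) = (fun w => p (rincl (rincl w))) \o h).
  by apply: P_comp Pp; exact: (@esmooth_rincl _ U _ (openI oA oB)).
by apply/funext => w /=; congr p; exact: epoint_inj.
Qed.

Lemma gen_plotW (U : edom) (p : U -> X) : P p -> gen_plot p.
Proof.
move=> Pp u; exists setT, openT; split=> //.
by apply: (P_comp (f := @rincl _ U setT openT)) => //; exact: esmooth_rincl.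
Qed.

Definition gen_diffspace : diffspace :=
  Diffspace gen_plot_cst gen_plot_comp gen_plot_local.

End Generated.

Definition eucl (n : nat) : diffspace :=
  @Diffspace 'rV[R]_n (fun U p => vsmooth p)
    (fun U x => vsmooth_cst U x)
    (fun U V f p => @vsmooth_comp R U V n f p)
    (fun U p => @vsmooth_local R U n p).

Definition subD (X : diffspace) (A : set X) : diffspace :=
  @Diffspace (set_type A) (fun U p => plot (fun u => val (p u)))
    (fun U x => plot_cst U (val x))
    (fun U V f p sf pp => plot_comp sf pp)
    (fun U p H => plot_local H).

Definition edomD (U : edom) : diffspace := @subD (eucl (edim U)) (eset U).

Program Definition prodD (X Y : diffspace) : diffspace :=
  @Diffspace (X * Y)%type
    (fun U p => plot (fun u => (p u).1) /\ plot (fun u => (p u).2)) _ _ _.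
Next Obligation. by move=> X Y U x; split; exact: plot_cst. Qed.
Next Obligation.
by move=> X Y U V f p sf [p1 p2]; split; [exact: plot_comp p1|exact: plot_comp p2].
Qed.
Next Obligation.
by move=> X Y U p H; split; apply: plot_local => u; have [A [oA [Au [p1 p2]]]] := H u;
  exists A, oA.
Qed.

Program Definition powD (k : nat) (X : diffspace) : diffspace :=
  @Diffspace ('I_k -> X) (fun U p => forall i, plot (fun u => p u i)) _ _ _.
Next Obligation. by move=> k X U x i; exact: plot_cst. Qed.
Next Obligation. by move=> k X U V f p sf pp i; exact: plot_comp (pp i). Qed.
Next Obligation.
move=> k X U p H i; apply: plot_local => u; have [A [oA [Au pA]]] := H u.
by exists A, oA.
Qed.

(* Y x_B ... x_B Y, for k >= 1 factors and f : Y -> B *)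
Definition fprod (k : nat) (Y : diffspace) (B : Type) (f : Y -> B) : diffspace :=
  @subD (powD k Y) [set w | forall i j, f (w i) = f (w j)].

Definition fproj k (Y : diffspace) B (f : Y -> B) (i : 'I_k) (w : fprod k f) : Y :=
  val w i.

Lemma fproj_smooth k (Y : diffspace) B (f : Y -> B) i : dsmooth (@fproj k Y B f i).
Proof. by move=> U p; apply. Qed.

Definition fprojD k (Y : diffspace) B (f : Y -> B) i : dmap (fprod k f) Y :=
  Dmap (@fproj_smooth k Y B f i).

Definition induction (X Y : diffspace) (f : X -> Y) : Prop :=
  diffeo (fun x => mkset (imageT f x) : subD (range f)).

End Diffeology.
Arguments diffspace : clear implicits.

Section Quotient.
Context (T : Type) (r : T -> T -> Prop).

(* The quotient of T by the equivalence relation generated by r. *)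
Definition quot : Type :=
  {A : set T | exists s, A = clos_refl_sym_trans T r s}.

Definition cls (s : T) : quot := exist _ _ (ex_intro _ s erefl).

Definition repr (z : quot) : T := projT1 (cid (proj2_sig z)).

Lemma reprK z : cls (repr z) = z.
Proof.
by case: z => A hA; rewrite /repr; case: cid => s /= e; exact: eq_exist.
Qed.

Lemma cls_eq s t : r s t -> cls s = cls t.
Proof.
move=> rst; apply: eq_exist; apply/funext => x; apply/propext; split => h.
  by apply: rst_trans h; exact/rst_sym/rst_step.
by apply: rst_trans h; exact: rst_step.
Qed.

Lemma quot_lift Y (f : T -> Y) s :
  (forall x y, r x y -> f x = f y) -> f (repr (cls s)) = f s.
Proof.
move=> rf; have : clos_refl_sym_trans T r s (repr (cls s)).
  have /(congr1 (@proj1_sig _ _)) /= e := reprK (cls s).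
  by rewrite -e; exact: rst_refl.
by elim=> // [x y /rf //|x y z _ -> _ ->].
Qed.

End Quotient.

Section Extension.
Context {R : realType}.
Local Notation edom := (edom R).
Local Notation diffspace := (diffspace R).

(* The data of an endofunctor of the category of open subsets of Euclidean
   spaces. Its values are presented as diffeological spaces, so that e.g.
   U x R^n need not be recoded as an open subset of R^(n + n). *)
Record efun := Efun {
  eobj :> edom -> diffspace;
  emap : forall U V : edom, (U -> V) -> eobj U -> eobj V }.

Section ExtensionDef.
Context (F : efun) (X : diffspace).

Record pelt := Pelt {
  pdom : edom;
  pmap : pdom -> X;
  pplot : plot pmap;
  pval : F pdom }.

Arguments pmap : clear implicits.
Arguments pplot : clear implicits.
Arguments pval : clear implicits.

Definition prel (s t : pelt) : Prop := exists f : pdom s -> pdom t,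
  [/\ esmooth f, pmap s = pmap t \o f & pval t = emap f (pval s)].

(* the class p_* xi *)
Definition star (U : edom) (p : U -> X) (pp : plot p) (xi : F U) : quot prel :=
  cls prel (Pelt pp xi).

(* the maps u |-> p_* (g u), for a plot p and a smooth g *)
Definition star_plot (U : edom) (q : U -> quot prel) : Prop :=
  exists (V : edom) (p : V -> X) (pp : plot p) (g : U -> F V),
    plot g /\ q = (fun u => star pp (g u)).

Fact star_plot_cst (U : edom) z : star_plot (fun _ : U => z).
Proof.
rewrite -(reprK z); case: (repr z) => V p pp xi.
by exists V, p, pp, (fun=> xi); split=> //; exact: plot_cst.
Qed.

Fact star_plot_comp (U V : edom) (f : U -> V) (q : V -> quot prel) :
  esmooth f -> star_plot q -> star_plot (q \o f).
Proof.
move=> sf [W [p [pp [g [pg ->]]]]]; exists W, p, pp, (g \o f); split=> //.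
exact: plot_comp pg.
Qed.

(* The plots of the quotient of the coproduct of the F U by prel are the maps
   that lift locally to some summand F U. *)
Definition LD : diffspace := gen_diffspace star_plot_cst star_plot_comp.

Lemma starP (z : LD) : exists (U : edom) (p : U -> X) (pp : plot p) (xi : F U),
  z = star pp xi.
Proof. by rewrite -(reprK z); case: (repr z) => U p pp xi; exists U, p, pp, xi. Qed.

Lemma star_eq (U : edom) (p p' : U -> X) (pp : plot p) (pp' : plot p') (xi : F U) :
  p = p' -> star pp xi = star pp' xi.
Proof. by move=> e; subst p'; congr star; exact: Prop_irrelevance. Qed.

Lemma star_comp (U V : edom) (f : U -> V) (p : V -> X) (pp : plot p)
    (ppf : plot (p \o f)) (xi : F U) : esmooth f ->
  star ppf xi = star pp (emap f xi).
Proof. by move=> sf; apply: cls_eq; exists f. Qed.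

End ExtensionDef.
Arguments pmap {F X} p _.
Arguments pplot {F X} p.
Arguments pval {F X} p.

(* Below, maps out of LD F X are given on a representative p_* xi. *)

Definition Lpush (F : efun) (X Y : diffspace) (f : dmap X Y) (z : LD F X) : LD F Y :=
  star (dmapP f (pplot (repr z))) (pval (repr z)).

Lemma LpushE (F : efun) X Y (f : dmap X Y) (U : edom) (p : U -> X) (pp : plot p)
    (xi : F U) :
  Lpush f (star pp xi) = star (dmapP f pp) xi.
Proof.
apply: (@quot_lift _ _ _ (fun s : pelt F X => star (dmapP f (pplot s)) (pval s) : LD F Y)).
move=> [V q pq x] [W q' pq' x'] [g /= [sg e ->]].
rewrite -(star_comp (dmapP f pq') (plot_comp sg (dmapP f pq')))//.
by apply: star_eq; rewrite e.
Qed.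

Lemma Lpush_smooth (F : efun) X Y (f : dmap X Y) : dsmooth (@Lpush F X Y f).
Proof.
move=> U q pq u; have [A [oA [Au [V [p [pp [g [pg e]]]]]]]] := pq u.
exists A, oA; split=> //; exists V, (f \o p), (dmapP f pp), g; split=> //.
apply/funext => w /=.
by rewrite -[q (rincl w)]/((fun w => q (rincl w)) w) e LpushE.
Qed.

Definition LpushD (F : efun) X Y (f : dmap X Y) : dmap (LD F X) (LD F Y) :=
  Dmap (@Lpush_smooth F X Y f).

(* the map induced by a natural transformation *)
Definition Lnat (F G : efun) (alpha : forall U : edom, F U -> G U)
    (X : diffspace) (z : LD F X) : LD G X :=
  star (pplot (repr z)) (alpha _ (pval (repr z))).

End Extension.
Arguments pmap {R F X} p _.
Arguments pplot {R F X} p.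
Arguments pval {R F X} p.

Section Tangent.
Context {R : realType}.
Local Notation edom := (edom R).
Local Notation diffspace := (diffspace R).

(* D_u f (v) *)
Definition ediff (U V : edom) (f : U -> V) (u : U) (v : 'rV[R]_(edim U)) :
    'rV[R]_(edim V) :=
  'D_v (ext (fun w => epoint (f w))) (epoint u).

Definition T_hat : efun :=
  @Efun R (fun U => prodD (edomD U) (eucl (edim U)))
    (fun U V f x => (f x.1, ediff f x.1 x.2)).

Definition Tk_hat (k : nat) : efun :=
  @Efun R (fun U => prodD (edomD U) (powD k (eucl (edim U))))
    (fun U V f x => (f x.1, fun i => ediff f x.1 (x.2 i))).

(* (u, v0, v1, v01) is coded as ((u, v0), (v1, v01)); the last component of the
   action on f is the derivative of (u, v0) |-> D_u f (v0) along (v1, v01). *)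
Definition T2_hat : efun :=
  @Efun R (fun U => prodD (T_hat U) (prodD (eucl (edim U)) (eucl (edim U))))
    (fun U V f x =>
      (emap f x.1,
       (ediff f x.1.1 x.2.1,
        'D_(x.2 : 'rV[R]_(edim U) * 'rV[R]_(edim U))
          (fun y : 'rV[R]_(edim U) * 'rV[R]_(edim U) =>
             'D_(y.2) (ext (fun w => epoint (f w))) y.1)
          (epoint x.1.1, x.1.2)))).

Definition scale_hat (t : R) (U : edom) (x : T_hat U) : T_hat U :=
  (x.1, t *: x.2).

Definition add_hat (U : edom) (x : Tk_hat 2 U) : T_hat U :=
  (x.1, x.2 ord0 + x.2 ord_max).

Definition flip_hat (U : edom) (x : T2_hat U) : T2_hat U :=
  ((x.1.1, x.2.1), (x.1.2, x.2.2)).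

Definition lift_hat (U : edom) (x : T_hat U) : T2_hat U :=
  ((x.1, 0), (0, x.2)).

Definition tangent (X : diffspace) : diffspace := LD T_hat X.

Definition tangent_map (X Y : diffspace) (f : dmap X Y) :
  dmap (tangent X) (tangent Y) := LpushD T_hat f.

Definition tproj (X : diffspace) (z : tangent X) : X :=
  pmap (repr z) (pval (repr z)).1.

Lemma tprojE (X : diffspace) (U : edom) (p : U -> X) (pp : plot p) (xi : T_hat U) :
  tproj (star pp xi) = p xi.1.
Proof.
apply: (@quot_lift _ _ _ (fun s : pelt T_hat X => pmap s (pval s).1)).
by move=> [V q pq x] [W q' pq' x'] [g /= [sg -> ->]].
Qed.

Lemma tproj_smooth (X : diffspace) : dsmooth (@tproj X).
Proof.
move=> U q pq; apply: plot_local => u.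
have [A [oA [Au [V [p [pp [g [[pg _] e]]]]]]]] := pq u.
exists A, oA; split=> //.
rewrite (_ : (fun w => _) = p \o (fun w => (g w).1)); first exact: plot_comp pg pp.
apply/funext => w /=.
by rewrite -[q (rincl w)]/((fun w => q (rincl w)) w) e tprojE.
Qed.

Definition tprojD (X : diffspace) : dmap (tangent X) X := Dmap (@tproj_smooth X).

Definition epunit : edom := @Edom R 0 setT openT.

(* The zero vector at x is represented by the constant plot R^0 -> X at x. *)
Definition tzero (X : diffspace) (x : X) : tangent X :=
  @star _ T_hat X epunit _ (plot_cst epunit x)
    (@mkset _ (eset epunit) 0 Logic.I, 0).

Lemma tzeroE (X : diffspace) (U : edom) (p : U -> X) (pp : plot p) (u : U) :
  tzero (p u) = star pp ((u, 0) : T_hat U).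
Proof.
have sf : esmooth (fun _ : epunit => u) by exact: vsmooth_cst.
rewrite /tzero (@star_eq _ T_hat X epunit _ (p \o (fun=> u)) _ (plot_comp sf pp))//.
rewrite (star_comp pp _ _ sf) /=; congr star; congr pair.
by rewrite /ediff derive0.
Qed.

Definition tscale (X : diffspace) (t : R) : tangent X -> tangent X :=
  @Lnat _ _ _ (scale_hat t) X.

Definition tangentk (k : nat) (X : diffspace) : diffspace := fprod k (@tproj X).

Lemma theta_in (k : nat) (X : diffspace) (s : pelt (Tk_hat k) X) (i j : 'I_k) :
  let w (i : 'I_k) : tangent X :=
    star (F := T_hat) (pplot s) ((pval s).1, (pval s).2 i) in
  tproj (w i) = tproj (w j).
Proof. by rewrite /= !tprojE. Qed.

Definition theta (k : nat) (X : diffspace) (z : LD (Tk_hat k) X) : tangentk k X :=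
  mkset (@theta_in k X (repr z)).

(* U x R^n as an open subset of R^(n + n) *)
Lemma Tdom_open (U : edom) :
  open [set w : 'rV[R]_(edim U + edim U) | eset U (lsubmx w)].
Proof.
apply: (@open_comp _ _ (lsubmx : 'rV[R]_(edim U + edim U) -> _)); last exact: eopen.
by move=> x _; exact: continuous_lsubmx.
Qed.

Definition Tdom (U : edom) : edom := Edom (@Tdom_open U).

Definition Tdom_split (U : edom) (w : Tdom U) : T_hat U :=
  (@mkset _ (eset U) (lsubmx (epoint w)) (epointP w), rsubmx (epoint w)).

Lemma Tdom_join_in (U : edom) (x : T_hat U) :
  eset (Tdom U) (row_mx (epoint x.1) x.2).
Proof. by rewrite /= row_mxKl; exact: (@epointP R U). Qed.

Definition Tdom_join (U : edom) (x : T_hat U) : Tdom U := mkset (@Tdom_join_in U x).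

Lemma Tdom_split_plot (U : edom) : plot (@Tdom_split U).
Proof.
split.
  apply: (@vsmooth_on R (Tdom U) _ lsubmx) => k.
  by apply: kdiff_lin; exact: continuous_lsubmx.
apply: (@vsmooth_on R (Tdom U) _ rsubmx) => k.
by apply: kdiff_lin; exact: continuous_rsubmx.
Qed.

(* T p : T U -> T X as a plot *)
Definition Tplot (X : diffspace) (U : edom) (p : U -> X) (pp : plot p)
    (w : Tdom U) : tangent X :=
  star pp (Tdom_split w).

Lemma Tplot_plot (X : diffspace) (U : edom) (p : U -> X) (pp : plot p) :
  plot (Tplot pp).
Proof.
apply: gen_plotW; first exact: star_plot_comp.
by exists U, p, pp, (@Tdom_split U); split=> //; exact: Tdom_split_plot.
Qed.

(* p_* ((u, v0), (v1, v01)) |-> T^2 p ((u, v0), (v1, v01)) *)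
Definition theta2 (X : diffspace) (z : LD T2_hat X) : tangent (tangent X) :=
  let s := repr z in
  star (F := T_hat) (Tplot_plot (pplot s))
    (Tdom_join (pval s).1, row_mx (pval s).2.1 (pval s).2.2).

Lemma nu_in (k : nat) (X : diffspace) (z : tangent (tangentk k X)) (i j : 'I_k) :
  let w (i : 'I_k) := tangent_map (fprojD (@tproj X) i) z in
  tangent_map (tprojD X) (w i) = tangent_map (tprojD X) (w j).
Proof.
have [U [p [pp [xi ->]]]] := starP z.
have E l : tangent_map (fprojD (@tproj X) l) (star pp xi) =
    star (dmapP (fprojD (@tproj X) l) pp) xi by exact: LpushE.
move=> w; rewrite /w !E [LHS]LpushE [RHS]LpushE.
apply: star_eq; apply/funext => u /=.
by have /(_ i j) := set_valP (p u).
Qed.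

Definition nu (k : nat) (X : diffspace) (z : tangent (tangentk k X)) :
    fprod k (tangent_map (tprojD X)) :=
  mkset (@nu_in k X z).

Definition tlift (X : diffspace) (z : tangent X) : tangent (tangent X) :=
  theta2 (Lnat lift_hat z).

Definition is_flip (X : diffspace)
    (tau : dmap (tangent (tangent X)) (tangent (tangent X))) : Prop :=
  forall z, tau (theta2 z) = theta2 (Lnat flip_hat z).

Record elastic14 (X : diffspace) : Prop := Elastic14 {
  elastic1 : forall k, (0 < k)%N -> diffeo (@theta k X);
  elastic2 : exists tau, @is_flip X tau;
  elastic3 : induction (@tlift X);
  elastic4 : forall k, (0 < k)%N -> injective (@nu k X) }.

Record elastic (X : diffspace) : Prop := Elastic {
  elastic_14 : elastic14 X;
  elastic5 : forall ks : seq nat, all (fun k => (0 < k)%N) ks ->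
    elastic14 (foldr tangentk X ks) }.

Definition tadd (X : diffspace) (hX : elastic X) (w : tangentk 2 X) : tangent X :=
  let theta2V := projT1 (cid (elastic1 (elastic_14 hX) (isT : (0 < 2)%N))) in
  Lnat add_hat (theta2V w).

Definition tflip (X : diffspace) (hX : elastic X) :
    dmap (tangent (tangent X)) (tangent (tangent X)) :=
  projT1 (cid (elastic2 (elastic_14 hX))).

End Tangent.

Section Convenient.
Context {R : realType}.
Local Notation edom := (edom R).
Implicit Types E F : tvsType R.

Definition curve_derivative_at E (c : R -> E) (t : R) (l : E) : Prop :=
  (fun h : R => h^-1 *: (c (h + t) - c t)) @ 0^' --> l.

Definition curve_derivable E (c : R -> E) (t : R) : Prop :=
  exists l, curve_derivative_at c t l.

Definition curve_derive E (c : R -> E) (t : R) : E :=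
  xget 0 [set l | curve_derivative_at c t l].

Definition smooth_curve E (c : R -> E) : Prop :=
  forall k t, curve_derivable (iter k (@curve_derive E) c) t.

Definition Dc E (U : edom) (p : U -> E) : Prop :=
  forall c : R -> U, curve_smooth (fun t => epoint (c t)) -> smooth_curve (p \o c).

Definition PiL E (U : edom) (p : U -> E) : Prop :=
  forall l : {linear E -> R^o}, continuous l -> vsmooth (l \o p).

Definition convenient E : Prop :=
  hausdorff_space E /\ forall (U : edom) (p : U -> E), Dc p <-> PiL p.

Definition cinf_open E (A : set E) : Prop :=
  forall c : R -> E, smooth_curve c -> open (c @^-1` A).

Definition Dc_smooth_on E F (A : set E) (f : E -> F) : Prop :=
  forall (U : edom) (p : U -> E), (forall u, A (p u)) -> Dc p -> Dc (f \o p).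

Fact Dc_cst E (U : edom) (x : E) : Dc (fun _ : U => x).
Proof.
move=> c _ k; rewrite (_ : _ \o c = cst x)//.
have cstE y : exists z, iter k (@curve_derive E) (cst y) = cst z.
  elim: k y => [|k IH] y; first by exists y.
  rewrite iterSr (_ : curve_derive (cst y) = cst (curve_derive (cst y) 0))//.
have [z ->] := cstE x; move=> t; exists 0.
rewrite /curve_derivative_at (_ : (fun h => _) = cst 0); first exact: cvg_cst.
by apply/funext => h /=; rewrite subrr scaler0.
Qed.

Fact Dc_comp E (U V : edom) (f : U -> V) (p : V -> E) :
  esmooth f -> Dc p -> Dc (p \o f).
Proof. by move=> sf Dp c sc; apply: (Dp (f \o c)); exact: curve_smooth_comp. Qed.

End Convenient.

Section Manifold.
Context {R : realType}.
Local Notation edom := (edom R).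

(* An atlas: achart i matters only on its domain adom i; the axioms of convenient
   manifolds are in is_convman below. *)
Record atlas := Atlas {
  acar :> Type;
  aidx : Type;
  amod : aidx -> tvsType R;
  adom : aidx -> set acar;
  achart : forall i, acar -> amod i;
  acover : forall x, exists i, adom i x }.

Arguments adom : clear implicits.
Arguments achart : clear implicits.

(* achart N j \o f \o (achart M i)^-1 *)
Definition local_rep (M N : atlas) (f : M -> N) (i : aidx M) (j : aidx N)
    (x : amod i) : amod j :=
  xget 0 [set y | exists m,
    [/\ adom M i m, adom N j (f m), achart M i m = x & achart N j (f m) = y]].

Definition transition (M : atlas) (i j : aidx M) : amod i -> amod j :=
  @local_rep M M id i j.

(* open for the final topology of the inverses of the charts *)
Definition man_open (M : atlas) (A : set M) : Prop :=
  forall i, cinf_open (achart M i @` (A `&` adom M i)).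

Record is_convman (M : atlas) : Prop := IsConvman {
  cm_model : forall i : aidx M, convenient (amod i);
  cm_inj : forall (i : aidx M) x y,
    adom M i x -> adom M i y -> achart M i x = achart M i y -> x = y;
  cm_open : forall i : aidx M, cinf_open (achart M i @` adom M i);
  cm_overlap : forall i j : aidx M,
    cinf_open (achart M i @` (adom M i `&` adom M j));
  cm_transition : forall i j : aidx M,
    Dc_smooth_on (achart M i @` (adom M i `&` adom M j)) (@transition M i j);
  cm_hausdorff : forall x y : M, x <> y -> exists A B : set M,
    [/\ man_open A, man_open B, A x, B y & A `&` B = set0] }.

Definition convman_smooth (M N : atlas) (f : M -> N) : Prop :=
  forall i j, let A := achart M i @` (adom M i `&` f @^-1` adom N j) in
    cinf_open A /\ Dc_smooth_on A (@local_rep M N f i j).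

Definition chart_plot (M : atlas) (U : edom) (p : U -> M) : Prop :=
  exists i, (forall u, adom M i (p u)) /\ Dc (achart M i \o p).

Fact chart_plot_cst (M : atlas) (U : edom) (x : M) : chart_plot (fun _ : U => x).
Proof. by have [i xi] := acover x; exists i; split=> //; exact: Dc_cst. Qed.

Fact chart_plot_comp (M : atlas) (U V : edom) (f : U -> V) (p : V -> M) :
  esmooth f -> chart_plot p -> chart_plot (p \o f).
Proof.
by move=> sf [i [ip Dp]]; exists i; split=> [u|]; [exact: ip|exact: Dc_comp sf Dp].
Qed.

(* The plots are the maps that are locally smooth in some chart. *)
Definition manD (M : atlas) : diffspace R :=
  gen_diffspace (@chart_plot_cst M) (@chart_plot_comp M).

End Manifold.
Arguments atlas : clear implicits.
Arguments adom {R} a i _.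
Arguments achart {R} a i _.

Section KrieglMichor.
Context {R : realType}.
Local Notation atlas := (atlas R).

Definition S_hat (E F : tvsType R) (f : E -> F) (x : E * E) : F * F :=
  (f x.1, curve_derive (fun t => f (x.1 + t *: x.2)) 0).

(* The element (achart M i m, v) of S_hat (achart M i @` adom M i) is coded
   as (i, (m, v)). *)
Definition spre (M : atlas) : Type :=
  {i : aidx M & (set_type (adom M i) * amod i)%type}.

Definition srel (M : atlas) (s s' : spre M) : Prop :=
  let: existT i (m, v) := s in
  let: existT j (m', v') := s' in
  val m = val m' /\
  S_hat (@transition R M i j) (achart M i (val m), v) = (achart M j (val m'), v').

Definition svec (M : atlas) (i : aidx M) (m : set_type (adom M i)) (v : amod i) :
    quot (@srel M) :=
  cls (@srel M) (existT _ i (m, v)).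

Definition sdom (M : atlas) (i : aidx M) : set (quot (@srel M)) :=
  [set z | exists s : set_type (adom M i) * amod i, z = svec s.1 s.2].

Definition schart (M : atlas) (i : aidx M) (z : quot (@srel M)) :
    (amod i * amod i)%type :=
  xget 0 [set w | exists2 s : set_type (adom M i) * amod i,
    z = svec s.1 s.2 & w = (achart M i (val s.1), s.2)].

Lemma scover (M : atlas) (z : quot (@srel M)) : exists i, sdom i z.
Proof. by rewrite -(reprK z); case: (repr z) => i [m v]; exists i, (m, v). Qed.

(* S M, with the charts S_hat (achart M i). *)
Definition kmS (M : atlas) : atlas :=
  @Atlas R (quot (@srel M)) (aidx M) (fun i => (amod i * amod i)%type)
    (@sdom M) (@schart M) (@scover M).

Lemma svec_dom (M : atlas) (i : aidx M) (m : set_type (adom M i)) (v : amod i) :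
  adom (kmS M) i (svec m v).
Proof. by exists (m, v). Qed.

Definition choose_chart (M : atlas) (m : M) : {i : aidx M & set_type (adom M i)} :=
  let h := cid (acover m) in 
  existT _ (projT1 h) (@mkset _ (adom M (projT1 h)) m (projT2 h)).

Definition smap (M N : atlas) (f : M -> N) (z : kmS M) : kmS N :=
  let: existT i (m, v) := repr z in
  let: existT j n := choose_chart (f (val m)) in
  svec n (S_hat (@local_rep R M N f i j) (achart M i (val m), v)).2.

Definition sproj (M : atlas) (z : kmS M) : M := val (projT2 (repr z)).1.

Definition szero (M : atlas) (m : M) : kmS M := svec (projT2 (choose_chart m)) 0.

Definition sscale (M : atlas) (t : R) (z : kmS M) : kmS M :=
  let: existT i (m, v) := repr z in svec m (t *: v).

Definition kmS2 (M : atlas) : diffspace R :=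
  fprod 2 (@sproj M : manD (kmS M) -> M).

Definition sadd (M : atlas) (w : kmS2 M) : kmS M :=
  let: existT i (m, v0) := repr (fproj ord0 w : kmS M) in
  svec m (v0 + (achart (kmS M) i (fproj ord_max w)).2).

(* A tangent vector of kmS M is (i, (y, (v1, v01))) with y = (i, (m, v0)); this
   is (u, v0, v1, v01) in the chart i, for u = achart M i m. *)
Definition sflip (M : atlas) (z : kmS (kmS M)) : kmS (kmS M) :=
  let: existT i (y, w) := repr z in
  let: (m, v0) := projT1 (cid (set_valP y)) in
  @svec (kmS M) i (mkset (svec_dom m w.1)) (v0, w.2).

Definition slift (M : atlas) (z : kmS M) : kmS (kmS M) :=
  let: existT i (m, v) := repr z in
  @svec (kmS M) i (mkset (svec_dom m 0)) (0, v).

End KrieglMichor.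

(* Main.v *)
(* A tangent vector of a diffeological space X with a chart into a convenient
   space E is determined by its base point and its derivative in the chart. By
   Hadamard's lemma, a smooth P(s) differs from its affine part by a sum of terms
   s_i s_j r_ij(s) with r_ij smooth; and a term a b r with a and b vanishing at the
   base point does not change tangent vectors, since P and P + a b r are the
   pullbacks of P(s) + t r(s) along s |-> (s, 0) and s |-> (s, a(s) b(s)), which have
   the same derivative. Hence T X, T_k X and T^2 X have charts with values in E x E,
   E x E^k and E^4. So spaces with such charts are stable under T_k, and the
   elasticity axioms can be verified in coordinates: the existence of the flip is
   the symmetry of second derivatives.

   The charts of a convenient manifold M are such charts, as c^oo-open sets have
   open preimages under smooth maps (special curve lemma). The map S M -> T M sends
   (u, v) to the class of the line u + t v; in the charts of S M and T M it is the
   identity, so S M inherits its manifold structure from T M, and all structure maps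
   correspond because they have the same expression in these charts. *)

From HB Require Import structures.
Require Import Defs.
From mathcomp Require Import all_boot all_order all_algebra.
From mathcomp Require Import all_classical all_reals all_analysis.
From mathcomp Require Import ring lra.

Import Defs.

Set Implicit Arguments.
Unset Strict Implicit.
Unset Printing Implicit Defensive.

Import Order.TTheory GRing.Theory Num.Theory.
Import numFieldNormedType.Exports.

Local Open Scope classical_set_scope.
Local Open Scope ring_scope.

(** * Calculus in finite dimensions *)

(** A vector of a convenient space [E] is controlled only through continuous functionals, and
    integrals with values in [E] are avoided. So Hadamard's remainder is defined pointwise, as a
    difference quotient off the hyperplane [s_j = 0] and as a derivative on it. Only its composites
    with functionals are integrals, and these are smooth by differentiation under the integral sign.
    The objects that must exist in [E] itself are directional derivatives, and this is where the
    equality of [Dc] and [PiL] enters.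

    Accordingly a model space [cvs] keeps a vector space, a separating set of functionals and the
    existence of derivatives. Products and powers of models then need no topology; the price is that
    [E x E] carries two sets of functionals, which must be shown to test the same smooth maps.

    Plots live on open sets while curves are defined on all of [R]. Hence lines are reparametrized
    or continued by arbitrary values, and the curves of the special curve lemma are kept inside a
    given ball. *)

Section Calculus.
Context {R : realType}.
Implicit Types V W : normedModType R.

Lemma is_derive_line V W (f : V -> W) x v (t : R) : differentiable f (x + t *: v) ->
  is_derive t 1 (fun s : R => f (x + s *: v)) ('D_v f (x + t *: v)).
Proof.
move=> df; pose l := fun s : R => x + s *: v.
have dl : differentiable l t.
  by apply: (@differentiableD _ _ _ (cst x) (fun s : R => s *: v)).
have ld : 'd l t 1 = v.
  rewrite /l (_ : (fun s : R => _) = cst x + (fun s : R => s *: v)); last by apply/funext.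
  rewrite diffD//= diff_cst /= add0r.
  by rewrite (@diffZl _ _ _ id v t)//= diff_val scale1r.
have dfl : differentiable (f \o l) t by exact: differentiable_comp.
apply: DeriveDef; first exact: diff_derivable.
rewrite -[LHS]/('D_1 (f \o l) t) deriveE // diff_comp //= ld deriveE //.
Qed.

Lemma mvt_line V (f : V -> R) x v :
  (forall t : R, 0 <= t <= 1 -> differentiable f (x + t *: v)) ->
  exists2 t : R, 0 < t < 1 & f (x + v) - f x = 'D_v f (x + t *: v).
Proof.
move=> df.
have [|t|t t01] := @MVT R (fun s : R => f (x + s *: v)) (fun s => 'D_v f (x + s *: v)) 0 1 ltr01.
- move=> t /itvP t01; apply: is_derive_line; apply: df.
  by rewrite !t01.
- apply: derivable_within_continuous => {}t /itvP t01.
  have h := @is_derive_line _ _ f x v t; apply: (@ex_derive _ _ _ _ _ _ _ (h _)).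
  by apply: df; rewrite !t01.
- by rewrite scale1r scale0r addr0 subr0 mulr1 => ->; exists t => //; rewrite !(itvP t01).
Qed.

Lemma derive_linear V W (f : V -> W) x : differentiable f x ->
  forall a u v, 'D_(a *: u + v) f x = a *: 'D_u f x + 'D_v f x.
Proof. by move=> df a u v; rewrite !deriveE // linearP. Qed.

Lemma ball_line V (x v : V) (d t : R) : `|v| < d -> 0 <= t <= 1 -> ball x d (x + t *: v).
Proof.
move=> vd /andP[t0 t1]; rewrite -ball_normE /ball_/= opprD addNKr normrN normrZ.
by rewrite (ger0_norm t0); apply: le_lt_trans vd; rewrite ler_piMl.
Qed.

Lemma deriveZv V W (f : V -> W) x : differentiable f x ->
  forall a v, 'D_(a *: v) f x = a *: 'D_v f x.
Proof. by move=> df a v; rewrite !deriveE // linearZ. Qed.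

Lemma deriveDv V W (f : V -> W) x : differentiable f x ->
  forall u v, 'D_(u + v) f x = 'D_u f x + 'D_v f x.
Proof. by move=> df u v; rewrite !deriveE // linearD. Qed.

Lemma derivable_shift V W (f : V -> W) x v w : derivable f (x + w) v ->
  is_derive x v (fun y => f (y + w)) ('D_v f (x + w)).
Proof.
move=> df; have E : (fun h : R => h^-1 *: (((fun y => f (y + w)) \o shift x) (h *: v) - f (x + w)))
  = (fun h : R => h^-1 *: ((f \o shift (x + w)) (h *: v) - f (x + w))).
  by apply/funext => h /=; rewrite addrA.
by apply: DeriveDef; rewrite /derivable /derive E.
Qed.

Lemma differentiable_shift V W (f : V -> W) x w : differentiable f (x + w) ->
  differentiable (fun y => f (y + w)) x.
Proof.
by move=> df; apply: (@differentiable_comp _ _ _ _ (fun y => y + w) f).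
Qed.

Lemma near_derive V W (f g : V -> W) x v :
  (\forall y \near x, f y = g y) -> 'D_v f x = 'D_v g x.
Proof.
have [->|v0] := eqVneq v 0; first by rewrite !derive0.
exact: near_eq_derive.
Qed.

(** The mean value theorem is used twice: along [v] for [y |-> f (y + w) - f y], then along [w] for
    ['D_v f]. *)
Lemma second_difference V (f : V -> R) x v w d : `|v| + `|w| < d ->
  kdiff 2 (ball x d) f ->
  exists2 y, ball x d y &
    f (x + v + w) - f (x + v) - (f (x + w) - f x) = 'D_w ('D_v f) y.
Proof.
move=> vwd [df dkf].
have bD (s t : R) : 0 <= s <= 1 -> 0 <= t <= 1 -> ball x d (x + s *: v + t *: w).
  move=> /andP[s0 s1] /andP[t0 t1].
  rewrite -ball_normE /ball_/= -addrA opprD addNKr normrN.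
  apply: le_lt_trans vwd; apply: le_trans (ler_normD _ _) _; rewrite !normrZ.
  by rewrite (ger0_norm s0) (ger0_norm t0) lerD// ler_piMl.
have z01 : 0 <= (0 : R) <= 1 by rewrite lexx ler01.
have o01 : 0 <= (1 : R) <= 1 by rewrite lexx ler01.
have bS (s : R) : 0 <= s <= 1 -> ball x d (x + s *: v).
  by move=> s01; have := bD s 0 s01 z01; rewrite scale0r addr0.
pose g y := f (y + w) - f y.
have dg (s : R) : 0 <= s <= 1 -> differentiable g (x + s *: v).
  move=> s01; apply: (@differentiableB _ _ _ (fun y => f (y + w)) f).
    by apply: differentiable_shift; apply: df; have := bD s 1 s01 o01; rewrite scale1r.
  by apply: df; exact: bS.
have [s s01 gE] := mvt_line dg.
have s01' : 0 <= s <= 1 by case/andP: s01 => *; rewrite !ltW.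
have dvf (t : R) : 0 <= t <= 1 -> differentiable ('D_v f) (x + s *: v + t *: w).
  by move=> t01; apply: (dkf v).1; exact: bD.
have [t t01 fE] := mvt_line dvf.
have t01' : 0 <= t <= 1 by case/andP: t01 => *; rewrite !ltW.
exists (x + s *: v + t *: w); first exact: bD.
rewrite -fE -[LHS]/(g (x + v) - g x) gE /g deriveB.
- congr (_ - _); apply: derive_val; apply: derivable_shift; apply: diff_derivable; apply: df.
  by have := bD s 1 s01' o01; rewrite scale1r.
- have := @derivable_shift _ _ f (x + s *: v) v w.
  case=> //; apply: diff_derivable; apply: df.
  by have := bD s 1 s01' o01; rewrite scale1r.
- by apply: diff_derivable; apply: df; exact: bS.
Qed.

(** The second difference is symmetric in its two increments. For the increments [t v] and [t w] it
    is [t^2] times a mixed derivative of either order at a point near [x], and third-order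
    differentiability makes both mixed derivatives continuous. *)
Lemma derive_swap V (A : set V) (f : V -> R) x v w : open A -> A x ->
  kdiff 3 A f -> 'D_v ('D_w f) x = 'D_w ('D_v f) x.
Proof.
move=> oA Ax kf.
have cf a b : {for x, continuous ('D_a ('D_b f))}.
  by apply: differentiable_continuous; apply: ((kf.2 b).2 a).1.
apply/eqP; rewrite -subr_eq0 -normr_le0; apply/ler_addgt0Pl => e e0; rewrite addr0.
have e2 : 0 < e / 2 by rewrite divr_gt0.
have near_x : \forall y \near x, [/\ A y, `|'D_v ('D_w f) x - 'D_v ('D_w f) y| < e / 2 &
    `|'D_w ('D_v f) x - 'D_w ('D_v f) y| < e / 2].
  have [hv hw] : (\forall y \near x, `|'D_v ('D_w f) x - 'D_v ('D_w f) y| < e / 2) /\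
      (\forall y \near x, `|'D_w ('D_v f) x - 'D_w ('D_v f) y| < e / 2).
    by split; [have /cvgr_dist_lt := cf v w|have /cvgr_dist_lt := cf w v]; apply.
  by apply: filterS3 (open_nbhs_nbhs (conj oA Ax)) hv hw => y; split.
have /nbhs_ballP[d /= d0 bd] := near_x.
(* The [+ 1] keeps the denominator positive when [v = w = 0] and makes the next bound strict. *)
pose t := d / (`|v| + `|w| + 1).
have N0 : 0 < `|v| + `|w| + 1 by rewrite ltr_pwDr// addr_ge0.
have t0 : 0 < t by rewrite divr_gt0.
have small : `|t *: v| + `|t *: w| < d.
  rewrite [`|t *: v|]normrZ [`|t *: w|]normrZ -mulrDr (gtr0_norm t0).
  rewrite /t -mulrA gtr_pMr// mulrC ltr_pdivrMr//.
  by rewrite mul1r ltrDl.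
have kb : kdiff 3 (ball x d) f by apply: kdiff_sub kf => y /bd[].
have [y yb yE] := second_difference small (kdiffW kb).
rewrite addrC in small.
have [z zb zE] := second_difference small (kdiffW kb).
have DE a b u : ball x d u -> 'D_(t *: a) ('D_(t *: b) f) u = t * t * 'D_a ('D_b f) u.
  move=> bu; have -> : 'D_(t *: a) ('D_(t *: b) f) u = 'D_(t *: a) (t *: 'D_b f) u.
    apply: near_derive.
    have nu : nbhs u (ball x d) by apply: open_nbhs_nbhs; split => //; exact: ball_open.
    apply: filterS nu => q bq.
    by rewrite deriveZv//; exact: kb.1.
  have dd : differentiable ('D_b f) u by exact: (kb.2 b).1.
  rewrite deriveZ; last exact: diff_derivable.
  by rewrite deriveZv// scalerA.
have : 'D_v ('D_w f) z = 'D_w ('D_v f) y.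
  apply: (@mulfI _ (t * t)); first by rewrite mulf_neq0// gt_eqF.
  apply: (etrans (esym (DE v w z zb))); apply: (etrans _ (DE w v y yb)); rewrite -yE -zE.
  rewrite (_ : x + t *: w + t *: v = x + t *: v + t *: w); last by rewrite addrAC.
  by rewrite opprB addrACA !addrA; ring.
move=> yz; have [_ h1 _] := bd _ zb; have [_ _ h2] := bd _ yb.
rewrite -yz in h2.
move: h1 h2; clear; move: ('D_v ('D_w f) x) ('D_w ('D_v f) x) ('D_v ('D_w f) z) => a b c h1 h2.
apply: ltW; rewrite (splitr e); apply: le_lt_trans (ler_distD c _ _) _.
by rewrite [X in _ + X]distrC ltrD.
Qed.
End Calculus.

(** * Differentiation under the integral sign *)

Section ParameterIntegral.
Context {R : realType}.

Local Notation mean f := (\int[lebesgue_measure]_(t in `[(0 : R), 1]) f t)%R.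

Lemma linear_bundle (V W : lmodType R) (L : V -> W) : linear L ->
  exists l : {linear V -> W}, l = L :> (V -> W).
Proof.
move=> aL; pose hL := GRing.isLinear.Build _ _ _ _ L aL.
pose l : {linear V -> W} := HB.pack L hL.
by exists l.
Qed.

Lemma differentiable_expansion (V W : normedModType R) (f : V -> W) a (l : {linear V -> W}) :
  continuous l ->
  (forall e, 0 < e -> \forall x \near (0 : V), `|f (x + a) - f a - l x| <= e * `|x|) ->
  differentiable f a /\ forall v, 'D_v f a = l v.
Proof.
move=> cl H; have e0 : f \o shift a = cst (f a) + l +o_ 0 id.
  apply/eqaddoP => _/posnumP[e].
  apply: filterS (H e%:num _) => // x /=.
  by rewrite !fctE /= opprD addrA.
have dl := diff_unique cl e0.
have df : differentiable f a by apply/diff_locallyP; rewrite dl; split.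
by split=> // v; rewrite deriveE// dl.
Qed.

Lemma row_coord_le n (x : 'rV[R]_n) i : `|x ord0 i| <= `|x|.
Proof. by rewrite [leRHS]/Num.Def.normr /= mx_normrE; apply/bigmax_geP; right => /=; exists (ord0, i). Qed.

Lemma differentiable_of_expansion n (f : 'rV[R]_n -> R) a (c : 'I_n -> R) :
  (forall e, 0 < e -> \forall x \near (0 : 'rV[R]_n),
    `|f (x + a) - f a - \sum_i x ord0 i * c i| <= e * `|x|) ->
  differentiable f a /\ forall v, 'D_v f a = \sum_i v ord0 i * c i.
Proof.
move=> H; pose L (x : 'rV[R]_n) : R := \sum_i x ord0 i * c i.
have aL : linear L.
  move=> k u v; rewrite /L scaler_sumr -big_split/=; apply: eq_bigr => i _.
  by rewrite !mxE mulrDl -mulrA.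
have [l lE] := linear_bundle aL.
have cl : continuous l.
  rewrite lE => x; apply: differentiable_continuous.
  rewrite /L (_ : (fun x : 'rV_n => _) = \sum_i (fun x : 'rV[R]_n => x ord0 i * c i)).
    apply: differentiable_sum => i; apply: (@differentiableM _ _ (fun x : 'rV[R]_n => x ord0 i) (cst (c i))) => //.
    exact: differentiable_coord.
  by apply/funext => y; rewrite fct_sumE.
have [|df dfE] := differentiable_expansion cl (f := f) (a := a).
  by move=> e /H; rewrite lE.
by split=> // v; rewrite dfE lE.
Qed.

Definition cont01 (f : R -> R) := forall t : R, 0 <= t <= 1 -> {for t, continuous f}.

Lemma cont01_within f : cont01 f -> {within `[0, 1], continuous f}.
Proof.
move=> cf; apply: continuous_in_subspaceT => t; rewrite inE /= in_itv /= => t01; exact: cf.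
Qed.

Lemma integrable01 (f : R -> R) : cont01 f ->
  lebesgue_measure.-integrable `[(0 : R), 1] (EFin \o f).
Proof.
by move=> /cont01_within cf; apply: continuous_compact_integrable => //; exact: segment_compact.
Qed.

Lemma cont01D (f g : R -> R) : cont01 f -> cont01 g -> cont01 (fun t => f t + g t).
Proof. by move=> cf cg t t01; apply: continuousD; [exact: cf|exact: cg]. Qed.

Lemma cont01M (f g : R -> R) : cont01 f -> cont01 g -> cont01 (fun t => f t * g t).
Proof. by move=> cf cg t t01; apply: continuousM; [exact: cf|exact: cg]. Qed.

Lemma cont01_cst (c : R) : cont01 (fun=> c).
Proof. by move=> t _; exact: cst_continuous. Qed.

Lemma cont01_sum n (F : 'I_n -> R -> R) :
  (forall i, cont01 (F i)) -> cont01 (fun t => \sum_i F i t).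
Proof.
elim: n F => [|n IH] F cF.
  by under [fun t => _]eq_fun do rewrite big_ord0; exact: cont01_cst.
under [fun t => _]eq_fun do rewrite big_ord_recl.
by apply: cont01D => //; exact: IH.
Qed.

Lemma meanD (f g : R -> R) : cont01 f -> cont01 g ->
  mean (fun t => f t + g t) = mean f + mean g.
Proof. by move=> cf cg; rewrite RintegralD//; exact: integrable01. Qed.

Lemma meanB (f g : R -> R) : cont01 f -> cont01 g ->
  mean (fun t => f t - g t) = mean f - mean g.
Proof. by move=> cf cg; rewrite RintegralB//; exact: integrable01. Qed.

Lemma meanZ (f : R -> R) r : cont01 f -> mean (fun t => r * f t) = r * mean f.
Proof. by move=> cf; rewrite RintegralZl//; exact: integrable01. Qed.

Lemma mean_sum n (F : 'I_n -> R -> R) : (forall i, cont01 (F i)) ->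
  mean (fun t => \sum_i F i t) = \sum_i mean (F i).
Proof.
elim: n F => [|n IH] F cF.
  by under eq_Rintegral do rewrite big_ord0; rewrite Rintegral_cst// mul0r big_ord0.
under eq_Rintegral do rewrite big_ord_recl.
by rewrite meanD ?IH ?big_ord_recl//; exact: cont01_sum.
Qed.

Lemma mean_le (f : R -> R) e : cont01 f ->
  (forall t : R, 0 <= t <= 1 -> `|f t| <= e) -> `|mean f| <= e.
Proof.
move=> cf fe; apply: le_trans (le_normr_Rintegral _ _) _ => //; first exact: integrable01.
have := @le_Rintegral _ _ R lebesgue_measure `[(0 : R), 1] (fun t => `|f t|) (fun=> e).
rewrite Rintegral_cst//= lebesgue_measure_itv/= lte01 oppr0 adde0 mulr1; apply => //.
- apply: integrable01 => t t01; apply: (continuous_comp (cf t t01)); exact: norm_continuous.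
- by apply: integrable01; exact: cont01_cst.
Qed.

Lemma mean_ftc (F f : R -> R) : cont01 f ->
  (forall t : R, 0 <= t <= 1 -> is_derive t 1 F (f t)) -> mean f = F 1 - F 0.
Proof.
move=> cf dF; rewrite /Rintegral (continuous_FTC2 ltr01 (cont01_within cf) (F := F))//.
have cF (t : R) : 0 <= t <= 1 -> {for t, continuous F}.
  by move=> /dF[dt _]; apply: differentiable_continuous; exact/derivable1_diffP.
- split=> [t /itvP t01| |].
  + by apply: ex_derive; apply: dF; rewrite !t01.
  + by apply: cvg_at_right_filter; apply: cF; rewrite lexx ler01.
  + by apply: cvg_at_left_filter; apply: cF; rewrite lexx ler01.
- by move=> t /itvP t01; rewrite derive1E; apply: derive_val; apply: dF; rewrite !t01.
Qed.

(** For each [t] the mean value theorem in [s] writes the error of the linear approximation as a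
    difference of values of [dH t] at two nearby points. It is small uniformly in [t], hence so is
    its integral. *)
Lemma differentiable_mean n (A : set 'rV[R]_n) (H : R -> 'rV[R]_n -> R)
    (dH : R -> 'rV[R]_n -> 'rV[R]_n -> R) a : open A -> A a ->
  (forall s, A s -> cont01 (H ^~ s)) ->
  (forall t s, 0 <= t <= 1 -> A s -> differentiable (H t) s) ->
  (forall t s v, 0 <= t <= 1 -> A s -> 'D_v (H t) s = dH t s v) ->
  (forall t s v, 0 <= t <= 1 -> A s ->
     {for (t, s), continuous (fun p : R * 'rV[R]_n => dH p.1 p.2 v)}) ->
  let G s := mean (H ^~ s) in
  differentiable G a /\ forall v, 'D_v G a = mean (fun t => dH t a v).
Proof.
move=> oA Aa cH dfH dHE cdH G.
have cdHa v : cont01 (fun t => dH t a v).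
  move=> t t01; apply: (@continuous_comp _ _ _ (fun t => (t, a)) (fun p : R * 'rV[R]_n => dH p.1 p.2 v)).
    move=> P [[U V] /= [Ut Va] UV]; apply: filterS Ut => s Us; apply: UV; split=> //.
    exact: nbhs_singleton.
  exact: cdH.
have linH t s : 0 <= t <= 1 -> A s ->
    forall v, dH t s v = \sum_i v ord0 i * dH t s (delta_mx ord0 i).
  move=> t01 As v; rewrite -dHE// {1}(row_coord v) deriveE; last exact: dfH.
  rewrite linear_sum; apply: eq_bigr => i _.
  by rewrite linearZ /= -dHE// deriveE//; exact: dfH.
have meanE (v : 'rV[R]_n) : \sum_i v ord0 i * mean (fun t => dH t a (delta_mx ord0 i)) =
    mean (fun t => dH t a v).
  transitivity (mean (fun t => \sum_i v ord0 i * dH t a (delta_mx ord0 i))).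
    rewrite mean_sum => [|i]; last by apply: cont01M => //; exact: cont01_cst.
    by apply: eq_bigr => i _; rewrite meanZ.
  by apply: eq_Rintegral => t; rewrite inE /= in_itv /= => t01; rewrite -linH.
have [|dG dGE] := @differentiable_of_expansion n G a
    (fun i => mean (fun t => dH t a (delta_mx ord0 i))); last first.
  by split=> // v; rewrite dGE meanE.
(* Each of the [n] coordinates contributes at most [e'] times the norm of [x]; the successor also
   covers [n = 0]. *)
move=> e e0; pose e' := e / n.+1%:R.
have e'0 : 0 < e' by rewrite divr_gt0.
(* Compactness of [[0, 1]] turns joint continuity of [dH] into continuity in [s] that is uniform in
   [t]. *)
have near_i i : \forall s \near a, forall t : R, 0 <= t <= 1 ->
    `|dH t s (delta_mx ord0 i) - dH t a (delta_mx ord0 i)| <= e'.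
  have := @segment_compact R 0 1 => /compact_near_coveringP.
  move=> /(_ _ (nbhs a) (fun s t => `|dH t s (delta_mx ord0 i) - dH t a (delta_mx ord0 i)| <= e')).
  move=> h; apply: filterS (h _ _) => [s hs t t01|]; first by apply: hs; rewrite /= in_itv.
  move=> t; rewrite /= in_itv /= => t01.
  have /cvgr_dist_lt c1 := cdH t a (delta_mx ord0 i) t01 Aa.
  have e2 : 0 < e' / 2 by rewrite divr_gt0.
  have [[U V] /= [Ut Va] UV] := c1 _ e2.
  exists (U, V) => // -[t' s] [/= Ut' Vs].
  have h1 := UV (t', s) (conj Ut' Vs).
  have h2 := UV (t', a) (conj Ut' (nbhs_singleton Va)).
  move: h1 h2 => /=; move: (dH t a _) (dH t' s _) (dH t' a _) => x y z h1 h2.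
  rewrite (splitr e'); apply: le_trans (ler_distD x _ _) _.
  by rewrite distrC lerD// ltW.
have near_all : \forall s \near a, forall i (t : R), 0 <= t <= 1 ->
    `|dH t s (delta_mx ord0 i) - dH t a (delta_mx ord0 i)| <= e'.
  exact: filter_forall near_i.
have near_b : \forall s \near a, A s /\ forall i (t : R), 0 <= t <= 1 ->
    `|dH t s (delta_mx ord0 i) - dH t a (delta_mx ord0 i)| <= e'.
  apply: filterS2 (open_nbhs_nbhs (conj oA Aa)) near_all; by split.
have /nbhs_ballP[d /= d0 bd] := near_b.
have nb0 : nbhs (0 : 'rV[R]_n) (ball 0 d) by exact: nbhsx_ballx.
apply: filterS nb0 => x; rewrite -ball_normE /ball_ /= sub0r normrN => xd.
have bx (t : R) : 0 <= t <= 1 -> ball a d (a + t *: x) by exact: ball_line.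
have bx1 : ball a d (a + x).
  by have := bx 1; rewrite scale1r; apply; rewrite ler01 lexx.
have Aax : A (a + x) by exact: (bd _ bx1).1.
have cB (f g : R -> R) : cont01 f -> cont01 g -> cont01 (fun t => f t - g t).
  by move=> cf cg t t01; apply: continuousB; [exact: cf|exact: cg].
have cBH : cont01 (fun t => H t (a + x) - H t a) by apply: cB; exact: cH.
have cBdH : cont01 (fun t => H t (a + x) - H t a - dH t a x) by exact: cB.
rewrite meanE [x + a]addrC -!meanB//.
- apply: mean_le.
    exact: cBdH.
  move=> t t01.
  have [|u u01 ->] := @mvt_line R _ (H t) a x.
    by move=> u u01; apply: dfH => //; exact: (bd _ (bx u u01)).1.
  have u01' : 0 <= u <= 1 by case/andP: u01 => *; rewrite !ltW.
  have [Au hu] := bd _ (bx u u01').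
  rewrite dHE// (linH _ _ t01 Au) (linH _ _ t01 Aa) -sumrB; apply: le_trans (ler_norm_sum _ _ _) _.
  apply: (@le_trans _ _ (\sum_(i < n) `|x| * e')).
    apply: ler_sum => i _; rewrite -mulrBr normrM.
    by apply: ler_pM => //; [exact: row_coord_le|exact: hu].
  rewrite sumr_const card_ord -mulr_natr -mulrA mulrC ler_wpM2r// /e'.
  by rewrite -mulrA ger_pMr// mulrC ler_pdivrMr// mul1r ler_nat.
- exact: cH.
- exact: cH.
Qed.
End ParameterIntegral.

(** * Hadamard's lemma along one coordinate *)

Section Hadamard.
Context {R : realType} (n : nat) (j : 'I_n) (d : R).
Local Notation V := 'rV[R]_n.
Local Notation mean f := (\int[lebesgue_measure]_(t in `[(0 : R), 1]) f t)%R.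
Local Notation A := (ball (0 : V) d).
Local Notation ej := (delta_mx ord0 j : V).

(** Multiplication of the [j]-th coordinate by [t]: the identity at [t = 1], the projection to the
    hyperplane [s_j = 0] at [t = 0]. Balls of the sup norm around 0 are stable under it for [t] in
    [[0, 1]]. *)
Definition shrink (t : R) (s : V) : V := s + ((t - 1) * s ord0 j) *: ej.

Lemma shrinkE t s i : shrink t s ord0 i = if i == j then t * s ord0 i else s ord0 i.
Proof.
rewrite /shrink !mxE eqxx /=; case: eqP => [->|_]; last by rewrite mulr0 addr0.
by rewrite mulr1; ring.
Qed.

Lemma shrink1 s : shrink 1 s = s.
Proof. by apply/rowP => i; rewrite shrinkE mul1r; case: eqP. Qed.

Lemma shrink_ball t s : 0 <= t <= 1 -> A s -> A (shrink t s).
Proof.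
move=> /andP[t0 t1] [d0 As]; split=> // i k; rewrite (ord1 i) shrinkE.
have := As ord0 k; rewrite -!ball_normE /ball_/= !mxE !sub0r !normrN.
case: eqP => // _ sd; rewrite normrM ger0_norm//.
by apply: le_lt_trans sd; rewrite ler_piMl.
Qed.

Lemma shrink_linear t : linear (shrink t).
Proof.
move=> a u v; apply/rowP => i.
transitivity (a * shrink t u ord0 i + shrink t v ord0 i); last by rewrite [RHS]mxE [in RHS]mxE.
rewrite !shrinkE !mxE.
by case: eqP => _; ring.
Qed.

Lemma shrink_continuous : continuous (fun p : R * V => shrink p.1 p.2).
Proof.
move=> [t s]; apply: (@continuousD _ _ _ (fun p : R * V => p.2)); first exact: cvg_snd.
apply: (@continuousZl _ _ _ (fun p : R * V => (p.1 - 1) * p.2 ord0 j)).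
apply: (@continuousM _ _ (fun p : R * V => p.1 - 1) (fun p : R * V => p.2 ord0 j)).
  by apply: (@continuousB _ _ _ (fun p : R * V => p.1) (cst 1)); [exact: cvg_fst|exact: cst_continuous].
apply: (@continuous_comp _ _ _ snd (fun s : V => s ord0 j)); first exact: cvg_snd.
exact: coord_continuous.
Qed.

Lemma shrink_continuousl s : continuous (fun t => shrink t s).
Proof.
move=> t; apply: (@continuous_comp _ _ _ (fun t => (t, s)) (fun p : R * V => shrink p.1 p.2)).
  move=> P [[U W] /= [Ut Wa] UW]; apply: filterS Ut => r Ur; apply: UW; split=> //.
  exact: nbhs_singleton.
exact: shrink_continuous.
Qed.

Lemma derive_shrink (h : V -> R) t s v : differentiable h (shrink t s) ->
  differentiable (h \o shrink t) s /\
  'D_v (h \o shrink t) s = 'D_v h (shrink t s) + (t - 1) * v ord0 j * 'D_ej h (shrink t s).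
Proof.
move=> dh; have [l lE] := linear_bundle (@shrink_linear t).
have cl : continuous l.
  rewrite lE => x.
  apply: (@continuous_comp _ _ _ (fun s => (t, s)) (fun p : R * V => shrink p.1 p.2)).
    move=> P [[U W] /= [Ut Wa] UW]; apply: filterS Wa => r Ur; apply: UW; split=> //.
    exact: nbhs_singleton.
  exact: shrink_continuous.
have dl : differentiable (shrink t) s by rewrite -lE; exact: linear_differentiable.
have dc : differentiable (h \o shrink t) s by exact: differentiable_comp.
have dlE : 'd (shrink t) s = shrink t :> (V -> V) by rewrite -lE; exact: diff_lin.
split=> //; rewrite deriveE// diff_comp//= dlE.
rewrite -(deriveE _ dh) /shrink deriveDv// deriveZv//.
Qed.

Lemma cont01_shrink (g : V -> R) s : A s -> smooth_on A g -> cont01 (fun t => g (shrink t s)).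
Proof.
move=> As sg t t01.
apply: (@continuous_comp _ _ _ (fun t => shrink t s) g); first exact: shrink_continuousl.
by apply: (smooth_on_continuous sg); exact: shrink_ball.
Qed.

Lemma mean_combination (r : R) (a b c : R -> R) : cont01 a -> cont01 b -> cont01 c ->
  mean a + r * (mean b + -1 * mean c) = mean (fun t => a t + r * (b t + -1 * c t)).
Proof.
move=> ca cb cc; have cZ r' (f : R -> R) : cont01 f -> cont01 (fun t => r' * f t).
  by move=> cf; apply: cont01M => //; exact: cont01_cst.
rewrite meanD//; last by apply/cZ/cont01D => //; exact: cZ.
by rewrite meanZ ?meanD ?meanZ//; [exact: cZ|apply/cont01D => //; exact: cZ].
Qed.

(** Differentiation in [s] produces a factor [t - 1] under the integral. As
    [t^m (t - 1) = t^(m+1) - t^m], the weights [t^m] make the family closed under derivatives, so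
    smoothness follows by induction over all [h] and [m] at once. *)
Definition hmean (m : nat) (h : V -> R) (s : V) : R := mean (fun t => t ^+ m * h (shrink t s)).

Lemma hmean_kdiff h : smooth_on A h -> forall k m, kdiff k A (hmean m h).
Proof.
move=> sh k; have oA : open A by exact: ball_open.
elim: k h sh => [//|k IH] h sh m.
have dh x : A x -> differentiable h x by exact: (sh 1%N).1.
have sD v : smooth_on A ('D_v h) by move=> i; exact: (sh i.+1).2.
have cD v x : A x -> {for x, continuous ('D_v h)} by exact: smooth_on_continuous.
pose dH (t : R) (s v : V) : R :=
  t ^+ m * ('D_v h (shrink t s) + (t - 1) * v ord0 j * 'D_ej h (shrink t s)).
have cX i : cont01 (fun t : R => t ^+ i) by move=> t _; exact: exprn_continuous.
have key s : A s -> differentiable (hmean m h) s /\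
    forall v, 'D_v (hmean m h) s = mean (fun t => dH t s v).
  move=> As; apply: (@differentiable_mean R n A (fun t s => t ^+ m * h (shrink t s)) dH s oA As).
  - by move=> x Ax; apply: cont01M => //; exact: cont01_shrink.
  - move=> t x t01 Ax.
    apply: (@differentiableM _ _ (cst (t ^+ m)) (h \o shrink t)) => //.
    by apply: (derive_shrink 0 _).1; apply: dh; exact: shrink_ball.
  - move=> t x v t01 Ax.
    have [dc dE] := derive_shrink v (dh _ (shrink_ball t01 Ax)).
    rewrite -[LHS]/('D_v (t ^+ m *: (h \o shrink t)) x) deriveZ; last exact: diff_derivable.
    by rewrite dE.
  - move=> t x v t01 Ax.
    have cc w : {for (t, x), continuous (fun p : R * V => 'D_w h (shrink p.1 p.2))}.
      apply: (@continuous_comp _ _ _ (fun p : R * V => shrink p.1 p.2) ('D_w h)).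
        exact: shrink_continuous.
      by apply: cD; exact: shrink_ball.
    have cf : {for (t, x), continuous (fun p : R * V => p.1)} by exact: cvg_fst.
    apply: (@continuousM _ _ (fun p : R * V => p.1 ^+ m)).
      by apply: (@continuous_comp _ _ _ fst (fun t : R => t ^+ m)) => //; exact: exprn_continuous.
    apply: (@continuousD _ _ _ (fun p : R * V => 'D_v h (shrink p.1 p.2))) => //.
    apply: (@continuousM _ _ (fun p : R * V => (p.1 - 1) * v ord0 j)) => //.
    apply: (@continuousM _ _ (fun p : R * V => (p.1 - 1)) (cst _)); last exact: cst_continuous.
    by apply: (@continuousB _ _ _ (fun p : R * V => p.1) (cst 1)) => //; exact: cst_continuous.
split=> [x /key[]//|v].
pose g s := hmean m ('D_v h) s + v ord0 j * (hmean m.+1 ('D_ej h) s + -1 * hmean m ('D_ej h) s).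
apply: (@kdiff_eq _ _ _ k A g _ oA) => [s As|].
  have c0 i w : cont01 (fun t => t ^+ i * 'D_w h (shrink t s)).
    by apply: cont01M => //; exact: (@cont01_shrink ('D_w h)).
  have [_ ->] := key s As.
  rewrite /g /hmean (mean_combination _ (c0 _ _) (c0 _ _) (c0 _ _)).
  by apply: eq_Rintegral => t _; rewrite /dH exprS; ring.
apply: kdiffD => //; first exact: IH.
apply: kdiffM => //; first exact: kdiff_cst.
apply: kdiffD => //; first exact: IH.
by apply: kdiffM => //; [exact: kdiff_cst|exact: IH].
Qed.

(** The derivative of [h (shrink t s)] in [t] is [s_j] times ['D_ej h] at [shrink t s]; it is
    integrated from 0 to 1. *)
Lemma hmean_ftc h s : smooth_on A h -> A s ->
  s ord0 j * hmean 0 ('D_ej h) s = h s - h (shrink 0 s).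
Proof.
move=> sh As; have dh x : A x -> differentiable h x by exact: (sh 1%N).1.
have sD v : smooth_on A ('D_v h) by move=> i; exact: (sh i.+1).2.
transitivity (h (shrink 1 s) - h (shrink 0 s)); last by rewrite shrink1.
have c0 : cont01 (fun t : R => t ^+ 0 * 'D_ej h (shrink t s)).
  by apply: cont01M => //; [exact: cont01_cst|exact: (@cont01_shrink ('D_ej h))].
rewrite /hmean -meanZ//; apply: (@mean_ftc _ (fun t => h (shrink t s))).
  by apply: cont01M => //; exact: cont01_cst.
move=> t t01.
have E r : shrink r s = (s - s ord0 j *: ej) + r *: (s ord0 j *: ej).
  by rewrite /shrink scalerA mulrBl mul1r scalerBl [RHS]addrAC addrA.
have dl : differentiable h ((s - s ord0 j *: ej) + t *: (s ord0 j *: ej)).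
  by rewrite -E; apply: dh; exact: shrink_ball.
have := is_derive_line dl; rewrite deriveZv// -E => D.
rewrite expr0 mul1r (_ : (fun t => h (shrink t s)) =
  (fun r => h ((s - s ord0 j *: ej) + r *: (s ord0 j *: ej))))//.
by apply/funext => r; rewrite E.
Qed.

(** Gives the Hadamard remainder on the hyperplane where the difference quotient is undefined. *)
Lemma hmean_hyperplane h (s : V) : s ord0 j = 0 -> hmean 0 h s = h s.
Proof.
move=> s0; rewrite /hmean.
under eq_Rintegral do rewrite expr0 mul1r /shrink s0 mulr0 scale0r addr0.
by rewrite Rintegral_cst//= lebesgue_measure_itv/= lte01 oppr0 adde0 mulr1.
Qed.
End Hadamard.

(** * The special curve lemma *)

Section RealFunctions.
Context {R : realType}.
Implicit Types f g : R -> R.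

Lemma kdiff_real k f f' : (forall x : R, is_derive x 1 f (f' x)) ->
  kdiff k (setT : set R) f' -> kdiff k.+1 (setT : set R) f.
Proof.
move=> df kf'; have dif x : differentiable f x by apply/derivable1_diffP; case: (df x).
split=> [x _ //|v].
apply: (@kdiff_eq _ _ _ k setT (fun x => v * f' x) _ openT) => [x _|].
  have [_ <-] := df x.
  by rewrite -[in RHS](mulr1 v) -[v * 1]/(v *: (1 : R)) deriveZv.
by apply: kdiffM => //; [exact: openT|exact: kdiff_cst].
Qed.

Lemma kdiff_sin_cos k : kdiff k (setT : set R) (@sin R) /\ kdiff k (setT : set R) (@cos R).
Proof.
elim: k => [//|k [IHs IHc]]; split; first exact: kdiff_real IHc.
apply: kdiff_real; apply: (@kdiff_eq _ _ _ k setT (fun x => -1 * sin x) _ openT).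
  by move=> x _; rewrite mulN1r.
by apply: kdiffM => //; [exact: openT|exact: kdiff_cst].
Qed.

(** Handles the point 0, at which [flat] and [dyadic_sum] are glued to the zero function. *)
Lemma derive0_of_quadratic f C d : 0 < d ->
  (forall x : R, `|x| < d -> `|f x| <= C * x ^+ 2) -> is_derive (0 : R) 1 f 0.
Proof.
move=> d0 fC; have f0 : f 0 = 0.
  by apply/eqP; rewrite -normr_le0 (le_trans (fC 0 _))// ?normr0// expr0n mulr0.
have H : (fun h : R => h^-1 *: ((f \o shift 0) (h *: 1) - f 0)) @ 0^' --> (0 : R).
  apply/cvgr0Pnorm_lt => e e0.
  pose r := Num.min d (e / (`|C| + 1)).
  have r0 : 0 < r by rewrite lt_min d0 divr_gt0// ltr_pwDr.
  have nr : \forall h \near (0 : R)^', h != 0 /\ `|h| < r.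
    by near=> h; split; near: h; [exact: nbhs_dnbhs_neq|exact: dnbhs0_lt].
  apply: filterS nr => h [h0]; rewrite lt_min => /andP[hd hr].
  rewrite /= addr0 f0 subr0 normrZ normrV ?unitfE// ltr_pdivrMl ?normr_gt0//.
  rewrite -[h *: 1]/(h * 1) mulr1; apply: le_lt_trans (fC _ hd) _.
  rewrite -(ger0_norm (sqr_ge0 h)) normrX expr2 mulrA [_ * e]mulrC ltr_pM2r ?normr_gt0//.
  have C1 : 0 < `|C| + 1 by rewrite ltr_pwDr.
  move: hr; rewrite ltr_pdivlMr// => hr; apply: le_lt_trans hr.
  rewrite mulrC ler_wpM2l//; apply: le_trans (ler_norm C) _.
  by rewrite lerDl.
apply: DeriveDef; first by apply/cvg_ex; exists 0.
exact: cvg_lim H.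
Unshelve. all: by end_near.
Qed.

(** For [n = 0] the classical flat function; the powers of [1/x] make the family closed under
    derivatives. *)
Definition flat (n : nat) (x : R) : R := if 0 < x then x^-1 ^+ n * expR (- x^-1) else 0.

(** With [y = 1/x], the exponential series gives [exp y >= y^(n+2) / (n+2)!]. *)
Lemma flat_le n (x : R) : 0 < x -> `|flat n x| <= n.+2`!%:R * x ^+ 2.
Proof.
move=> x0; rewrite /flat x0 expRN.
have y0 : 0 < x^-1 by rewrite invr_gt0.
rewrite ger0_norm; last by rewrite mulr_ge0 ?exprn_ge0 ?invr_ge0 ?expR_ge0 ?ltW.
rewrite ler_pdivrMr ?expR_gt0//.
have := expR_ge1Dxn n.+1 (ltW y0) => h.
have {}h : x^-1 ^+ n.+2 / n.+2`!%:R <= expR x^-1 by apply: le_trans h; rewrite lerDr.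
apply: le_trans (ler_wpM2l _ h); last by rewrite mulr_ge0// exprn_ge0// ltW.
have f0 : n.+2`!%:R != 0 :> R by rewrite pnatr_eq0 -lt0n fact_gt0.
have xn0 : x != 0 by rewrite gt_eqF.
rewrite le_eqVlt; apply/orP; left; apply/eqP.
rewrite (exprSr x^-1 n.+1) (exprSr x^-1 n); move: f0; move: (n.+2`!%:R : R) (x^-1 ^+ n) => p a p0.
by field; rewrite p0 xn0.
Qed.

Lemma is_derive_flat n (x : R) :
  is_derive x 1 (flat n) (flat n.+2 x - n%:R * flat n.+1 x).
Proof.
have [x0|x0|->] := ltgtP x 0.
- have E y : y < 0 -> forall m, flat m y = 0 by move=> y0 m; rewrite /flat ltNge (ltW y0).
  rewrite !E// mulr0 subr0; apply: (@near_eq_is_derive _ _ _ (cst 0)) => //.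
  by near=> y; rewrite /= E//; near: y; exact: lt_nbhsl.
- have xn0 : x != 0 by rewrite gt_eqF.
  have D : is_derive x 1 (fun y : R => y^-1 ^+ n * expR (- y^-1))
     (flat n.+2 x - n%:R * flat n.+1 x).
    have dV : is_derive x 1 (fun y : R => y^-1) (- x ^- 2).
      by have := is_deriveV xn0 (is_derive_id x 1); rewrite /GRing.scale /= mulr1.
    have dE : is_derive x 1 (fun y : R => expR (- y^-1)) (expR (- x^-1) * x ^- 2).
      apply: (@is_derive1_comp _ expR (fun y => - y^-1)).
      by rewrite -[x ^- 2]opprK; exact: is_deriveN.
    have dX := is_deriveX n dV.
    have := is_deriveM dX dE.
    rewrite (_ : _ * _ = (fun y : R => y^-1 ^+ n * expR (- y^-1))); last first.
      by apply/funext => y; rewrite fctE /= exprfctE.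
    rewrite exprfctE => -[h1 h2]; apply: DeriveDef => //.
    rewrite h2 /flat x0 -[x ^- 2]exprVn /GRing.scale /=.
    case: (n) => [|m]; first by rewrite !mul0r; ring.
    by rewrite /= !exprS; ring.
  apply: (@near_eq_is_derive _ _ _ (fun y : R => y^-1 ^+ n * expR (- y^-1))) => //.
  by near=> y; rewrite /flat ifT//; near: y; exact: lt_nbhsr.
- have z m : flat m 0 = 0 by rewrite /flat ltxx.
  rewrite !z mulr0 subr0; apply: (@derive0_of_quadratic _ n.+2`!%:R 1) => // u _.
  have [u0|u0] := ltP 0 u; first exact: flat_le.
  by rewrite /flat ltNge u0 /= normr0 mulr_ge0// sqr_ge0.
Unshelve. all: by end_near.
Qed.

Lemma kdiff_flat k n : kdiff k (setT : set R) (flat n).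
Proof.
elim: k n => [//|k IH] n; apply: kdiff_real (is_derive_flat n) _.
apply: (@kdiff_eq _ _ _ k setT (fun x => flat n.+2 x + (- n%:R) * flat n.+1 x) _ openT).
  by move=> x _; rewrite mulNr.
apply: kdiffD => //; first exact: openT.
by apply: kdiffM => //; [exact: openT|exact: kdiff_cst].
Qed.

Lemma kdiff_affine k f a b : (forall k, kdiff k (setT : set R) f) ->
  kdiff k (setT : set R) (fun x => f (a * x + b)).
Proof.
elim: k f => [//|k IH] f sf.
have df (x : R) : is_derive x 1 f ('D_1 f x).
  by apply: DeriveDef => //; apply: diff_derivable; apply: (sf 1%N).1.
apply: (@kdiff_real _ _ (fun x => 'D_1 f (a * x + b) * a)) => [x|].
  apply: (@is_derive1_comp _ f (fun x => a * x + b)).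
  by apply: is_derive_eq; rewrite scaler1 addr0.
apply: kdiffM; [exact: openT| |exact: kdiff_cst].
by apply: (IH ('D_1 f)) => i; exact: (sf i.+1).2.
Qed.

(** A bump around [3/4] that vanishes outside [(5/8, 7/8)], so that its rescalings by powers of 2
    have disjoint supports. *)
Definition bell (x : R) : R := flat 0 (x - 5 / 8) * flat 0 (7 / 8 - x).

Lemma kdiff_bell k : kdiff k (setT : set R) bell.
Proof.
have oT : open (setT : set R) by exact: openT.
have h a b : kdiff k (setT : set R) (fun x => flat 0 (a * x + b)).
  by apply: kdiff_affine => i; exact: kdiff_flat.
apply: (kdiff_eq oT) (kdiffM oT (h 1 (- (5 / 8))) (h (-1) (7 / 8))) => x _.
by rewrite /bell mul1r mulN1r [- x + _]addrC.
Qed.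

Lemma bell0 x : x <= 5 / 8 \/ 7 / 8 <= x -> bell x = 0.
Proof.
by case=> h; rewrite /bell /flat; [rewrite [0 < x - _]ltNge subr_le0 h mul0r|
  rewrite [0 < _ - x]ltNge subr_le0 h mulr0].
Qed.

Lemma bell_gt0 : 0 < bell (3 / 4).
Proof.
rewrite /bell /flat !ifT; [|by lra|by lra].
by rewrite !expr0 !mul1r mulr_gt0// expR_gt0.
Qed.

(* At most finitely many terms are nonzero at each t, so the cutoff at 1 / t does not matter. *)
Definition dyadic_sum f (y : nat -> R) (t : R) : R :=
  \sum_(n < (Num.truncn t^-1).+1) f (2 ^+ n * t) * y n.

(** The support condition confines [f (2^n t)] to the dyadic interval from [2^-(n+1)] to [2^-n]. *)
Definition profile f := (forall k, kdiff k (setT : set R) f) /\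
  forall x : R, x < 1 / 2 \/ 1 < x -> f x = 0.

(** Decay faster than every [2^-(k n)], hence stable under the factor [2^n] that differentiating
    [f (2^n t)] produces. *)
Definition fast (y : nat -> R) := forall k : nat, exists C : R, forall n,
  `|y n| * 2 ^+ (k * n) <= C.

Lemma pow2_ge n : n%:R <= 2 ^+ n :> R.
Proof. by rewrite -natrX ler_nat ltnW// ltn_expl. Qed.

(** As [2^n >= n], all terms from [N] on vanish once [N t > 1]. So near a positive [t] one cutoff
    serves all points, and the sum is locally finite. *)
Lemma dyadic_sumE f y N t : profile f -> t <= 0 \/ 1 < N%:R * t ->
  dyadic_sum f y t = \sum_(n < N) f (2 ^+ n * t) * y n.
Proof.
move=> [_ f0] h.
have z n : (t <= 0) \/ (1 < n%:R * t) -> f (2 ^+ n * t) = 0.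
  move=> {}h; apply: f0; case: h => ht; [left|right].
    by apply: (@le_lt_trans _ _ 0); [rewrite mulr_ge0_le0// exprn_ge0|rewrite divr_gt0].
  have t0 : 0 < t by rewrite ltNge; apply/negP => /(mulr_ge0_le0 (ler0n R n)) /(lt_le_trans ht); rewrite ltr10.
  by apply: lt_le_trans ht _; rewrite ler_pM2r// pow2_ge.
have zt n : (Num.truncn t^-1 < n)%N -> f (2 ^+ n * t) = 0.
  move=> hn; apply: z; have [|t0] := leP t 0; [by left|right].
  rewrite -ltr_pdivrMr// div1r; apply: lt_le_trans (truncnS_gt _) _.
  by rewrite ler_nat.
have zN n : (N <= n)%N -> f (2 ^+ n * t) = 0.
  move=> hn; apply: z; case: h => [|h]; [by left|right].
  have t0 : 0 < t by rewrite ltNge; apply/negP => /(mulr_ge0_le0 (ler0n R N)) /(lt_le_trans h); rewrite ltr10.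
  by apply: lt_le_trans h _; rewrite ler_pM2r// ler_nat.
have E M K : (M <= K)%N -> (forall n, (M <= n)%N -> f (2 ^+ n * t) = 0) ->
    \sum_(n < M) f (2 ^+ n * t) * y n = \sum_(n < K) f (2 ^+ n * t) * y n.
  move=> MK zM; rewrite (big_ord_widen _ (fun n => f (2 ^+ n * t) * y n) MK).
  rewrite [RHS](bigID (fun n : 'I_K => (n < M)%N)) /= [X in _ + X]big1 ?addr0// => i.
  by rewrite -leqNgt => /zM ->; rewrite mul0r.
rewrite /dyadic_sum; have [MN|NM] := leqP (Num.truncn t^-1).+1 N; first exact: E.
by apply/esym/E => //; exact: ltnW.
Qed.

Lemma profile_derive f : profile f -> profile ('D_1 f).
Proof.
move=> [sf f0]; split=> [k|x hx]; first exact: (sf k.+1).2.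
rewrite (@near_derive _ _ _ f (cst 0)) ?derive_cst//.
case: hx => hx; near=> y; apply: f0; [left|right]; near: y; [exact: lt_nbhsl|exact: lt_nbhsr].
Unshelve. all: by end_near.
Qed.

Lemma profile_bounded f : profile f -> exists2 M : R, 0 < M & forall x, `|f x| <= M.
Proof.
move=> [sf f0]; have cf : continuous f.
  by move=> x; apply: differentiable_continuous; apply: (sf 1%N).1.
have [|c _ hc] := @EVT_max R (fun x => `|f x|) 0 1 ler01.
  apply: continuous_subspaceT => x; apply: (continuous_comp (cf x)); exact: norm_continuous.
exists (`|f c| + 1) => [|x]; first by rewrite ltr_pwDr.
have [x01|] := boolP (x \in `[0, 1]%R); first by rewrite (le_trans (hc _ x01))// lerDl.
rewrite in_itv /= negb_and -!ltNge => /orP[x0|x1].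
  by rewrite f0 ?normr0 ?addr_ge0//; left; apply: lt_trans x0 _; rewrite divr_gt0.
by rewrite f0 ?normr0 ?addr_ge0//; right.
Qed.

Lemma fast_double y : fast y -> fast (fun n => 2 ^+ n * y n).
Proof.
move=> fy k; have [C hC] := fy k.+1; exists C => n.
rewrite normrM ger0_norm ?exprn_ge0// mulrAC mulrC -exprD addnC.
by have := hC n; rewrite mulSn addnC.
Qed.

Lemma geometric_half N : \sum_(n < N) (1 / 2 : R) ^+ n <= 2.
Proof.
elim: N => [|N IH]; first by rewrite big_ord0.
rewrite big_ord_recl expr0.
rewrite (_ : \sum_(i < N) _ = 1 / 2 * \sum_(n < N) (1 / 2 : R) ^+ n); last first.
  by rewrite mulr_sumr; apply: eq_bigr => i _; rewrite /= /bump /= exprS.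
by lra.
Qed.

Lemma dyadic_sum_le f y C t : 0 <= C ->
  (forall n, `|f (2 ^+ n * t) * y n| <= C * (1 / 2) ^+ n) -> `|dyadic_sum f y t| <= 2 * C.
Proof.
move=> C0 fC; rewrite /dyadic_sum; apply: le_trans (ler_norm_sum _ _ _) _.
apply: (@le_trans _ _ (\sum_(n < (Num.truncn t^-1).+1) C * (1 / 2) ^+ n)).
  by apply: ler_sum => n _.
by rewrite -mulr_sumr [leRHS]mulrC ler_wpM2l// geometric_half.
Qed.

Lemma dyadic_sum0 f y t : profile f -> t <= 0 -> dyadic_sum f y t = 0.
Proof. by move=> bf t0; rewrite (@dyadic_sumE _ _ 0)// ?big_ord0//; left. Qed.

(** Away from 0 the sum is locally zero or locally a finite sum that can be differentiated termwise.
    At 0 it is bounded by a multiple of [s^2]. *)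
Lemma is_derive_dyadic f y (t : R) : profile f -> fast y ->
  is_derive t 1 (dyadic_sum f y) (dyadic_sum ('D_1 f) (fun n => 2 ^+ n * y n) t).
Proof.
move=> bf fy; have bf' := profile_derive bf.
have [t0|t0|->] := ltgtP t 0.
- rewrite dyadic_sum0//; last exact: ltW.
  apply: (@near_eq_is_derive _ _ _ (cst 0)) => //.
  by near=> s; rewrite /= dyadic_sum0// ltW//; near: s; exact: lt_nbhsl.
(* This cutoff is valid for every [s > t / 2], hence on a neighbourhood of [t]. *)
- pose N := (Num.truncn (2 / t)).+1.
  have NP s : t / 2 < s -> 1 < N%:R * s.
    move=> ts; have s0 : 0 < s by apply: lt_trans ts; rewrite divr_gt0.
    rewrite -ltr_pdivrMr// div1r; apply: lt_trans (truncnS_gt (2 / t)).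
    by rewrite -[2 / t]invrK invfM invrK mulrC ltf_pV2// ?posrE// divr_gt0.
  rewrite (@dyadic_sumE _ _ N) //; last by right; apply: NP; lra.
  apply: (@near_eq_is_derive _ _ _ (\sum_(n < N) (fun s => f (2 ^+ n * s) * y n))) => //.
    near=> s; rewrite fct_sumE (@dyadic_sumE _ _ N)//; right; apply: NP.
    by near: s; apply: lt_nbhsr; lra.
  have D n : is_derive t 1 (fun s => f (2 ^+ n * s) * y n) ('D_1 f (2 ^+ n * t) * (2 ^+ n * y n)).
    have df : is_derive (2 ^+ n * t) 1 f ('D_1 f (2 ^+ n * t)).
      by apply: DeriveDef => //; apply: diff_derivable; apply: (bf.1 1%N).1.
    have dl : is_derive t 1 (fun s : R => 2 ^+ n * s) (2 ^+ n).
      by apply: is_derive_eq; rewrite scaler1.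
    have [h1 h2] := is_deriveM (is_derive1_comp df dl) (is_derive_cst (y n) t 1).
    apply: DeriveDef => //; rewrite [LHS]h2 scaler0 add0r /GRing.scale /=.
    by rewrite mulrC mulrA.
  exact: is_derive_sum.
- rewrite dyadic_sum0//.
  (* Exponent 3: two factors [2^n] are absorbed by [(2^n s)^2], the third pays for the geometric
     series. *)
  have [M M0 fM] := profile_bounded bf; have [C hC] := fy 3%N.
  have C0 : 0 <= C by apply: le_trans (hC 0%N); rewrite mulr_ge0// exprn_ge0.
  apply: (@derive0_of_quadratic _ (2 * (4 * M * C)) 1) => // s _.
  rewrite -[leRHS]mulrA; apply: dyadic_sum_le => [|n].
    by rewrite mulr_ge0 ?sqr_ge0// !mulr_ge0// ltW.
  have [lt2|le2] := ltP (2 ^+ n * s) (1 / 2).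
    rewrite bf.2; last by left.
    by rewrite mul0r normr0 mulr_ge0 ?exprn_ge0// mulr_ge0 ?sqr_ge0// !mulr_ge0// ltW.
  (* In the range where the term can be nonzero, this factor may be inserted to obtain the quadratic
     bound. *)
  have h4 : 1 <= 4 * (2 ^+ n * s) ^+ 2.
    have := @ler_pM _ (1 / 2 : R) (2 ^+ n * s) (1 / 2) (2 ^+ n * s).
    by rewrite -!expr2; lra.
  rewrite normrM; apply: (@le_trans _ _ (M * `|y n|)); first by rewrite ler_wpM2r.
  apply: (@le_trans _ _ (M * `|y n| * (4 * (2 ^+ n * s) ^+ 2))).
    by rewrite ler_peMr// mulr_ge0// ltW.
  have p0 : 0 < (2 : R) ^+ n by rewrite exprn_gt0.
  have -> : (1 / 2 : R) ^+ n = (2 ^+ n)^-1 by rewrite div1r exprVn.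
  rewrite ler_pdivlMr//.
  have := hC n; rewrite mulnC exprM => h.
  move: h; clear -M0; move: (`|y n|) (2 ^+ n : R) => a b h.
  have -> : M * a * (4 * (b * s) ^+ 2) * b = 4 * M * s ^+ 2 * (a * b ^+ 3) by ring.
  have -> : 4 * M * C * s ^+ 2 = 4 * M * s ^+ 2 * C by ring.
  by rewrite ler_wpM2l// mulr_ge0 ?sqr_ge0// mulr_ge0// ltW.
Unshelve. all: by end_near.
Qed.

Lemma kdiff_dyadic k f y : profile f -> fast y -> kdiff k (setT : set R) (dyadic_sum f y).
Proof.
elim: k f y => [//|k IH] f y bf fy.
apply: kdiff_real (fun t => is_derive_dyadic t bf fy) _.
by apply: IH; [exact: profile_derive|exact: fast_double].
Qed.

Lemma profile_bell : profile bell.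
Proof.
split=> [k|x hx]; first exact: kdiff_bell.
by apply: bell0; case: hx => h; [left|right]; lra.
Qed.

(** At this time the [n]-th term evaluates [bell] at [3/4] times [2^(n-k)], which is at most [3/8]
    for [n < k] and at least [3/2] for [n > k]. *)
Lemma dyadic_sum_bell y k : dyadic_sum bell y (3 / 4 * (1 / 2) ^+ k) = bell (3 / 4) * y k.
Proof.
have p0 n : 0 < (1 / 2 : R) ^+ n by rewrite exprn_gt0.
have halfK m : 2 ^+ m * (1 / 2 : R) ^+ m = 1.
  by rewrite -exprMn div1r divff ?expr1n// pnatr_eq0.
pose t : R := 3 / 4 * (1 / 2) ^+ k.
have t0 : 0 < t by rewrite mulr_gt0.
pose N := (k + (Num.truncn t^-1).+1)%N.
have Nt : 1 < N%:R * t.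
  rewrite -(ltr_pdivrMr _ _ t0) div1r; apply: lt_le_trans (truncnS_gt _) _.
  by rewrite ler_nat leq_addl.
rewrite -/t (dyadic_sumE _ profile_bell (or_intror Nt)).
have kN : (k < N)%N by rewrite /N addnS ltnS leq_addr.
have E n : 2 ^+ (k + n) * t = 3 / 4 * 2 ^+ n.
  rewrite exprD /t; transitivity (3 / 4 * 2 ^+ n * (2 ^+ k * (1 / 2) ^+ k) : R); last by rewrite halfK mulr1.
  by move: (2 ^+ k : R) (2 ^+ n : R) ((1 / 2) ^+ k : R) => a b c; ring.
rewrite (bigD1 (Ordinal kN)) //= big1 ?addr0 => [|i ik].
  by have := E 0%N; rewrite addn0 expr0 mulr1 => ->.
rewrite bell0 ?mul0r//.
have [ik'|ik'|ik'] := ltngtP i k; last first.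
- by move: ik; rewrite -val_eqE /= ik' eqxx.
- right; have -> : (i : nat) = (k + (i - k))%N by rewrite subnKC// ltnW.
  rewrite E; case: (i - k)%N (subn_gt0 k i) => [|m _]; first by rewrite ik'.
  have : 1 <= (2 : R) ^+ m by rewrite exprn_ege1// ler1n.
  by rewrite exprS; lra.
- left; rewrite /t; have -> : k = (i + (k - i))%N by rewrite subnKC// ltnW.
  case: (k - i)%N (subn_gt0 i k) => [|m _]; first by rewrite ik'.
  have -> : 2 ^+ i * (3 / 4 * (1 / 2) ^+ (i + m.+1)) = 3 / 4 * (1 / 2) ^+ m.+1 :> R.
    rewrite exprD; transitivity (3 / 4 * (1 / 2) ^+ m.+1 * (2 ^+ i * (1 / 2) ^+ i) : R).
      2: by rewrite halfK mulr1.
    by move: (2 ^+ i : R) ((1 / 2) ^+ m.+1 : R) ((1 / 2) ^+ i : R) => a b c; ring.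
  have : (1 / 2 : R) ^+ m <= 1 by rewrite exprn_ile1//; lra.
  by rewrite exprS; lra.
Qed.

(* If A is not a neighbourhood of x, points z_k outside A converge to x so fast that
   bumps on disjoint dyadic intervals form a smooth curve through all of them. *)
Lemma special_curve n (A : set 'rV[R]_n) (x : 'rV[R]_n) (e : R) : 0 < e ->
  (forall c : R -> 'rV[R]_n, curve_smooth c -> c 0 = x -> (forall t, ball x e (c t)) ->
    \forall t \near (0 : R), A (c t)) ->
  nbhs x A.
Proof.
move=> e0 H; apply: contrapT => nA.
have [M M0 bM] := profile_bounded profile_bell.
pose b := bell (3 / 4); have b0 : 0 < b by exact: bell_gt0.
(* The first factor keeps the curve in the ball of radius [e], the second makes the series
   geometric, and the third beats [2^(k n)] for every [k]. *)
pose r n : R := e / (4 * M) * (1 / 2) ^+ n * (1 / 2) ^+ (n * n).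
have h0 m : 0 < (1 / 2 : R) ^+ m by rewrite exprn_gt0.
have eM0 : 0 < e / (4 * M) by rewrite divr_gt0// mulr_gt0.
have r0 m : 0 < r m by apply: mulr_gt0 => //; exact: mulr_gt0.
have ex k : exists z, ball x (r k * b) z /\ ~ A z.
  apply: contrapT => /forallNP nz; apply: nA; apply/nbhs_ballP.
  exists (r k * b) => [|z bz]; first by rewrite /= mulr_gt0.
  by apply: contrapT => nAz; exact: (nz z).
have [z zP] := choice ex.
(* Division by [b] makes the curve pass exactly through [z k] at the time of [dyadic_sum_bell]. *)
pose y (i : 'I_n) k : R := (z k ord0 i - x ord0 i) / b.
have yr i k : `|y i k| <= r k.
  have [[_ /(_ ord0 i)]] := zP k; rewrite -ball_normE /ball_/= distrC => h _.
  by rewrite /y normrM normfV (gtr0_norm b0) ler_pdivrMr// ltW.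
have fy i : fast (y i).
  move=> k; exists (e / (4 * M) * 2 ^+ (k * k)) => m.
  apply: (@le_trans _ _ (r m * 2 ^+ (k * m))).
    by rewrite ler_wpM2r// exprn_ge0.
  have p0 i' : 0 < (2 : R) ^+ i' by rewrite exprn_gt0.
  have h1 : (1 / 2 : R) ^+ m <= 1 by rewrite exprn_ile1//; lra.
  (* On exponents this is [k m <= m^2 + k^2]. *)
  have hk : (1 / 2 : R) ^+ (m * m) * 2 ^+ (k * m) <= 2 ^+ (k * k).
    rewrite mulrC div1r exprVn ler_pdivrMr// -exprD ler_weXn2l ?ler1n//.
    have [km|mk] := leqP k m.
      by apply: (@leq_trans (m * m)); rewrite ?leq_mul2r ?km ?orbT// leq_addl.
    by apply: (@leq_trans (k * k)); rewrite ?leq_mul2l ?(ltnW mk) ?orbT// leq_addr.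
  have q0 : 0 <= (1 / 2 : R) ^+ (m * m) * 2 ^+ (k * m) by rewrite mulr_ge0// ltW.
  rewrite /r; move: hk h1 q0 eM0; clear.
  move: (e / (4 * M)) ((1 / 2) ^+ m) ((1 / 2) ^+ (m * m)) (2 ^+ (k * m)) (2 ^+ (k * k)).
  move=> K a q p s hk a1 q0 K0; rewrite -!mulrA ler_pM2l//.
  by apply: le_trans hk; rewrite ler_piMl.
pose c t := x + \row_i dyadic_sum bell (y i) t.
have sc : curve_smooth c.
  move=> k; apply/kdiff_coord => [|i]; first exact: openT.
  apply: (@kdiff_eq _ _ _ k setT (fun t => x ord0 i + dyadic_sum bell (y i) t) _ openT).
    by move=> t _; rewrite /c !mxE.
  apply: kdiffD; [exact: openT|exact: kdiff_cst|].
  by apply: kdiff_dyadic => //; exact: profile_bell.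
have c0 : c 0 = x.
  apply/rowP => i; rewrite /c !mxE dyadic_sum0 ?addr0//; exact: profile_bell.
have bc t : ball x e (c t).
  split=> // i j; rewrite (ord1 i) -ball_normE /ball_/= /c !mxE opprD addNKr normrN.
  have : `|dyadic_sum bell (y j) t| <= 2 * (M * (e / (4 * M))).
    apply: dyadic_sum_le => [|k]; first by rewrite mulr_ge0// ltW.
    rewrite normrM -mulrA ler_pM//; apply: le_trans (yr j k) _.
    have h1 : (1 / 2 : R) ^+ (k * k) <= 1 by rewrite exprn_ile1//; lra.
    by rewrite /r ler_piMr// mulr_ge0// ltW.
  move=> /le_lt_trans; apply.
  have -> : 2 * (M * (e / (4 * M))) = e / 2 by field; rewrite gt_eqF.
  by lra.
have /nbhs_ballP[d /= d0 bd] := H c sc c0 bc.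
pose k := (Num.truncn d^-1).+1.
have : A (c (3 / 4 * (1 / 2) ^+ k)).
  apply: bd; rewrite -ball_normE /ball_/= sub0r normrN gtr0_norm ?mulr_gt0//.
  have : (1 / 2 : R) ^+ k < d.
    rewrite div1r exprVn -[d]invrK ltf_pV2 ?posrE ?invr_gt0// ?exprn_gt0//.
    by apply: lt_le_trans (truncnS_gt _) (pow2_ge _).
  by have := h0 k; lra.
rewrite (_ : c _ = z k); first by have [_] := zP k.
apply/rowP => i; rewrite /c !mxE dyadic_sum_bell -/b /y mulrC divfK ?gt_eqF//.
by rewrite addrC subrK.
Qed.
End RealFunctions.

Section Preimage.
Context {R : realType}.

Definition dopen (U : edom R) (B : set U) : Prop := open (@epoint R U @` B).

(** The test curves of [special_curve] stay in a ball contained in [U], so they are curves in [U]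
    and [p] sends them to smooth curves of [E]. *)
Lemma cinf_preimage (E : tvsType R) (A : set E) (U : edom R) (p : U -> E) :
  cinf_open A -> Dc p -> dopen (p @^-1` A).
Proof.
move=> oA Dp; rewrite /dopen openE => _ [u Au <-].
have /nbhs_ballP[e /= e0 bU] : nbhs (epoint u) (eset U).
  by apply: open_nbhs_nbhs; split; [exact: eopen|exact: epointP].
apply: (special_curve e0) => c sc c0 bc.
pose c' t : U := @Defs.mkset _ (eset U) _ (bU _ (bc t)).
have sp : smooth_curve (p \o c') by exact: Dp.
have c'0 : c' 0 = u by exact: epoint_inj.
have : nbhs (0 : R) ((p \o c') @^-1` A).
  by apply: open_nbhs_nbhs; split; [exact: oA|rewrite /= c'0].
by apply: filterS => t At; exists (c' t).
Qed.
End Preimage.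

(** * Scalarwise smooth maps *)

Section Domains.
Context {R : realType}.
Local Notation edom := (edom R).
Implicit Types U V W : edom.

Lemma near_ext U (W : normedModType R) (F : 'rV[R]_(edim U) -> W) (f : U -> W) u :
  (forall u, f u = F (epoint u)) -> \forall x \near epoint u, F x = ext f x.
Proof.
move=> fF; have nU : nbhs (epoint u) (eset U).
  by apply: open_nbhs_nbhs; split; [exact: eopen|exact: epointP].
by apply: filterS nU => x Ux; rewrite (extP _ Ux) fF.
Qed.

Lemma derive_ext U (W : normedModType R) (F : 'rV[R]_(edim U) -> W) (f : U -> W) u v :
  (forall u, f u = F (epoint u)) -> 'D_v (ext f) (epoint u) = 'D_v F (epoint u).
Proof. by move=> fF; apply/esym/near_derive; exact: near_ext. Qed.

Lemma vsmooth_of U (W : normedModType R) (F : 'rV[R]_(edim U) -> W) (f : U -> W) :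
  (forall u, f u = F (epoint u)) -> smooth_on (eset U) F -> vsmooth f.
Proof.
move=> fF sF; rewrite (_ : f = fun u => F (epoint u)); first exact: vsmooth_on.
exact/funext.
Qed.

Lemma vsmooth_differentiable U (W : normedModType R) (f : U -> W) u :
  vsmooth f -> differentiable (ext f) (epoint u).
Proof. by move=> sf; apply: (sf 1%N).1; exact: epointP. Qed.

Lemma vsmooth_ext_derive U (W : normedModType R) (f : U -> W) v :
  vsmooth f -> smooth_on (eset U) ('D_v (ext f)).
Proof. by move=> sf k; exact: (sf k.+1).2. Qed.

Lemma vsmooth_compR U V (f : U -> V) (g : V -> R) :
  esmooth f -> vsmooth g -> vsmooth (g \o f).
Proof.
move=> sf sg; rewrite /vsmooth.
apply: (@smooth_on_eq _ _ _ _ (ext g \o ext (fun u => epoint (f u))) _ (eopen U)).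
  by move=> x Ux /=; rewrite !(extP _ Ux) /= extE.
move=> k; apply: (kdiff_comp_scalar (eopen U) _ (sg k) (sf k)) => x Ux.
by rewrite (extP _ Ux); exact: epointP.
Qed.

Lemma vsmoothD U (f g : U -> R) : vsmooth f -> vsmooth g -> vsmooth (fun u => f u + g u).
Proof.
move=> sf sg; apply: (@vsmooth_of U _ (fun x => ext f x + ext g x)) => [u|k].
  by rewrite !extE.
by apply: kdiffD; [exact: eopen|exact: sf|exact: sg].
Qed.

Lemma vsmoothM U (f g : U -> R) : vsmooth f -> vsmooth g -> vsmooth (fun u => f u * g u).
Proof.
move=> sf sg; apply: (@vsmooth_of U _ (fun x => ext f x * ext g x)) => [u|k].
  by rewrite !extE.
by apply: kdiffM; [exact: eopen|exact: sf|exact: sg].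
Qed.

Lemma vsmooth_const U (a : R) : vsmooth (fun _ : U => a).
Proof. by apply: (@vsmooth_of U _ (fun=> a)) => // k; exact: kdiff_cst. Qed.

Lemma vsmooth_sum U n (f : 'I_n -> U -> R) :
  (forall i, vsmooth (f i)) -> vsmooth (fun u => \sum_i f i u).
Proof.
move=> sf; apply: (@vsmooth_of U _ (fun x => \sum_i ext (f i) x)) => [u|k].
  by apply: eq_bigr => i _; rewrite extE.
by apply: kdiff_sum => [|i]; [exact: eopen|exact: sf].
Qed.

Lemma vsmooth_coord U n (f : U -> 'rV[R]_n) :
  vsmooth f <-> forall i, vsmooth (fun u => f u ord0 i).
Proof.
have E i x : ext f x ord0 i = ext (fun u => f u ord0 i) x.
  by rewrite /ext; case: insub => //; rewrite mxE.
split=> [sf i k|H k].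
  have := proj1 (kdiff_coord k (ext f) (eopen U)) (sf k) i.
  by under eq_fun do rewrite E.
apply/kdiff_coord => [|i]; first exact: eopen.
by under eq_fun do rewrite E; exact: H.
Qed.

Lemma vsmooth_epoint U : vsmooth (@epoint R U).
Proof.
apply: (@vsmooth_of U _ id) => // k.
by apply: (@kdiff_lin R 'rV[R]_(edim U) 'rV[R]_(edim U) k _ idfun) => x; exact: cvg_id.
Qed.

Lemma derive_ext_comp U V (f : U -> V) (g : V -> R) u v :
  differentiable (ext (fun u => epoint (f u))) (epoint u) ->
  differentiable (ext g) (epoint (f u)) ->
  'D_v (ext (g \o f)) (epoint u) = 'D_(ediff f u v) (ext g) (epoint (f u)).
Proof.
move=> df dg.
have E : ext (fun u => epoint (f u)) (epoint u) = epoint (f u) by rewrite extE.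
rewrite (@near_derive _ _ _ _ (ext g \o ext (fun u => epoint (f u)))); last first.
  have nU : nbhs (epoint u) (eset U).
    by apply: open_nbhs_nbhs; split; [exact: eopen|exact: epointP].
  by apply: filterS nU => x Ux; rewrite /= !(extP _ Ux) /= extE.
rewrite -E in dg *.
rewrite deriveE; last exact: differentiable_comp.
by rewrite diff_comp//= [RHS]deriveE// /ediff deriveE.
Qed.

Lemma ediff_coord U V (f : U -> V) u v i : esmooth f ->
  ediff f u v ord0 i = 'D_v (ext (fun u => epoint (f u) ord0 i)) (epoint u).
Proof.
move=> sf; rewrite /ediff -derive_coord; last exact: vsmooth_differentiable.
apply/esym/near_derive; near=> x; rewrite /ext; case: insub => //; rewrite mxE.
Unshelve. all: by end_near.
Qed.

Lemma near_restr U (W : normedModType R) A (oA : open A) (f : U -> W) (w : restr oA) :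
  \forall x \near epoint w, ext (fun w : restr oA => f (rincl w)) x = ext f x.
Proof.
have nU : nbhs (epoint w) (eset (restr oA)).
  by apply: open_nbhs_nbhs; split; [exact: eopen|exact: epointP].
apply: filterS nU => x Ux; rewrite (extP _ Ux) /= (extP _ (proj1 Ux)).
by congr f; exact: epoint_inj.
Qed.

Lemma derive_restr U (W : normedModType R) A (oA : open A) (f : U -> W) (w : restr oA) v :
  'D_v (ext (fun w : restr oA => f (rincl w))) (epoint w) = 'D_v (ext f) (epoint (rincl w)).
Proof. by apply: near_derive; exact: near_restr. Qed.

Lemma ediff_rincl U A (oA : open A) (w : @restr R U A oA) v : ediff (@rincl R U A oA) w v = v.
Proof.
rewrite /ediff (@derive_ext (restr oA) _ id) //.
have [_ ->//] := is_derive_id (epoint w) v.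
Qed.

Lemma vsmooth_localR U (f : U -> R) :
  (forall u : U, exists (A : set 'rV[R]_(edim U)) (oA : open A),
    A (epoint u) /\ vsmooth (fun w : restr oA => f (rincl w))) ->
  vsmooth f.
Proof.
move=> H; have /vsmooth_coord/(_ ord0) : vsmooth (fun u => \row_(i < 1) f u).
  apply: vsmooth_local => u; have [A [oA [Au sf]]] := H u.
  exists A, oA; split=> //; apply/vsmooth_coord => i.
  by under eq_fun do rewrite mxE.
by under eq_fun do rewrite mxE.
Qed.

Definition dsub U (B : set U) (oB : dopen B) : edom := @restr R U _ oB.

Lemma dsubP U (B : set U) (oB : dopen B) (w : dsub oB) : B (rincl w).
Proof.
have [_ [u Bu uw]] := epointP w.
by rewrite (_ : rincl w = u)//; apply: epoint_inj.
Qed.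

Definition dsub_in U (B : set U) (oB : dopen B) u (Bu : B u) : dsub oB :=
  @Defs.mkset _ (eset (dsub oB)) (epoint u) (conj (epointP u) (ex_intro2 _ _ u Bu erefl)).

Lemma dsub_inK U (B : set U) (oB : dopen B) u (Bu : B u) : rincl (dsub_in oB Bu) = u.
Proof. exact: epoint_inj. Qed.

Lemma dsub_lift U V (B : set U) (oB : dopen B) (f : V -> U) (fB : forall v, B (f v)) :
  esmooth f -> exists2 g : V -> dsub oB, esmooth g & forall v, rincl (g v) = f v.
Proof. by move=> sf; exists (fun v => dsub_in oB (fB v)) => // v; exact: dsub_inK. Qed.

Lemma dopen_nbhs U (B : set U) : (forall u, B u ->
  exists A : set 'rV[R]_(edim U), [/\ open A, A (epoint u) &
    forall w, A (epoint w) -> B w]) -> dopen B.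
Proof.
move=> H; rewrite /dopen openE => _ [u Bu <-].
have [A [oA Au AB]] := H u Bu.
have n1 : nbhs (epoint u) (eset U `&` A).
  by apply: open_nbhs_nbhs; split; [exact: openI (eopen U) oA|split=> //; exact: epointP].
apply: filterS n1 => x [Ux Ax]; exists (@Defs.mkset _ (eset U) _ Ux) => //.
exact: AB.
Qed.

Lemma dopen_comp U V (f : U -> V) (B : set V) : esmooth f -> dopen B -> dopen (f @^-1` B).
Proof.
move=> sf oB; apply: dopen_nbhs => u Bu.
have [A [oA [g [AB sg gE]]]] := esmooth_lift oB sf.
exists A; split=> //; first by apply: AB; exists (f u).
move=> w Aw; pose w' : restr oA := @Defs.mkset _ (eset (restr oA)) _ (conj (epointP w) Aw).
have := dsubP (g w'); rewrite gE /=.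
by rewrite (_ : rincl w' = w)//; exact: epoint_inj.
Qed.

Lemma xdom_open U k : open [set w : 'rV[R]_(edim U + k) | eset U (lsubmx w)].
Proof.
apply: (@open_comp _ _ (lsubmx : 'rV[R]_(edim U + k) -> _)); last exact: eopen.
by move=> x _; exact: continuous_lsubmx.
Qed.

(** [U x R^k] as a domain. The additional coordinates serve as a deformation parameter in
    [jet_perturb] and as fibre directions in [jet_family]. *)
Definition xdom U k : edom := Edom (@xdom_open U k).

Definition pfst U k (w : xdom U k) : U :=
  @Defs.mkset _ (eset U) (lsubmx (epoint w)) (epointP w).

Definition psnd U k (w : xdom U k) : 'rV[R]_k := rsubmx (epoint w).

Lemma pmk_in U k (u : U) (s : 'rV[R]_k) : eset (xdom U k) (row_mx (epoint u) s).
Proof. by rewrite /= row_mxKl; exact: epointP. Qed.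

Definition pmk U k (u : U) (s : 'rV[R]_k) : xdom U k :=
  @Defs.mkset _ (eset (xdom U k)) _ (@pmk_in U k u s).

Lemma pfst_mk U k (u : U) (s : 'rV[R]_k) : pfst (pmk u s) = u.
Proof. by apply: epoint_inj; rewrite -[LHS]/(lsubmx (row_mx (epoint u) s)) row_mxKl. Qed.

Lemma psnd_mk U k (u : U) (s : 'rV[R]_k) : psnd (pmk u s) = s.
Proof. by rewrite -[LHS]/(rsubmx (row_mx (epoint u) s)) row_mxKr. Qed.

Lemma esmooth_pfst U k : esmooth (@pfst U k).
Proof. by apply: (@vsmooth_of (xdom U k) _ lsubmx) => // i; apply: kdiff_lin; exact: continuous_lsubmx. Qed.

Lemma vsmooth_psnd U k : vsmooth (@psnd U k).
Proof. by apply: (@vsmooth_of (xdom U k) _ rsubmx) => // i; apply: kdiff_lin; exact: continuous_rsubmx. Qed.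

Lemma ediff_pfst U k (w : xdom U k) v : ediff (@pfst U k) w v = lsubmx v.
Proof.
rewrite /ediff (@derive_ext (xdom U k) _ lsubmx) //.
have dl : differentiable (lsubmx : 'rV[R]_(edim U + k) -> _) (epoint w).
  exact: differentiable_lsubmx.
by rewrite deriveE// diff_lin//; exact: continuous_lsubmx.
Qed.

Lemma vsmooth_row_mx V m n (f : V -> 'rV[R]_m) (g : V -> 'rV[R]_n) :
  vsmooth f -> vsmooth g -> vsmooth (fun v => row_mx (f v) (g v)).
Proof.
move=> /vsmooth_coord sf /vsmooth_coord sg; apply/vsmooth_coord => i.
have [j ->|j ->] := split_ordP i.
  by under eq_fun do rewrite row_mxEl; exact: sf.
by under eq_fun do rewrite row_mxEr; exact: sg.
Qed.

Lemma derive_row_mx V m n (f : V -> 'rV[R]_m) (g : V -> 'rV[R]_n) v w :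
  vsmooth f -> vsmooth g ->
  'D_w (ext (fun v => row_mx (f v) (g v))) (epoint v) =
  row_mx ('D_w (ext f) (epoint v)) ('D_w (ext g) (epoint v)).
Proof.
move=> sf sg.
have C n' (h : V -> 'rV[R]_n') i : vsmooth h ->
    'D_w (ext h) (epoint v) ord0 i = 'D_w (ext (fun u => h u ord0 i)) (epoint v).
  move=> sh; rewrite -derive_coord; last exact: vsmooth_differentiable.
  by apply: near_derive; near=> x; rewrite /ext; case: insub => //; rewrite mxE.
apply/rowP => i; rewrite C; last exact: vsmooth_row_mx.
have [j ->|j ->] := split_ordP i.
  by rewrite row_mxEl C//; under eq_fun do rewrite row_mxEl.
by rewrite row_mxEr C//; under eq_fun do rewrite row_mxEr.
Unshelve. all: by end_near.
Qed.

Lemma esmooth_pmk U V k (f : V -> U) (s : V -> 'rV[R]_k) :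
  esmooth f -> vsmooth s -> esmooth (fun v => pmk (f v) (s v)).
Proof. exact: vsmooth_row_mx. Qed.

Lemma ediff_pmk U V k (f : V -> U) (s : V -> 'rV[R]_k) v w : esmooth f -> vsmooth s ->
  ediff (fun v => pmk (f v) (s v)) v w = row_mx (ediff f v w) ('D_w (ext s) (epoint v)).
Proof. exact: derive_row_mx. Qed.

Definition rdom k : edom := @Edom R k setT openT.

Definition rpt k (s : 'rV[R]_k) : rdom k := @Defs.mkset _ (eset (rdom k)) s Logic.I.

Definition bdom k (d : R) : edom := @Edom R k (ball 0 d) (ball_open _ _).

Lemma derive_mul0 V (a b : V -> R) v w : vsmooth a -> vsmooth b ->
  a v = 0 -> b v = 0 -> 'D_w (ext (fun v => a v * b v)) (epoint v) = 0.
Proof.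
move=> sa sb a0 b0.
rewrite (@derive_ext V _ (fun x => ext a x * ext b x)); last by move=> u; rewrite !extE.
rewrite [LHS](@deriveM _ _ (ext a) (ext b)); try exact/diff_derivable/vsmooth_differentiable.
by rewrite !extE a0 b0 !scale0r addr0.
Qed.
End Domains.

(** * Model spaces and derivatives tested by functionals *)

Section Models.
Context {R : realType}.
Local Notation edom := (edom R).
Implicit Types U V W : edom.

(* Convenient spaces without their topology: only the continuous functionals and
   the existence of directional derivatives of scalarwise smooth maps are retained. *)
Record cvs := Cvs {
  ccar :> lmodType R;
  cfun : set (ccar -> R);
  cfun_lin : forall l, cfun l -> forall a x y, l (a *: x + y) = a * l x + l y;
  cfun_sep : forall x, (forall l, cfun l -> l x = 0) -> x = 0;
  cfun_diff : forall U (P : U -> ccar) u v,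
    (forall l, cfun l -> vsmooth (fun u => l (P u))) ->
    exists y, forall l, cfun l -> l y = 'D_v (ext (fun u => l (P u))) (epoint u) }.

Definition sm (E : cvs) U (P : U -> E) : Prop :=
  forall l, cfun l -> vsmooth (fun u => l (P u)).

(* junk unless P is scalarwise smooth *)
Definition dvec (E : cvs) U (P : U -> E) (u : U) v : E :=
  xget 0 [set y | forall l, cfun l -> l y = 'D_v (ext (fun u => l (P u))) (epoint u)].

Section Model.
Context (E : cvs).
Implicit Types P Q : forall U, U -> E.

Lemma cfunD l : cfun l -> forall x y : E, l (x + y) = l x + l y.
Proof. by move=> hl x y; rewrite -[x]scale1r cfun_lin// mul1r scale1r. Qed.

Lemma cfun0 l : cfun l -> l (0 : E) = 0.
Proof.
move=> hl; have := cfun_lin hl 1 0 0; rewrite scale1r addr0 mul1r => /eqP.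
by rewrite -subr_eq0 opprD addNKr oppr_eq0 => /eqP.
Qed.

Lemma cfunZ l : cfun l -> forall a (x : E), l (a *: x) = a * l x.
Proof. by move=> hl a x; rewrite -[a *: x]addr0 cfun_lin// cfun0// addr0. Qed.

Lemma cfunB l : cfun l -> forall x y : E, l (x - y) = l x - l y.
Proof. by move=> hl x y; rewrite cfunD// -scaleN1r cfunZ// mulN1r. Qed.

Lemma cfun_sum l n (f : 'I_n -> E) : cfun l -> l (\sum_i f i) = \sum_i l (f i).
Proof.
move=> hl; elim: n f => [|n IH] f; first by rewrite !big_ord0 cfun0.
by rewrite !big_ord_recl cfunD// IH.
Qed.

Lemma cfun_ext (x y : E) : (forall l, cfun l -> l x = l y) -> x = y.
Proof.
move=> H; apply/eqP; rewrite -subr_eq0; apply/eqP/cfun_sep => l hl.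
by rewrite cfunB// H// subrr.
Qed.

Lemma dvecE U (P : U -> E) u v y :
  (forall l, cfun l -> l y = 'D_v (ext (fun u => l (P u))) (epoint u)) -> dvec P u v = y.
Proof.
move=> H; apply: cfun_ext => l hl; rewrite H//.
rewrite /dvec; case: xgetP => [z _ ->//|/(_ y)]; by case.
Qed.

Lemma cfun_dvec U (P : U -> E) u v l : sm P -> cfun l ->
  l (dvec P u v) = 'D_v (ext (fun u => l (P u))) (epoint u).
Proof. by move=> sP hl; have [y yP] := cfun_diff u v sP; rewrite (dvecE yP) yP. Qed.

Lemma sm_comp U V (f : U -> V) (P : V -> E) : esmooth f -> sm P -> sm (P \o f).
Proof. by move=> sf sP l hl; exact: (vsmooth_compR (g := fun v => l (P v)) sf (sP l hl)). Qed.

Lemma sm_cst U (x : E) : sm (fun _ : U => x).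
Proof. by move=> l hl; exact: vsmooth_const. Qed.

Lemma smD U (P Q : U -> E) : sm P -> sm Q -> sm (fun u => P u + Q u).
Proof.
move=> sP sQ l hl; rewrite (_ : (fun u => _) = fun u => l (P u) + l (Q u)).
  by apply: vsmoothD; [exact: sP|exact: sQ].
by apply/funext => u; rewrite cfunD.
Qed.

Lemma smZ U (a : U -> R) (P : U -> E) : vsmooth a -> sm P -> sm (fun u => a u *: P u).
Proof.
move=> sa sP l hl; rewrite (_ : (fun u => _) = fun u => a u * l (P u)).
  by apply: vsmoothM => //; exact: sP.
by apply/funext => u; rewrite cfunZ.
Qed.

Lemma sm_sum U n (P : 'I_n -> U -> E) : (forall i, sm (P i)) -> sm (fun u => \sum_i P i u).
Proof.
move=> sP l hl; rewrite (_ : (fun u => _) = fun u => \sum_i l (P i u)).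
  by apply: vsmooth_sum => i; exact: sP.
by apply/funext => u; rewrite cfun_sum.
Qed.

Lemma smB U (P Q : U -> E) : sm P -> sm Q -> sm (fun u => P u - Q u).
Proof.
move=> sP sQ; rewrite (_ : (fun u => _) = fun u => P u + (-1) *: Q u).
  by apply: smD => //; apply: smZ => //; exact: vsmooth_const.
by apply/funext => u; rewrite scaleN1r.
Qed.

Lemma sm_local U (P : U -> E) : (forall u : U, exists (A : set 'rV[R]_(edim U)) (oA : open A),
    A (epoint u) /\ sm (fun w : restr oA => P (rincl w))) -> sm P.
Proof.
by move=> H l hl; apply: vsmooth_localR => u; have [A [oA [Au sP]]] := H u;
  exists A, oA; split=> //; exact: sP.
Qed.

Lemma dvec_comp U V (f : U -> V) (P : V -> E) u v : esmooth f -> sm P ->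
  dvec (P \o f) u v = dvec P (f u) (ediff f u v).
Proof.
move=> sf sP; apply: dvecE => l hl; rewrite cfun_dvec//.
have -> : (fun u => l ((P \o f) u)) = (fun u => l (P u)) \o f by [].
rewrite derive_ext_comp//; first exact: vsmooth_differentiable.
by apply: vsmooth_differentiable; exact: sP.
Qed.

Lemma dvec_restr U A (oA : open A) (P : U -> E) (w : restr oA) v :
  dvec (fun w : restr oA => P (rincl w)) w v = dvec P (rincl w) v.
Proof.
rewrite /dvec; congr xget; apply/seteqP; split=> y yP l hl.
  by rewrite yP// (derive_restr (fun u => l (P u))).
by rewrite yP// -(derive_restr (fun u => l (P u))).
Qed.

Lemma dvecD U (P Q : U -> E) u v : sm P -> sm Q ->
  dvec (fun u => P u + Q u) u v = dvec P u v + dvec Q u v.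
Proof.
move=> sP sQ; apply: dvecE => l hl; rewrite cfunD// !cfun_dvec//.
rewrite [RHS](@derive_ext _ U _ (ext (fun u => l (P u)) \+ ext (fun u => l (Q u)))).
  rewrite [RHS]deriveD//; apply: diff_derivable; apply: vsmooth_differentiable;
    [exact: sP|exact: sQ].
by move=> w; rewrite /= !extE cfunD.
Qed.

Lemma dvecZ U (a : U -> R) (P : U -> E) u v : vsmooth a -> sm P ->
  dvec (fun u => a u *: P u) u v =
  a u *: dvec P u v + 'D_v (ext a) (epoint u) *: P u.
Proof.
move=> sa sP; apply: dvecE => l hl; rewrite cfunD// !cfunZ// cfun_dvec//.
rewrite [RHS](@derive_ext _ U _ (fun x => ext a x * ext (fun u => l (P u)) x)).
  rewrite [RHS](@deriveM _ _ (ext a) (ext (fun u => l (P u)))).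
  - by rewrite !extE /GRing.scale /= [X in _ + X = _]mulrC.
  - exact/diff_derivable/vsmooth_differentiable.
  - by apply/diff_derivable/vsmooth_differentiable; exact: sP.
by move=> w; rewrite /= !extE cfunZ.
Qed.

Lemma dvec_sum U n (P : 'I_n -> U -> E) u v : (forall i, sm (P i)) ->
  dvec (fun u => \sum_i P i u) u v = \sum_i dvec (P i) u v.
Proof.
move=> sP; apply: dvecE => l hl; rewrite cfun_sum//.
rewrite [RHS](@derive_ext _ U _ (\sum_i ext (fun u => l (P i u)))).
  rewrite [RHS]derive_sum => [|i].
    by apply: eq_bigr => i _; rewrite cfun_dvec.
  by apply/diff_derivable/vsmooth_differentiable; exact: sP.
by move=> w; rewrite /= fct_sumE cfun_sum//; apply: eq_bigr => i _; rewrite extE.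
Qed.

Lemma dvec_cst U (x : E) (u : U) v : dvec (fun _ : U => x) u v = 0.
Proof.
apply: dvecE => l hl; rewrite cfun0// [RHS](@derive_ext _ U _ (cst (l x)))//.
by rewrite derive_cst.
Qed.

Lemma dvec_lin U (P : U -> E) u a v w : sm P ->
  dvec P u (a *: v + w) = a *: dvec P u v + dvec P u w.
Proof.
move=> sP; apply: dvecE => l hl; rewrite (cfun_lin hl) !(cfun_dvec _ _ sP hl).
rewrite derive_linear//; apply: vsmooth_differentiable; exact: sP.
Qed.

(** Expanding [h] in the standard basis leaves fixed directional derivatives composed with [g]. *)
Lemma sm_dvec U W (P : U -> E) (g : W -> U) (h : W -> 'rV[R]_(edim U)) :
  sm P -> esmooth g -> vsmooth h -> sm (fun w => dvec P (g w) (h w)).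
Proof.
move=> sP sg /vsmooth_coord sh l hl.
rewrite (_ : (fun w => _) = fun w => \sum_i h w ord0 i *
    'D_(delta_mx ord0 i) (ext (fun u => l (P u))) (epoint (g w))).
  apply: vsmooth_sum => i; apply: vsmoothM => //.
  apply: (vsmooth_compR (g := fun u => 'D_(delta_mx ord0 i) (ext (fun u => l (P u))) (epoint u)) sg).
  apply: (@vsmooth_of _ U _ ('D_(delta_mx ord0 i) (ext (fun u => l (P u))))) => //.
  by apply: vsmooth_ext_derive; exact: sP.
apply/funext => w; rewrite cfun_dvec//.
have dP : differentiable (ext (fun u => l (P u))) (epoint (g w)).
  by apply: vsmooth_differentiable; exact: sP.
rewrite [in LHS](row_coord (h w)) deriveE// linear_sum; apply: eq_bigr => i _.
by rewrite linearZ /= deriveE.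
Qed.
End Model.
End Models.

(** * Taylor's formula with values in a model space *)

Section Taylor.
Context {R : realType} (E : cvs (R := R)) (k : nat) (d : R) (d0 : 0 < d).
Local Notation B := (bdom (R := R) k d).
Local Notation e_ j := (delta_mx ord0 j : 'rV[R]_k).

Definition bpt (s : 'rV[R]_k) (h : ball 0 d s) : B := @Defs.mkset _ (eset B) s h.

Definition b0 : B := bpt (ballxx 0 d0).

Lemma shrink0_ball (j : 'I_k) (s : 'rV[R]_k) : ball 0 d s -> ball 0 d (shrink j 0 s).
Proof. by apply: shrink_ball; rewrite lexx ler01. Qed.

Definition bshrink (j : 'I_k) (s : B) : B := bpt (shrink0_ball j (epointP s)).

Lemma trunc_ball m (s : 'rV[R]_k) : ball 0 d s ->
  ball 0 d (\row_(i < k) (if (i < m)%N then s ord0 i else 0)).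
Proof.
move=> [_ h]; split=> // i j; rewrite !mxE; case: ifP => _.
  by have := h ord0 j; rewrite mxE.
exact: ballxx.
Qed.

Definition btrunc m (s : B) : B := bpt (trunc_ball m (epointP s)).

Lemma vsmooth_bcoord i : vsmooth (fun s : B => epoint s ord0 i).
Proof. exact: (proj1 (vsmooth_coord (@epoint R B)) (@vsmooth_epoint R B) i). Qed.

Lemma esmooth_btrunc m : esmooth (btrunc m).
Proof.
apply/vsmooth_coord => i; case: (boolP (i < m)%N) => im.
  rewrite (_ : (fun u => _) = fun u : B => epoint u ord0 i).
    exact: vsmooth_bcoord.
  by apply/funext => u; rewrite mxE im.
rewrite (_ : (fun u => _) = fun u : B => 0); first exact: vsmooth_const.
by apply/funext => u; rewrite mxE (negbTE im).
Qed.

(** The remainder is a difference quotient, completed by the derivative where [s_j = 0]. Each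
    functional turns it into [hmean], which is smooth across the hyperplane. *)
Lemma hadamard_coord j (Q : B -> E) : sm Q ->
  exists2 r : B -> E, sm r & forall s, Q s = Q (bshrink j s) + epoint s ord0 j *: r s.
Proof.
move=> sQ; pose r (s : B) := if epoint s ord0 j == 0 then dvec Q s (e_ j)
  else (epoint s ord0 j)^-1 *: (Q s - Q (bshrink j s)).
have shrink_id (s : B) : epoint s ord0 j = 0 -> bshrink j s = s.
  move=> s0; apply: epoint_inj; rewrite -[LHS]/(shrink j 0 (epoint s)).
  by rewrite /shrink s0 mulr0 scale0r addr0.
exists r => [l hl|s].
  pose h := ext (fun s => l (Q s)).
  have sh : smooth_on (ball 0 d) h by exact: (sQ l hl).
  have sh' : smooth_on (ball 0 d) ('D_(e_ j) h) by move=> i; exact: (sh i.+1).2.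
  apply: (@vsmooth_of _ B _ (hmean j 0 ('D_(e_ j) h))); last first.
    by move=> i; exact: hmean_kdiff.
  move=> s; rewrite /r; case: eqP => s0.
    by rewrite cfun_dvec// hmean_hyperplane.
  have := hmean_ftc j sh (epointP s).
  rewrite /h -[shrink j 0 _]/(epoint (bshrink j s)) !extE => h1.
  rewrite cfunZ// cfunB// -h1 mulrA mulVf ?mul1r//; exact/eqP.
rewrite /r; case: eqP => s0; first by rewrite s0 scale0r addr0 shrink_id.
by rewrite scalerA divff; [rewrite scale1r addrC subrK|exact/eqP].
Qed.

(** Telescoping sum along the truncations of [s] to its first [m] coordinates: consecutive
    truncations differ by shrinking one coordinate to 0. *)
Lemma hadamard (Q : B -> E) : sm Q ->
  exists2 r : 'I_k -> B -> E, (forall i, sm (r i)) &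
    forall s, Q s = Q b0 + \sum_i epoint s ord0 i *: r i s.
Proof.
move=> sQ; have ex j : exists r : B -> E, sm r /\
    forall s, Q s = Q (bshrink j s) + epoint s ord0 j *: r s.
  by have [r] := hadamard_coord j sQ; exists r.
have [r0 r0P] := choice ex.
exists (fun j s => r0 j (btrunc j.+1 s)) => [j|s].
  by apply: (sm_comp (@esmooth_btrunc j.+1)); exact: (r0P j).1.
have step m : (m <= k)%N ->
    Q (btrunc m s) = Q b0 + \sum_(i < k | (i < m)%N) epoint s ord0 i *: r0 i (btrunc i.+1 s).
  elim: m => [_|m IH mk].
    rewrite big_pred0// addr0; congr Q; apply: epoint_inj; apply/rowP => i.
    by rewrite !mxE.
  pose j : 'I_k := Ordinal mk.
  rewrite ((r0P j).2 (btrunc m.+1 s)) (_ : bshrink j _ = btrunc m s); last first.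
    apply: epoint_inj; apply/rowP => i; rewrite /= shrinkE !mxE.
    case: eqP => [->|/eqP ij]; first by rewrite mul0r /= ltnn.
    by rewrite ltnS leq_eqVlt -[m]/(j : nat) val_eqE (negbTE ij).
  rewrite IH ?(ltnW mk)// -addrA; congr (_ + _).
  rewrite [RHS](bigD1 j) //= addrC mxE /= ltnSn; congr (_ + _).
  by apply: eq_bigl => i; rewrite -val_eqE /= ltnS andbC -ltn_neqAle.
have := step k (leqnn k).
rewrite (_ : btrunc k s = s); last first.
  by apply: epoint_inj; apply/rowP => i; rewrite mxE ltn_ord.
move=> ->; congr (_ + _); apply: eq_bigl => i; exact: ltn_ord.
Qed.

Lemma derive_bcoord i v : 'D_v (ext (fun s : B => epoint s ord0 i)) (epoint b0) = v ord0 i.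
Proof.
rewrite -(@ediff_coord _ B B id)//; last exact: vsmooth_epoint.
rewrite /ediff (@derive_ext _ B _ id)//.
by have [_ ->] := is_derive_id (epoint b0) v.
Qed.

(** [hadamard] is applied to [Q] and then to its remainders, whose values at 0 are the partial
    derivatives of [Q]. *)
Lemma taylor2 (Q : B -> E) : sm Q ->
  exists2 r : 'I_k -> 'I_k -> B -> E, (forall i j, sm (r i j)) &
    forall s, Q s = Q b0 + \sum_i epoint s ord0 i *: dvec Q b0 (e_ i) +
      \sum_i \sum_j (epoint s ord0 i * epoint s ord0 j) *: r i j s.
Proof.
move=> sQ; have [r1 sr1 r1E] := hadamard sQ.
have ex i : exists r : 'I_k -> B -> E, (forall j, sm (r j)) /\
    forall s, r1 i s = r1 i b0 + \sum_j epoint s ord0 j *: r j s.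
  by have [r] := hadamard (sr1 i); exists r.
have [r rP] := choice ex.
exists r => [i|s]; first exact: (rP i).1.
have d1 i : dvec Q b0 (e_ i) = r1 i b0.
  rewrite (_ : Q = fun s => Q b0 + \sum_i epoint s ord0 i *: r1 i s); last exact/funext.
  have sZ j : sm (fun s : B => epoint s ord0 j *: r1 j s).
    by apply: smZ => //; exact: vsmooth_bcoord.
  rewrite dvecD; [|exact: sm_cst|exact: sm_sum].
  rewrite dvec_cst add0r dvec_sum//.
  rewrite (bigD1 i)//= dvecZ//; last exact: vsmooth_bcoord.
  rewrite derive_bcoord !mxE !eqxx /= scale0r add0r scale1r big1 ?addr0// => j ji.
  rewrite dvecZ//; last exact: vsmooth_bcoord.
  by rewrite derive_bcoord !mxE (negbTE ji) !scale0r addr0.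
rewrite r1E -addrA; congr (_ + _); rewrite -big_split /=; apply: eq_bigr => i _.
rewrite d1 {1}(rP i).2 scalerDr; congr (_ + _).
by rewrite scaler_sumr; apply: eq_bigr => j _; rewrite scalerA.
Qed.
End Taylor.

(** * Jets in charts *)

Section Charts.
Context {R : realType}.
Local Notation edom := (edom R).
Local Notation diffspace := (diffspace R).
Implicit Types U V W : edom.

(* cphi matters only on cD. Openness is tested on plots. *)
Record chart (X : diffspace) := Chart {
  cE : cvs (R := R);
  cD : set X;
  cphi : X -> cE;
  cD_open : forall U (p : U -> X), plot p -> dopen (p @^-1` cD);
  cphi_inj : forall x y, cD x -> cD y -> cphi x = cphi y -> x = y;
  cimg_open : forall U (P : U -> cE), sm P -> dopen (P @^-1` (cphi @` cD));
  cphi_plot : forall U (p : U -> X), (forall u, cD (p u)) ->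
    plot p <-> sm (fun u => cphi (p u)) }.

(* Elements of F U are jets of maps R^k -> U at 0, i.e. a point with k tangent vectors. *)
Record jets (k : nat) := Jets {
  jF :> efun (R := R);
  jpt : forall U, jF U -> U;
  jvec : forall U, jF U -> 'I_k -> 'rV[R]_(edim U);
  jmk : forall U, U -> ('I_k -> 'rV[R]_(edim U)) -> jF U;
  jptK : forall U (xi : jF U), jmk (jpt xi) (jvec xi) = xi;
  jpt_mk : forall U (u : U) v, jpt (jmk u v) = u;
  jvec_mk : forall U (u : U) v, jvec (jmk u v) = v;
  jmap : forall U V (f : U -> V) u v,
    emap f (jmk u v) = jmk (f u) (fun i => ediff f u (v i));
  jplot : forall W U (g : W -> jF U),
    plot g <-> esmooth (fun w => jpt (g w)) /\ forall i, vsmooth (fun w => jvec (g w) i) }.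

Section LocalSmooth.
Context (E : cvs (R := R)).

(** Smoothness near [u] only: the chart expression of a plot is meaningful just where the plot meets
    the chart domain. *)
Definition lsm U (P : U -> E) (u : U) : Prop :=
  exists (B : set U) (oB : dopen B), B u /\ sm (fun w : dsub oB => P (rincl w)).

Lemma dvec_compl U V (f : U -> V) (P : V -> E) u v : esmooth f -> lsm P (f u) ->
  dvec (P \o f) u v = dvec P (f u) (ediff f u v).
Proof.
move=> sf [B [oB [Bu sP]]].
have fB (w : dsub (dopen_comp sf oB)) : B (f (rincl w)) by exact: (dsubP w).
have [g sg gE] := @dsub_lift _ _ _ _ oB (fun w : dsub (dopen_comp sf oB) => f (rincl w)) fB
  (esmooth_comp (@esmooth_rincl R _ _ _) sf).
pose w := dsub_in (dopen_comp sf oB) Bu.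
have wE : rincl w = u by exact: dsub_inK.
rewrite -{1}wE -dvec_restr.
rewrite (_ : (fun w => _) = (fun w => P (rincl w)) \o g); last first.
  by apply/funext => w' /=; rewrite gE.
have -> : ediff f u v = ediff g w v.
  rewrite -[RHS]/(ediff (fun w => rincl (g w)) w v).
  rewrite (_ : (fun w => rincl (g w)) = fun w => f (rincl w)); last first.
    by apply/funext => w'; rewrite gE.
  by rewrite /ediff (derive_restr (fun u => epoint (f u))) wE.
by rewrite (dvec_comp w v sg sP) (@dvec_restr _ _ V _ oB P) gE wE.
Qed.

Lemma dvec_linl U (P : U -> E) u a v w : lsm P u ->
  dvec P u (a *: v + w) = a *: dvec P u v + dvec P u w.
Proof.
move=> [B [oB [Bu sP]]]; pose w' := dsub_in oB Bu.
have wE : rincl w' = u by exact: dsub_inK.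
by rewrite -wE -!(@dvec_restr _ _ U _ oB) dvec_lin.
Qed.
End LocalSmooth.

Section Jets.
Context (X : diffspace) (c : chart X) (k : nat) (J : jets k).
Local Notation E := (cE c).
Local Notation O := (cphi c @` cD c).
Local Notation phi := (cphi c).
Local Notation T := (LD J X).

Lemma chart_lsm U (p : U -> X) u : plot p -> cD c (p u) -> lsm (fun u => phi (p u)) u.
Proof.
move=> pp Du; exists (p @^-1` cD c), (cD_open pp); split=> //.
apply/(proj1 (cphi_plot (c := c) (p := fun w => p (rincl w)) _)).
  by move=> w; exact: (dsubP w).
exact: (plot_comp (@esmooth_rincl R U _ (cD_open pp)) pp).
Qed.

Definition cinv e (h : O e) : X := projT1 (cid2 h).

Lemma cinv_D e (h : O e) : cD c (cinv h).
Proof. by rewrite /cinv; case: cid2. Qed.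

Lemma cinvK e (h : O e) : phi (cinv h) = e.
Proof. by rewrite /cinv; case: cid2. Qed.

(** The inverse chart after [P], on the open set where [P] takes values in the chart image. *)
Definition lplot U (P : U -> E) (sP : sm P) (w : dsub (cimg_open sP)) : X :=
  cinv (dsubP w).

Lemma lplot_plot U (P : U -> E) (sP : sm P) : plot (lplot (sP := sP)).
Proof.
apply/cphi_plot => [w|]; first exact: cinv_D.
rewrite (_ : (fun u => _) = P \o (@rincl R U _ (cimg_open sP))).
  exact: (sm_comp (@esmooth_rincl R U _ (cimg_open sP)) sP).
by apply/funext => w; rewrite /lplot cinvK.
Qed.

Definition jet U (P : U -> E) (sP : sm P) (u : U) (hu : O (P u)) (v : 'I_k -> 'rV[R]_(edim U)) : T :=
  star (lplot_plot sP) (jmk J (dsub_in (cimg_open sP) hu) v).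

Lemma jet_eq U (P : U -> E) (sP : sm P) u u' (hu : O (P u)) (hu' : O (P u')) v v' :
  u = u' -> v = v' -> jet sP hu v = jet sP hu' v'.
Proof. by move=> uu vv; subst u' v'; congr jet; exact: Prop_irrelevance. Qed.

(** The generating relation of the quotient, restated for maps into the model space. *)
Lemma jet_pull U W (f : W -> U) (P : U -> E) (Q : W -> E) (sP : sm P) (sQ : sm Q)
    w (hw : O (Q w)) (hu : O (P (f w))) v :
  esmooth f -> (forall w, Q w = P (f w)) ->
  jet sQ hw v = jet sP hu (fun i => ediff f w (v i)).
Proof.
move=> sf QP.
have fO (z : dsub (cimg_open sQ)) : (P @^-1` O) (f (rincl z)).
  by have := dsubP z; rewrite /preimage /= QP.
have [g sg gE] := @dsub_lift _ _ _ _ (cimg_open sP) (fun w : dsub (cimg_open sQ) => f (rincl w)) fO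
  (esmooth_comp (@esmooth_rincl R _ _ _) sf).
have lE : lplot (sP := sQ) = lplot (sP := sP) \o g.
  apply/funext => w'; apply: (@cphi_inj _ c); try exact: cinv_D.
  by rewrite /lplot /= !cinvK gE QP.
rewrite /jet (star_eq _ (plot_comp sg (lplot_plot sP)) _ lE).
rewrite (star_comp (lplot_plot sP) (plot_comp sg (lplot_plot sP)) _ sg).
rewrite (jmap J g).
apply: (f_equal (star _)); apply: (f_equal2 (@jmk _ J _)); first by
  apply: epoint_inj; rewrite -epoint_rincl gE dsub_inK.
apply/funext => i; set w' := dsub_in _ hw.
have wE : rincl w' = w by exact: dsub_inK.
rewrite -[LHS]/(ediff (fun w => rincl (g w)) w' (v i)).
rewrite (_ : (fun w => rincl (g w)) = fun w => f (rincl w)); last first.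
  by apply/funext => w''; rewrite gE.
by rewrite /ediff (derive_restr (fun u => epoint (f u))) wE.
Qed.

(* Both jets are pulled back from P(s) + t r(s), along (s, 0) and (s, a(s) b(s)). *)
Lemma jet_perturb U (P Q r : U -> E) (a b : U -> R) (sP : sm P) (sQ : sm Q)
    u (hP : O (P u)) (hQ : O (Q u)) v :
  sm r -> vsmooth a -> vsmooth b -> a u = 0 -> b u = 0 ->
  (forall u, Q u = P u + (a u * b u) *: r u) -> jet sQ hQ v = jet sP hP v.
Proof.
move=> sr sa sb a0 b0 QE.
pose q (w : xdom U 1) : E := P (pfst w) + (psnd w ord0 ord0) *: r (pfst w).
have sq : sm q.
  apply: smD; first by apply: sm_comp sP; exact: esmooth_pfst.
  apply: smZ; last by apply: sm_comp sr; exact: esmooth_pfst.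
  exact: (proj1 (vsmooth_coord (@psnd R U 1)) (@vsmooth_psnd R U 1) ord0).
pose s u : 'rV[R]_1 := \row_i (a u * b u).
have ss : vsmooth s.
  by apply/vsmooth_coord => i; under eq_fun do rewrite mxE; exact: vsmoothM.
have s0 : vsmooth (fun _ : U => 0 : 'rV[R]_1) by exact: vsmooth_cst.
have sid : esmooth (@id U) by exact: vsmooth_epoint.
have su0 : s u = 0 by apply/rowP => i; rewrite !mxE a0 mul0r.
have sf1 : esmooth (fun u => pmk u (s u)) by exact: esmooth_pmk.
have sf0 : esmooth (fun u : U => pmk u (0 : 'rV[R]_1)) by exact: (esmooth_pmk sid s0).
have q0 u' : q (pmk u' 0) = P u' by rewrite /q pfst_mk psnd_mk mxE scale0r addr0.
have q1 u' : q (pmk u' (s u')) = Q u' by rewrite /q pfst_mk psnd_mk mxE QE.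
have h0 : O (q (pmk u 0)) by rewrite q0.
have h1 : O (q (pmk u (s u))) by rewrite q1.
rewrite (@jet_pull _ _ (fun u : U => pmk u (0 : 'rV[R]_1)) _ _ sq sP u hP h0 v sf0 (fun w => esym (q0 w))).
rewrite (@jet_pull _ _ (fun u => pmk u (s u)) _ _ sq sQ u hQ h1 v sf1 (fun w => esym (q1 w))).
apply: jet_eq; first by rewrite su0.
apply/funext => i; rewrite (ediff_pmk _ _ sid ss) (ediff_pmk _ _ sid s0); congr row_mx.
rewrite [RHS](@derive_ext _ U _ (cst 0))// derive_cst.
apply/rowP => j; rewrite mxE -derive_coord; last exact: vsmooth_differentiable.
rewrite -[RHS](derive_mul0 (v i) sa sb a0 b0); apply: near_derive.
by near=> x; rewrite /ext; case: insub => [w|]; rewrite !mxE.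
Unshelve. all: by end_near.
Qed.

Definition lin (x : E) (y : 'I_k -> E) (s : rdom k) : E := x + \sum_i epoint s ord0 i *: y i.

Lemma vsmooth_ecoord U i : vsmooth (fun u : U => epoint u ord0 i).
Proof. exact: (proj1 (vsmooth_coord (@epoint R U)) (@vsmooth_epoint R U) i). Qed.

Lemma sm_lin x y : sm (lin x y).
Proof.
apply: smD; first exact: sm_cst.
by apply: sm_sum => i; apply: smZ; [exact: vsmooth_ecoord|exact: sm_cst].
Qed.

Lemma lin0 x y : lin x y (rpt 0) = x.
Proof. by rewrite /lin big1 ?addr0// => i _; rewrite mxE scale0r. Qed.

Definition jlin x y (hx : O (lin x y (rpt 0))) : T :=
  jet (sm_lin x y) hx (fun i => delta_mx ord0 i).

Lemma ball_line_in U (u : U) (v : 'I_k -> 'rV[R]_(edim U)) : exists2 d : R, 0 < d &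
  forall s : 'rV[R]_k, ball 0 d s -> eset U (epoint u + \sum_i s ord0 i *: v i).
Proof.
pose F (s : 'rV[R]_k) := epoint u + \sum_i s ord0 i *: v i.
have cF : {for 0, continuous F}.
  apply: differentiable_continuous; apply: (@differentiableD _ _ _ (cst _)) => //.
  rewrite (_ : (fun s : 'rV[R]_k => _) = \sum_i (fun s : 'rV[R]_k => s ord0 i *: v i)).
    by apply: differentiable_sum => i; apply: differentiableZl; exact: differentiable_coord.
  by apply/funext => s; rewrite fct_sumE.
have nU : nbhs (F 0) (eset U).
  apply: open_nbhs_nbhs; split; first exact: eopen.
  rewrite /F big1 ?addr0 => [|i _]; last by rewrite mxE scale0r.
  exact: epointP.
by have /nbhs_ballP[d d0 bd] := cF _ nU; exists d.
Qed.

(** [P] is pulled back to a small ball by the affine map [a] spanned by [v]. Then the quadratic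
    terms of [taylor2] are removed one at a time by [jet_perturb]; each vanishes at the base point,
    so the value there stays in the chart image. *)
Lemma jet_lin U (P : U -> E) (sP : sm P) u (hu : O (P u)) v
    (hx : O (lin (P u) (fun i => dvec P u (v i)) (rpt 0))) :
  jet sP hu v = jlin hx.
Proof.
have [d d0 bd] := ball_line_in u v.
pose B := bdom (R := R) k d; pose o : B := b0 k d0.
pose a (s : B) : U := @Defs.mkset _ (eset U) _ (bd _ (epointP s)).
have sa : esmooth a.
  apply/vsmooth_coord => j; rewrite (_ : (fun s => _) = fun s : B =>
    epoint u ord0 j + \sum_i epoint s ord0 i * v i ord0 j).
    apply: vsmoothD; first exact: vsmooth_const.
    by apply: vsmooth_sum => i; apply: vsmoothM; [exact: vsmooth_ecoord|exact: vsmooth_const].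
  by apply/funext => s; rewrite !mxE summxE; congr (_ + _); apply: eq_bigr => i _; rewrite mxE.
have ao : a o = u.
  apply: epoint_inj; rewrite -[LHS]/(epoint u + \sum_i (0 : 'rV[R]_k) ord0 i *: v i).
  by rewrite big1 ?addr0// => i _; rewrite mxE scale0r.
pose e_ i : 'rV[R]_k := delta_mx ord0 i.
have da i : ediff a o (e_ i) = v i.
  apply/rowP => j; rewrite ediff_coord//.
  rewrite (_ : (fun s => _) = fun s : B =>
    epoint u ord0 j + \sum_i epoint s ord0 i * v i ord0 j); last first.
    by apply/funext => s; rewrite !mxE summxE; congr (_ + _); apply: eq_bigr => i' _; rewrite mxE.
  rewrite (@derive_ext _ B _ (fun x : 'rV[R]_k => epoint u ord0 j +
    \sum_i x ord0 i * v i ord0 j))//.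
  have [l lE] : exists l : {linear 'rV[R]_k -> R},
      l = (fun x : 'rV[R]_k => \sum_i x ord0 i * v i ord0 j) :> (_ -> _).
    apply: linear_bundle => t x y; rewrite scaler_sumr -big_split; apply: eq_bigr => i' _.
    by rewrite !mxE mulrDl -mulrA.
  have dl (x : 'rV[R]_k) : differentiable l x.
    rewrite lE (_ : (fun x : 'rV[R]_k => _) =
      \sum_i (fun x : 'rV[R]_k => x ord0 i * v i ord0 j)); last first.
      by apply/funext => y; rewrite fct_sumE.
    apply: differentiable_sum => i'.
    apply: (@differentiableM _ _ (fun x : 'rV[R]_k => x ord0 i') (cst (v i' ord0 j))) => //.
    exact: differentiable_coord.
  rewrite (_ : (fun x : 'rV[R]_k => _ + _) = cst (epoint u ord0 j) \+ l); last first.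
    by apply/funext => x; rewrite /= lE.
  rewrite deriveD//; last exact: diff_derivable.
  rewrite derive_cst add0r deriveE// diff_lin//; last first.
    by move=> x; exact: differentiable_continuous.
  rewrite lE (bigD1 i)//= !mxE !eqxx mul1r big1 ?addr0// => i' i'i.
  by rewrite !mxE (negbTE i'i) andbF mul0r.
have sPa : sm (P \o a) by exact: sm_comp.
have hPa : O ((P \o a) o) by rewrite /= ao.
have huo : O (P (a o)) by rewrite ao.
have -> : jet sP hu v = jet sPa hPa e_.
  rewrite (@jet_pull _ _ a _ _ sP sPa o hPa huo e_ sa)//.
  by apply: jet_eq => //; apply/funext => i; rewrite da.
have [r sr rE] := taylor2 d0 sPa.
pose y i := dvec P u (v i).
have yE i : dvec (P \o a) o (e_ i) = y i by rewrite dvec_comp// da ao.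
pose L (s : B) : E := P u + \sum_i epoint s ord0 i *: y i.
have sL : sm L.
  apply: smD; first exact: sm_cst.
  by apply: sm_sum => i; apply: smZ; [exact: vsmooth_ecoord|exact: sm_cst].
have hL : O (L o).
  by rewrite /L big1 ?addr0// => i _; rewrite [epoint o]/(0 : 'rV[R]_k) mxE scale0r.
have step (S : seq ('I_k * 'I_k)) (Q : B -> E) (sQ : sm Q) (hQ : O (Q o)) :
    (forall s, Q s = L s + \sum_(p <- S) (epoint s ord0 p.1 * epoint s ord0 p.2) *: r p.1 p.2 s) ->
    jet sQ hQ e_ = jet sL hL e_.
  elim: S Q sQ hQ => [|p S IH] Q sQ hQ QE.
    have QL : Q = L by apply/funext => s; rewrite QE big_nil addr0.
    by subst Q; rewrite (Prop_irrelevance sQ sL); exact: jet_eq.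
  pose Q' s := L s + \sum_(p <- S) (epoint s ord0 p.1 * epoint s ord0 p.2) *: r p.1 p.2 s.
  have QQ' s : Q s = Q' s + (epoint s ord0 p.1 * epoint s ord0 p.2) *: r p.1 p.2 s.
    by rewrite QE big_cons [X in L s + X]addrC addrA.
  have sQ' : sm Q'.
    rewrite (_ : Q' = fun s => Q s - (epoint s ord0 p.1 * epoint s ord0 p.2) *: r p.1 p.2 s).
      apply: smB => //; apply: smZ; last exact: sr.
      by apply: vsmoothM; exact: vsmooth_ecoord.
    by apply/funext => s; rewrite QQ' addrK.
  have hQ' : O (Q' o).
    have := hQ; rewrite QQ' [epoint o]/(0 : 'rV[R]_k) mxE mul0r scale0r addr0; exact.
  rewrite -(IH Q' sQ' hQ') //.
  apply: (jet_perturb sQ' sQ hQ' hQ e_ (sr p.1 p.2)) QQ'; try exact: vsmooth_ecoord.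
  - by rewrite [epoint o]/(0 : 'rV[R]_k) mxE.
  - by rewrite [epoint o]/(0 : 'rV[R]_k) mxE.
rewrite (step (index_enum _) (P \o a) sPa hPa) => [|s]; last first.
  rewrite rE -[in RHS](pair_bigA _ (fun i j => (epoint s ord0 i * epoint s ord0 j) *: r i j s)) /=.
  apply: (f_equal (fun x => x + _)); apply: (f_equal2 +%R); first by rewrite /= ao.
  by apply: eq_bigr => i _; rewrite yE.
(* The affine map extends to all of [R^k], which makes the normal form independent of the radius
   [d]. *)
pose f (s : B) : rdom k := rpt (epoint s).
have sf : esmooth f by exact: vsmooth_epoint.
rewrite /jlin (@jet_pull _ _ f _ _ (sm_lin (P u) y) sL o hL hx e_ sf)//.
apply: jet_eq => //; apply/funext => i.
rewrite /ediff (@derive_ext _ B _ id)//.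
by have [_ ->] := is_derive_id (epoint o) (e_ i).
Qed.
End Jets.
End Charts.

(** * Coordinates of jets in a chart *)

Section Coordinates.
Context {R : realType} (X : diffspace R) (k : nat) (J : jets (R := R) k).
Local Notation edom := (edom R).
Local Notation T := (LD J X).
Implicit Types U V W : edom.

Definition lbase (z : T) : X := pmap (repr z) (jpt (pval (repr z))).

Lemma jpt_emap U V (f : U -> V) (xi : J U) : jpt (emap f xi : J V) = f (jpt xi).
Proof. by rewrite -{1}(jptK xi) jmap jpt_mk. Qed.

Lemma jvec_emap U V (f : U -> V) (xi : J U) :
  jvec (emap f xi : J V) = fun i => ediff f (jpt xi) (jvec xi i).
Proof. by rewrite -{1}(jptK xi) jmap jvec_mk. Qed.

Lemma lbase_star U (p : U -> X) (pp : plot p) (xi : J U) : lbase (star pp xi) = p (jpt xi).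
Proof.
apply: (@quot_lift _ _ _ (fun s : pelt J X => pmap s (jpt (pval s)))).
move=> [V q pq x] [W q' pq' x'] [g /= [sg -> ->]].
by rewrite jpt_emap.
Qed.

Section InChart.
Context (c : chart X).
Local Notation E := (cE c).
Local Notation O := (cphi c @` cD c).
Local Notation phi := (cphi c).

Lemma jlin_eq x x' (y y' : 'I_k -> E) (hx : O (lin x y (rpt 0))) (hx' : O (lin x' y' (rpt 0))) :
  x = x' -> y = y' -> jlin J hx = jlin J hx'.
Proof. by move=> xx yy; subst x' y'; congr jlin; exact: Prop_irrelevance. Qed.

Lemma lin_in x (y : 'I_k -> E) : O x -> O (lin x y (rpt 0)).
Proof. by rewrite lin0. Qed.

(** Where [p] stays in the chart domain it is the inverse chart after its own coordinate expression,
    to which [jet_lin] applies. *)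
Lemma star_jlin U (p : U -> X) (pp : plot p) (u : U) v (Du : cD c (p u)) :
  star pp (jmk J u v) =
  jlin J (lin_in (fun i => dvec (fun u => phi (p u)) u (v i)) (imageP phi Du)).
Proof.
pose oB := cD_open (c:=c) pp; pose w := dsub_in oB Du.
have wE : rincl w = u by exact: dsub_inK.
pose p' (w : dsub oB) := p (rincl w).
have pp' : plot p' by exact: (plot_comp (@esmooth_rincl R U _ oB) pp).
have D' w' : cD c (p' w') by exact: (dsubP w').
have sP : sm (fun w' => phi (p' w')) by apply/(cphi_plot D').
have hw : O (phi (p' w)) by exact: imageP.
transitivity (star pp' (jmk J w v)).
  rewrite (star_comp pp pp' _ (@esmooth_rincl R U _ oB)) (jmap J) wE.
  by congr star; congr jmk; apply/funext => i; rewrite ediff_rincl.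
transitivity (jet J sP hw v).
  rewrite /jet; set w2 := dsub_in _ hw.
  have w2E : rincl w2 = w by exact: dsub_inK.
  have pp2 := plot_comp (@esmooth_rincl R _ _ (cimg_open sP)) pp'.
  have -> : star (lplot_plot sP) (jmk J w2 v) = star pp2 (jmk J w2 v).
    apply: star_eq; apply/funext => x; apply: (@cphi_inj _ _ c).
    - exact: cinv_D.
    - exact: D'.
    - by rewrite /lplot cinvK.
  rewrite (star_comp pp' pp2 _ (@esmooth_rincl R _ _ (cimg_open sP))) (jmap J) w2E.
  by congr star; congr jmk; apply/funext => i; rewrite ediff_rincl.
rewrite (@jet_lin _ _ _ _ _ _ _ sP w hw v (lin_in _ hw)).
apply: jlin_eq; first by rewrite /p' wE.
by apply/funext => i; rewrite (@dvec_restr _ _ U _ oB (fun u => phi (p u))) wE.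
Qed.

(** Computed on a chosen representative; by [cvec_star] the choice is irrelevant when the base point
    lies in [cD c]. *)
Definition cvec (z : T) (i : 'I_k) : E :=
  dvec (fun u => phi (pmap (repr z) u)) (jpt (pval (repr z))) (jvec (pval (repr z)) i).

Lemma cvec_star U (p : U -> X) (pp : plot p) (xi : J U) i : cD c (p (jpt xi)) ->
  cvec (star pp xi) i = dvec (fun u => phi (p u)) (jpt xi) (jvec xi i).
Proof.
(* The value 0 off the chart domain makes [F] respect [prel] on all representatives, as [quot_lift]
   demands. *)
move=> Du; pose F (s : pelt J X) : E := if pselect (cD c (pmap s (jpt (pval s)))) then
  dvec (fun u => phi (pmap s u)) (jpt (pval s)) (jvec (pval s) i) else 0.
have := @quot_lift _ (@prel R J X) _ F (Pelt pp xi).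
rewrite -/(star pp xi) /F; case: pselect => [Dr|nDr].
  case: pselect => //= _ h; apply: h.
  move=> [V q pq x] [W q' pq' x'] [g /= [sg -> ->]]; rewrite jpt_emap jvec_emap /=.
  case: pselect => // Dq.
  by rewrite -(dvec_compl _ sg)//; exact: chart_lsm.
by have := lbase_star pp xi; rewrite /lbase => e; case: nDr; rewrite e.
Qed.

Lemma coord_inj (z z' : T) : cD c (lbase z) -> cD c (lbase z') ->
  phi (lbase z) = phi (lbase z') -> (forall i, cvec z i = cvec z' i) -> z = z'.
Proof.
have [U [p [pp [xi ->]]]] := starP z; have [U' [p' [pp' [xi' ->]]]] := starP z'.
rewrite !lbase_star => Dz Dz' zz' vv'.
rewrite -(jptK xi) -(jptK xi') (star_jlin _ _ Dz) (star_jlin _ _ Dz').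
apply: jlin_eq => //; apply/funext => i.
by have := vv' i; rewrite !cvec_star.
Qed.

(** A single plot carries the whole family: the inverse chart of [a w + sum_i s_i b_i w] on an open
    part of [W x R^k]. At [(w, 0)] the [i]-th fibre direction has derivative [b i w]. *)
Lemma jet_family W (a : W -> E) (b : 'I_k -> W -> E) : sm a -> (forall i, sm (b i)) ->
  (forall w, O (a w)) ->
  exists q : W -> T, [/\ plot q, forall w, cD c (lbase (q w)),
    forall w, phi (lbase (q w)) = a w & forall w i, cvec (q w) i = b i w].
Proof.
move=> sa sb aO.
pose Q (x : xdom W k) : E := a (pfst x) + \sum_i psnd x ord0 i *: b i (pfst x).
have spsnd i : vsmooth (fun x : xdom W k => psnd x ord0 i).
  exact: (proj1 (vsmooth_coord (@psnd R W k)) (@vsmooth_psnd R W k) i).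
have sQ : sm Q.
  apply: smD; first by apply: sm_comp sa; exact: esmooth_pfst.
  by apply: sm_sum => i; apply: smZ => //; apply: sm_comp (sb i); exact: esmooth_pfst.
have Q0 w : Q (pmk w 0) = a w.
  rewrite /Q pfst_mk psnd_mk big1 ?addr0// => i _; by rewrite mxE scale0r.
have hQ w : O (Q (pmk w 0)) by rewrite Q0.
pose v (i : 'I_k) : 'rV[R]_(edim W + k) := row_mx 0 (delta_mx ord0 i).
pose g w := dsub_in (cimg_open sQ) (hQ w).
have gE w : rincl (g w) = pmk w 0 by exact: dsub_inK.
pose q w : T := star (lplot_plot sQ) (jmk J (g w) v).
have sid : esmooth (@id W) by exact: vsmooth_epoint.
have s0 : vsmooth (fun _ : W => 0 : 'rV[R]_k) by exact: vsmooth_cst.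
have qbase w : lbase (q w) = lplot (g w) by rewrite lbase_star jpt_mk.
have qphi w : phi (lplot (g w)) = a w by rewrite /lplot cinvK gE Q0.
have Dq w : cD c (lplot (g w)) by exact: cinv_D.
have sg : esmooth g by exact: (esmooth_pmk sid s0).
exists q; split.
- apply: gen_plotW; first exact: star_plot_comp.
  exists (dsub (cimg_open sQ)), (lplot (sP := sQ)), (lplot_plot sQ), (fun w => jmk J (g w) v).
  split=> //; apply/jplot; split.
    under eq_fun do rewrite jpt_mk.
    exact: sg.
  by move=> i; under eq_fun do rewrite jvec_mk; exact: vsmooth_cst.
- by move=> w; rewrite qbase.
- by move=> w; rewrite qbase.
move=> w i; rewrite cvec_star ?jpt_mk ?jvec_mk//.
rewrite (_ : (fun u => _) = fun x : dsub (cimg_open sQ) => Q (rincl x)); last first.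
  by apply/funext => x; rewrite /lplot cinvK.
rewrite (@dvec_restr _ _ _ _ (cimg_open sQ)) gE /Q.
have sZ j : sm (fun x : xdom W k => psnd x ord0 j *: b j (pfst x)).
  by apply: smZ => //; apply: sm_comp (sb j); exact: esmooth_pfst.
rewrite dvecD; [|by apply: sm_comp sa; exact: esmooth_pfst|exact: sm_sum].
have spf : esmooth (@pfst R W k) by exact: esmooth_pfst.
rewrite (dvec_comp (P := a) _ _ spf sa) ediff_pfst /v row_mxKl.
have dv0 U (P : U -> E) u : sm P -> dvec P u 0 = 0.
  by move=> sP; have := dvec_lin u (-1) 0 0 sP; rewrite scaler0 addr0 scaleN1r addNr.
rewrite dv0// add0r dvec_sum//.
have dpsnd j : 'D_(row_mx 0 (delta_mx ord0 i)) (ext (fun x : xdom W k => psnd x ord0 j))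
    (epoint (pmk w (0 : 'rV[R]_k))) = (j == i)%:R.
  rewrite (@derive_ext _ (xdom W k) _ (fun x : 'rV[R]_(edim W + k) => rsubmx x ord0 j))//.
  have dr (x : 'rV[R]_(edim W + k)) : differentiable (rsubmx : 'rV[R]_(edim W + k) -> 'rV[R]_k) x.
    exact: differentiable_rsubmx.
  rewrite derive_coord// deriveE// diff_lin//; last exact: continuous_rsubmx.
  by rewrite [LHS](congr1 (fun M : 'rV[R]_k => M ord0 j) (row_mxKr _ _)) mxE.
rewrite (bigD1 i)//= dvecZ// ?dpsnd; last by apply: sm_comp (sb i); exact: esmooth_pfst.
rewrite psnd_mk mxE scale0r add0r eqxx scale1r pfst_mk big1 ?addr0// => j ji.
rewrite dvecZ// ?dpsnd; last by apply: sm_comp (sb j); exact: esmooth_pfst.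
by rewrite psnd_mk mxE (negbTE ji) !scale0r addr0.
Qed.

Lemma coords_smooth W (q : W -> T) : plot q -> (forall w, cD c (lbase (q w))) ->
  sm (fun w => phi (lbase (q w))) /\ forall i, sm (fun w => cvec (q w) i).
Proof.
move=> pq Dq.
have H (w : W) : exists (A : set 'rV[R]_(edim W)) (oA : open A), A (epoint w) /\
    (sm (fun w : restr oA => phi (lbase (q (rincl w)))) /\
     forall i, sm (fun w : restr oA => cvec (q (rincl w)) i)).
  have [A [oA [Aw [V [p [pp [g [/jplot[sg1 sg2] qE]]]]]]]] := pq w.
  exists A, oA; split=> //.
  have qE' w' : q (rincl w') = star pp (g w').
    by rewrite -[LHS]/((fun w => q (rincl w)) w') qE.
  have Dg w' : (p @^-1` cD c) (jpt (g w')).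
    by have := Dq (rincl w'); rewrite qE' lbase_star.
  pose oB := cD_open (c:=c) pp.
  have [g' sg' gE] := dsub_lift oB Dg sg1.
  have sP : sm (fun x : dsub oB => phi (p (rincl x))).
    apply/(cphi_plot (c := c) (p := fun x : dsub oB => p (rincl x))); first by move=> x; exact: dsubP x.
    exact: (plot_comp (@esmooth_rincl R _ _ oB) pp).
  split=> [|i].
    rewrite (_ : (fun w => _) = (fun x : dsub oB => phi (p (rincl x))) \o g').
      exact: sm_comp.
    by apply/funext => w' /=; rewrite qE' lbase_star gE.
  rewrite (_ : (fun w => _) = fun w' => dvec (fun x : dsub oB => phi (p (rincl x))) (g' w') (jvec (g w') i)).
    by apply: sm_dvec.
  apply/funext => w'; rewrite qE' cvec_star; last exact: Dg.
  by rewrite (@dvec_restr _ _ V _ oB (fun u => phi (p u))) gE.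
split=> [|i]; apply: sm_local => w; have [A [oA [Aw [h1 h2]]]] := H w; exists A, oA; split=> //.
Qed.

(** [jet_family] builds a plot with the same coordinates, which is [q] by [coord_inj]. *)
Lemma coords_plot W (q : W -> T) : (forall w, cD c (lbase (q w))) ->
  sm (fun w => phi (lbase (q w))) -> (forall i, sm (fun w => cvec (q w) i)) -> plot q.
Proof.
move=> Dq s1 s2.
have [|q' [pq' D' E1 E2]] := @jet_family W (fun w => phi (lbase (q w))) (fun i w => cvec (q w) i) s1 s2.
  by move=> w; exact: imageP.
rewrite (_ : q = q')//; apply/funext => w; by apply: coord_inj => // i; rewrite ?E1 ?E2.
Qed.

Lemma coord_ex (x : E) (y : 'I_k -> E) : O x ->
  exists z : T, [/\ cD c (lbase z), phi (lbase z) = x & forall i, cvec z i = y i].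
Proof.
move=> Ox; have [||w|q [_ h1 h2 h3]] := @jet_family (rdom 0) (fun=> x) (fun i _ => y i).
- exact: sm_cst.
- by move=> i; exact: sm_cst.
- by [].
by exists (q (rpt 0)).
Qed.

End InChart.
End Coordinates.

(** * Charts of tangent spaces *)

Section Products.
Context {R : realType}.
Local Notation edom := (edom R).
Local Notation cvs := (cvs (R := R)).
Implicit Types U V W : edom.

(** Functionals of one factor separate points, and testing smoothness with them amounts to testing
    both components. *)
Definition prod_cfun (E F : cvs) : set (E * F -> R) :=
  [set l | (exists2 l1, @cfun R E l1 & l = l1 \o fst) \/ (exists2 l2, @cfun R F l2 & l = l2 \o snd)].

Program Definition prodm (E F : cvs) : cvs :=
  @Cvs R (E * F)%type (@prod_cfun E F) _ _ _.
Next Obligation. by move=> E F l [[l1 hl1 ->]|[l2 hl2 ->]] a x y /=; exact: cfun_lin. Qed.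
Next Obligation.
move=> E F [x y] H; congr pair; apply: cfun_sep => l hl.
  by apply: (H (l \o fst)); left; exists l.
by apply: (H (l \o snd)); right; exists l.
Qed.
Next Obligation.
move=> E F U P u v H.
have s1 : sm (fun u => (P u).1) by move=> l hl; apply: (H (l \o fst)); left; exists l.
have s2 : sm (fun u => (P u).2) by move=> l hl; apply: (H (l \o snd)); right; exists l.
exists (dvec (fun u => (P u).1) u v, dvec (fun u => (P u).2) u v).
by move=> l [[l1 hl1 ->]|[l2 hl2 ->]] /=; rewrite cfun_dvec.
Qed.

Lemma sm_prod (E F : cvs) U (P : U -> prodm E F) :
  sm P <-> sm (fun u => (P u).1) /\ sm (fun u => (P u).2).
Proof.
split=> [sP|[s1 s2] l [[l1 hl1 ->]|[l2 hl2 ->]]]; last 2 first.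
- exact: s1.
- exact: s2.
by split=> l hl; [apply: (sP (l \o fst)); left|apply: (sP (l \o snd)); right]; exists l.
Qed.

Definition pow_cfun k (E : cvs) : set ({ffun 'I_k -> E} -> R) :=
  [set l : {ffun 'I_k -> E} -> R |
    exists l1 (i : 'I_k), @cfun R E l1 /\ l = fun f : {ffun 'I_k -> E} => l1 (f i)].

Program Definition powm k (E : cvs) : cvs :=
  @Cvs R {ffun 'I_k -> E} (@pow_cfun k E) _ _ _.
Next Obligation. by move=> k E l [l1 [i [hl1 ->]]] a x y /=; rewrite !ffunE cfun_lin. Qed.
Next Obligation.
move=> k E x H; apply/ffunP => i; rewrite ffunE; apply: cfun_sep => l hl.
by apply: (H (fun f : {ffun 'I_k -> E} => l (f i))); exists l, i.
Qed.
Next Obligation.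
move=> k E U P u v H.
have s i : sm (fun u => P u i) by move=> l hl; apply: (H (fun f : {ffun 'I_k -> E} => l (f i))); exists l, i.
exists [ffun i => dvec (fun u => P u i) u v] => l [l1 [i [hl1 ->]]].
by rewrite ffunE cfun_dvec.
Qed.

Lemma sm_pow k (E : cvs) U (P : U -> powm k E) : sm P <-> forall i, sm (fun u => P u i).
Proof.
split=> [sP i l hl|s l [l1 [i [hl1 ->]]]]; last exact: s.
by apply: (sP (fun f : {ffun 'I_k -> E} => l (f i))); exists l, i.
Qed.

Lemma cfun_dvecl (E : cvs) U (P : U -> E) u v l : lsm P u -> cfun l ->
  l (dvec P u v) = 'D_v (ext (fun u => l (P u))) (epoint u).
Proof.
move=> [B [oB [Bu sP]]] hl; pose w := dsub_in oB Bu.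
have wE : rincl w = u by exact: dsub_inK.
by rewrite -wE -(@dvec_restr _ _ U _ oB) cfun_dvec// -(@derive_restr _ U _ _ oB (fun u => l (P u))).
Qed.

(** A map that pulls functionals back to functionals takes the place of a continuous linear map. *)
Lemma dvec_map (E F : cvs) (L : E -> F) U (P : U -> E) u v :
  (forall l, cfun l -> cfun (l \o L)) -> lsm P u ->
  dvec (fun u => L (P u)) u v = L (dvec P u v).
Proof.
move=> hL sP; apply: dvecE => l hl.
by rewrite -[LHS]/((l \o L) (dvec P u v)) cfun_dvecl//; exact: hL.
Qed.

Lemma cfun_fst (E F : cvs) l : @cfun R E l -> @cfun R (prodm E F) (l \o fst).
Proof. by move=> hl; left; exists l. Qed.

Lemma cfun_snd (E F : cvs) l : @cfun R F l -> @cfun R (prodm E F) (l \o snd).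
Proof. by move=> hl; right; exists l. Qed.

Lemma dopen_eq U (A B : set U) : A = B -> dopen A -> dopen B.
Proof. by move=> ->. Qed.
End Products.

Section TangentCharts.
Context {R : realType}.
Local Notation edom := (edom R).
Implicit Types (U V W : edom) (X : diffspace R).

Program Definition Tj : jets (R := R) 1 := @Jets R 1 (@T_hat R) (fun U xi => xi.1)
  (fun U xi _ => xi.2) (fun U u v => (u, v ord0)) _ _ _ _ _.
Next Obligation. by move=> U [u v]. Qed.
Next Obligation. by []. Qed.
Next Obligation. by move=> U u v; apply/funext => i; rewrite (ord1 i). Qed.
Next Obligation. by []. Qed.
Next Obligation. by move=> W U g; split=> [[h1 h2]|[h1 /(_ ord0) h2]]; split. Qed.

Program Definition Tkj k : jets (R := R) k := @Jets R k (@Tk_hat R k) (fun U xi => xi.1)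
  (fun U xi => xi.2) (fun U u v => (u, v)) _ _ _ _ _.
Next Obligation. by move=> k U [u v]. Qed.
Next Obligation. by []. Qed.
Next Obligation. by []. Qed.
Next Obligation. by []. Qed.
Next Obligation. by []. Qed.

Lemma tproj_lbase X (z : tangent X) : tproj z = lbase (J := Tj) z.
Proof. by []. Qed.

Lemma plot_dlocal U X (p : U -> X) :
  (forall u, exists (B : set U) (oB : dopen B), B u /\ plot (fun w : dsub oB => p (rincl w))) ->
  plot p.
Proof.
move=> H; apply: plot_local => u; have [B [oB [Bu pB]]] := H u.
by exists (@epoint R U @` B), oB; split=> //; exists u.
Qed.

Section OneChart.
Context X (c : chart X).
Local Notation E := (cE c).
Local Notation O := (cphi c @` cD c).

Definition tvec (z : tangent X) : E := cvec (J := Tj) c z ord0.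

Lemma tcoord_inj (z z' : tangent X) : cD c (tproj z) -> cD c (tproj z') ->
  cphi c (tproj z) = cphi c (tproj z') -> tvec z = tvec z' -> z = z'.
Proof. by move=> Dz Dz' h1 h2; apply: (@coord_inj R X 1 Tj c z z') => // i; rewrite (ord1 i). Qed.

Lemma tcoord_ex (x y : E) : O x ->
  exists z : tangent X, [/\ cD c (tproj z), cphi c (tproj z) = x & tvec z = y].
Proof. by move=> /(coord_ex Tj (fun=> y)) [z [h1 h2 h3]]; exists z; split=> //; exact: h3. Qed.

Program Definition tchart : chart (tangent X) :=
  @Chart R (tangent X) (prodm E E) [set z | cD c (tproj z)]
    (fun z => (cphi c (tproj z), tvec z)) _ _ _ _.
Next Obligation.
by move=> U p pp; exact: (cD_open (c := c) (tproj_smooth pp)).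
Qed.
Next Obligation. by move=> z z' Dz Dz' [h1 h2]; exact: tcoord_inj. Qed.
Next Obligation.
move=> U P /sm_prod[s1 s2]; apply: dopen_eq (cimg_open s1).
apply/seteqP; split=> u /=.
  move=> Ou; have [z [h1 h2 h3]] := tcoord_ex (P u).2 Ou.
  by exists z => //; rewrite h2 h3; case: (P u).
by move=> [z Dz <-]; exists (tproj z).
Qed.
Next Obligation.
move=> U p Dp; split=> [pp|/sm_prod[s1 s2]].
  have [s1 s2] := coords_smooth (J := Tj) (c := c) pp Dp.
  by apply/sm_prod; split=> //; exact: s2.
by apply: (coords_plot (J := Tj) (c := c)) => // i; rewrite (ord1 i).
Qed.

Section Power.
Variable k : nat.
Local Notation Tk := (tangentk k.+1 X).

Definition tkbase (w : Tk) : X := tproj (fproj ord0 w).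

Lemma tkbaseE (w : Tk) i : tproj (fproj i w) = tkbase w.
Proof. exact: (set_valP w). Qed.

Lemma tkbase_smooth : dsmooth tkbase.
Proof. by move=> U q pq; apply: (@tproj_smooth _ X U (fun u => fproj ord0 (q u))); exact: (pq ord0). Qed.

Lemma tk_ext (w w' : Tk) : (forall i, fproj i w = fproj i w') -> w = w'.
Proof. by move=> H; apply: val_inj; apply/funext. Qed.

Program Definition tkchart : chart Tk :=
  @Chart R Tk (prodm E (powm k.+1 E)) [set w | cD c (tkbase w)]
    (fun w => (cphi c (tkbase w), [ffun i => tvec (fproj i w)])) _ _ _ _.
Next Obligation.
by move=> U p pp; exact: (cD_open (c := c) (tkbase_smooth pp)).
Qed.
Next Obligation.
move=> w w' Dw Dw' [h1 /ffunP h2]; apply: tk_ext => i; apply: tcoord_inj; rewrite ?tkbaseE//.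
by have := h2 i; rewrite !ffunE.
Qed.
Next Obligation.
move=> U P /sm_prod[s1 s2]; apply: dopen_eq (cimg_open s1).
apply/seteqP; split=> u /=; last by move=> [w Dw <-]; exists (tkbase w).
move=> Ou; have ex i := tcoord_ex ((P u).2 i) Ou.
have [z zP] := choice ex.
have zb i j : tproj (z i) = tproj (z j).
  by have [h1 h2 _] := zP i; have [h1' h2' _] := zP j; apply: (cphi_inj h1 h1'); rewrite h2.
pose w : Tk := @mkset _ [set w : powD k.+1 (tangent X) | forall i j, tproj (w i) = tproj (w j)] z zb.
exists w; first by have [] := zP ord0.
rewrite [RHS]surjective_pairing; congr pair; first by have [] := zP ord0.
by apply/ffunP => i; rewrite ffunE; have [] := zP i.
Qed.
Next Obligation.
move=> U p Dp; split=> [pp|/sm_prod[s1 /sm_pow s2]].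
  apply/sm_prod; split; first by apply/(cphi_plot Dp); exact: (tkbase_smooth pp).
  apply/sm_pow => i /=; under eq_fun do rewrite ffunE.
  apply: (coords_smooth (J := Tj) (c := c) (pp i) _).2 => u.
  by rewrite -tproj_lbase -[val (p u) i]/(fproj i (p u)) tkbaseE; exact: Dp.
move=> i; apply: (coords_plot (J := Tj) (c := c)) => [u||j].
- by rewrite -tproj_lbase -[val (p u) i]/(fproj i (p u)) tkbaseE; exact: Dp.
- rewrite (_ : (fun w => _) = fun u => cphi c (tkbase (p u)))//.
  by apply/funext => u; rewrite -tproj_lbase -[val (p u) i]/(fproj i (p u)) tkbaseE.
- rewrite (ord1 j); have := s2 i; rewrite /=; under eq_fun do rewrite ffunE; exact.
Qed.
End Power.
End OneChart.

(** The class in which elasticity is proved: it contains the convenient manifolds and is closed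
    under [tangentk], which reduces (E5) to the other axioms. *)
Definition lconv X := forall x : X, exists c : chart X, cD c x.

Lemma lconv_tangentk X k : lconv X -> (0 < k)%N -> lconv (tangentk k X).
Proof. by case: k => // k H _ w; have [c Dc] := H (tkbase w); exists (tkchart c k). Qed.
End TangentCharts.

(** * Elasticity *)

Section Theta.
Context {R : realType}.
Local Notation edom := (edom R).
Implicit Types (U V W : edom) (X Y : diffspace R).

Lemma theta_star k X U (p : U -> X) (pp : plot p) (xi : Tk_hat k U) i :
  fproj i (theta (star pp xi)) = star (F := T_hat) pp (xi.1, xi.2 i).
Proof.
apply: (@quot_lift _ _ _ (fun s : pelt (Tk_hat k) X =>
  star (F := T_hat) (pplot s) ((pval s).1, (pval s).2 i) : tangent X)).
move=> [V q pq x] [W q' pq' x'] [g /= [sg e ->]].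
rewrite -(star_comp (F := T_hat) pq' (plot_comp sg pq') (x.1, x.2 i) sg).
by apply: star_eq.
Qed.

Lemma theta_smooth k X : dsmooth (@theta R k X).
Proof.
move=> U q pq i; apply: plot_local => u.
have [A [oA [Au [V [p [pp [g [[pg1 pg2] e]]]]]]]] := pq u.
exists A, oA; split=> //; apply: gen_plotW; first exact: star_plot_comp.
exists V, p, pp, (fun w => ((g w).1, (g w).2 i)); split; first by split=> //; exact: pg2.
apply/funext => w.
have qE : q (rincl w) = star pp (g w) by rewrite -[LHS]/((fun w => q (rincl w)) w) e.
by rewrite -(theta_star pp (g w) i) -qE.
Qed.

Lemma theta_base k X (z : LD (Tk_hat k) X) i :
  tproj (fproj i (theta z)) = lbase (J := Tkj k) z.
Proof. by have [U [p [pp [xi ->]]]] := starP z; rewrite theta_star tprojE lbase_star. Qed.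

Lemma theta_vec k X (c : chart X) (z : LD (Tk_hat k) X) i : cD c (lbase (J := Tkj k) z) ->
  tvec c (fproj i (theta z)) = cvec (J := Tkj k) c z i.
Proof.
have [U [p [pp [xi ->]]]] := starP z; rewrite lbase_star => Dz.
by rewrite theta_star /tvec !cvec_star.
Qed.

(** Both sides have coordinates [(x, y_0, ..., y_(k-1))], which [theta] preserves. The inverse is
    obtained by choice, and its smoothness is read off in coordinates. *)
Lemma theta_diffeo k X : lconv X -> (0 < k)%N -> diffeo (@theta R k X).
Proof.
case: k => // k lX _.
have inj : injective (@theta R k.+1 X).
  move=> z z' zz'.
  have bE : lbase (J := Tkj k.+1) z = lbase (J := Tkj k.+1) z'.
    by rewrite -!(theta_base _ ord0) zz'.
  have [c Dz] := lX (lbase (J := Tkj k.+1) z).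
  have Dz' : cD c (lbase (J := Tkj k.+1) z') by rewrite -bE.
  apply: (coord_inj Dz Dz'); first by rewrite bE.
  by move=> i; rewrite -(theta_vec i Dz) -(theta_vec i Dz') zz'.
have surj (w : tangentk k.+1 X) : exists z, theta z = w.
  have [c Dw] := lX (tkbase w).
  have [z [h1 h2 h3]] := coord_ex (Tkj k.+1) (fun i => tvec c (fproj i w)) (imageP (cphi c) Dw).
  exists z; apply: tk_ext => i.
  have b1 : tproj (fproj i (theta z)) = lbase (J := Tkj k.+1) z := theta_base z i.
  have b2 : tproj (fproj i w) = tkbase w := tkbaseE w i.
  apply: (@tcoord_inj _ X c); [rewrite b1; exact: h1|rewrite b2; exact: Dw| |].
    by rewrite b1 b2; exact: h2.
  by rewrite (theta_vec i h1); exact: h3.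
have [g gK] := choice surj.
exists g; split=> //; [by move=> z; apply: inj|exact: theta_smooth|].
move=> U q pq; apply: plot_dlocal => u.
have [c Du] := lX (tkbase (q u)).
have oB := cD_open (c := c) (tkbase_smooth pq).
exists _, oB; split=> //.
have D (w : dsub oB) : cD c (tkbase (q (rincl w))) by exact: (dsubP w).
have gb w : lbase (J := Tkj k.+1) (g w) = tkbase w by rewrite -(theta_base _ ord0) gK.
have pr : plot (fun w : dsub oB => q (rincl w)) by exact: (plot_comp (@esmooth_rincl R _ _ oB) pq).
have Dg (w : dsub oB) : cD c (lbase (J := Tkj k.+1) (g (q (rincl w)))) by rewrite gb; exact: D.
apply: (coords_plot Dg) => [|i].
  rewrite (_ : (fun w => _) = fun w : dsub oB => cphi c (tkbase (q (rincl w)))).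
    apply/(cphi_plot (c := c) (p := fun w : dsub oB => tkbase (q (rincl w))) D).
    exact: (tkbase_smooth pr).
  by apply/funext => w; rewrite gb.
rewrite (_ : (fun w => _) = fun w : dsub oB => tvec c (fproj i (q (rincl w)))); last first.
  by apply/funext => w; rewrite -(theta_vec i (Dg w)) gK.
apply: (coords_smooth (J := Tj) (c := c) (pr i) _).2 => w.
have -> : lbase (J := Tj) (val (q (rincl w)) i) = tkbase (q (rincl w)) := tkbaseE _ i.
exact: D.
Qed.

Lemma esmooth_tfst U : esmooth (fun w : Tdom U => (Tdom_split w).1).
Proof. exact: (Tdom_split_plot U).1. Qed.

Lemma vsmooth_tsnd U : vsmooth (fun w : Tdom U => (Tdom_split w).2).
Proof. exact: (Tdom_split_plot U).2. Qed.

Lemma ediff_sum U V (f : U -> V) u v i : esmooth f ->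
  ediff f u v ord0 i = \sum_j v ord0 j *
    'D_(delta_mx ord0 j) (ext (fun u => epoint (f u) ord0 i)) (epoint u).
Proof.
move=> sf; rewrite ediff_coord//.
have dP : differentiable (ext (fun u => epoint (f u) ord0 i)) (epoint u).
  apply: vsmooth_differentiable.
  exact: (proj1 (vsmooth_coord (fun u => epoint (f u))) sf i).
rewrite [in LHS](row_coord v) deriveE// linear_sum; apply: eq_bigr => j _.
by rewrite linearZ /= deriveE.
Qed.

(** [T_hat f] between Euclidean domains, so that it can witness [prel] for plots of the tangent
    space. *)
Definition tmap U V (f : U -> V) (w : Tdom U) : Tdom V :=
  Tdom_join (emap (e := @T_hat R) f (Tdom_split w)).

Lemma vsmooth_ediff U V (f : U -> V) : esmooth f ->
  vsmooth (fun w : Tdom U => ediff f (Tdom_split w).1 (Tdom_split w).2).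
Proof.
move=> sf; apply/vsmooth_coord => i; under eq_fun do rewrite ediff_sum//.
apply: vsmooth_sum => j; apply: vsmoothM.
  exact: (proj1 (vsmooth_coord (fun w : Tdom U => (Tdom_split w).2)) (vsmooth_tsnd U) j).
apply: (vsmooth_compR (g := fun u : U => 'D_(delta_mx ord0 j)
  (ext (fun u => epoint (f u) ord0 i)) (epoint u)) (@esmooth_tfst U)).
apply: (@vsmooth_of _ U _ ('D_(delta_mx ord0 j) (ext (fun u => epoint (f u) ord0 i)))) => //.
apply: vsmooth_ext_derive.
exact: (proj1 (vsmooth_coord (fun u => epoint (f u))) sf i).
Qed.

Lemma esmooth_tmap U V (f : U -> V) : esmooth f -> esmooth (tmap f).
Proof.
move=> sf; apply: (@vsmooth_row_mx R (Tdom U)); last exact: vsmooth_ediff.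
exact: (esmooth_comp (@esmooth_tfst U) sf).
Qed.

Lemma derive_line0 (A B : normedModType R) (F : A -> B) x w :
  'D_1 (fun t : R => F (x + t *: w)) 0 = 'D_w F x.
Proof.
have E : (fun h : R => h^-1 *: (((fun t : R => F (x + t *: w)) \o shift 0) (h *: 1) - F (x + (0 : R) *: w)))
  = (fun h : R => h^-1 *: ((F \o shift x) (h *: w) - F x)).
  apply/funext => h /=.
  by rewrite addr0 scale0r addr0 -[h *: 1]/(h * 1) mulr1 [x + _]addrC.
by rewrite /derive E.
Qed.

(** Along the line in direction [(v1, v01)] the function is ['D_v0 G + t 'D_v01 G] at [u + t v1], to
    be differentiated at [t = 0]. *)
Lemma derive_tangent n (A : set 'rV[R]_n) (G : 'rV[R]_n -> R) (u v0 v1 v01 : 'rV[R]_n) :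
  open A -> A u -> kdiff 2 A G ->
  'D_(row_mx v1 v01) (fun w : 'rV[R]_(n + n) => 'D_(rsubmx w) G (lsubmx w)) (row_mx u v0) =
  'D_v1 ('D_v0 G) u + 'D_v01 G u.
Proof.
move=> oA Au [dG ddG]; rewrite -derive_line0.
have cl : {for 0, continuous (fun t : R => u + t *: v1)}.
  apply: differentiable_continuous; apply: (@differentiableD _ _ _ (cst u)) => //.
have nA : \forall t \near (0 : R), A (u + t *: v1).
  by apply: cl; rewrite scale0r addr0; apply: open_nbhs_nbhs.
rewrite (@near_derive _ _ _ _ (fun t : R => t * 'D_v01 G (u + t *: v1) + 'D_v0 G (u + t *: v1))); last first.
  apply: filterS nA => t At.
  rewrite scale_row_mx add_row_mx row_mxKl row_mxKr [RHS]addrC.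
  by rewrite (deriveDv (dG _ At)) (deriveZv (dG _ At)).
have u0 : u + (0 : R) *: v1 = u by rewrite scale0r addr0.
have dl v : is_derive (0 : R) 1 (fun t : R => 'D_v G (u + t *: v1)) ('D_v1 ('D_v G) u).
  have := @is_derive_line R _ _ ('D_v G) u v1 0; rewrite u0; apply.
  exact: (ddG v).1.
have [_ ->] := is_deriveD (is_deriveM (is_derive_id (0 : R) 1) (dl v01)) (dl v0).
rewrite u0 scale0r add0r addrC; congr (_ + _).
by rewrite -[_ *: 1]/(_ * 1) mulr1.
Qed.
End Theta.

(** * The double tangent space in coordinates *)

Section Theta2.
Context {R : realType}.
Local Notation edom := (edom R).
Implicit Types (U V W : edom) (X Y : diffspace R).

Lemma Tdom_joinK U (y : T_hat U) : Tdom_split (Tdom_join y) = y.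
Proof.
rewrite [RHS]surjective_pairing; congr pair; first apply: epoint_inj.
  by rewrite -[LHS]/(lsubmx (row_mx (epoint y.1) y.2)) row_mxKl.
by rewrite -[LHS]/(rsubmx (row_mx (epoint y.1) y.2)) row_mxKr.
Qed.

Lemma Tdom_splitK U (w : Tdom U) : Tdom_join (Tdom_split w) = w.
Proof. by apply: epoint_inj; exact: hsubmxK. Qed.

Lemma ediff_comp U V W (f : U -> V) (g : V -> W) u v : esmooth f -> esmooth g ->
  ediff (g \o f) u v = ediff g (f u) (ediff f u v).
Proof.
move=> sf sg; apply/rowP => i; rewrite !ediff_coord//; last exact: esmooth_comp sf sg.
rewrite -(derive_ext_comp (g := fun v => epoint (g v) ord0 i))//.
  exact: vsmooth_differentiable.
apply: vsmooth_differentiable.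
exact: (proj1 (vsmooth_coord (fun u => epoint (g u))) sg i).
Qed.

Lemma ediff_tfst U (w : Tdom U) v : ediff (fun w : Tdom U => (Tdom_split w).1) w v = lsubmx v.
Proof.
rewrite /ediff (@derive_ext _ (Tdom U) _ lsubmx) //.
have dl : differentiable (lsubmx : 'rV[R]_(edim U + edim U) -> _) (epoint w).
  exact: differentiable_lsubmx.
by rewrite deriveE// diff_lin//; exact: continuous_lsubmx.
Qed.

Lemma ediff_tmap U V (f : U -> V) (y : T_hat U) (v1 v01 : 'rV[R]_(edim U)) : esmooth f ->
  let z := emap (e := @T2_hat R) f (y, (v1, v01)) in
  ediff (tmap f) (Tdom_join y) (row_mx v1 v01) = row_mx z.2.1 z.2.2.
Proof.
move=> sf z; rewrite /ediff.
have s1 : esmooth (fun w : Tdom U => f (Tdom_split w).1).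
  exact: (esmooth_comp (@esmooth_tfst R U) sf).
rewrite (@derive_row_mx _ (Tdom U) _ _ _ _ _ _ s1 (vsmooth_ediff sf)).
apply: (f_equal2 (@row_mx _ _ _ _)).
  rewrite -[LHS]/(ediff (f \o (fun w : Tdom U => (Tdom_split w).1)) _ _).
  rewrite (ediff_comp _ _ (@esmooth_tfst R U) sf).
  by rewrite ediff_tfst row_mxKl Tdom_joinK.
pose F (w : 'rV[R]_(edim U + edim U)) :=
  'D_(rsubmx w) (ext (fun u => epoint (f u))) (lsubmx w).
have FE (w : Tdom U) : ediff f (Tdom_split w).1 (Tdom_split w).2 = F (epoint w) by [].
transitivity ('D_(row_mx v1 v01) F (epoint (Tdom_join y))); first exact: derive_ext FE.
rewrite -derive_line0 -[RHS]derive_line0.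
apply: near_derive; near=> t => /=.
rewrite -[epoint (Tdom_join y)]/(row_mx (epoint y.1) y.2) scale_row_mx add_row_mx /F.
by rewrite row_mxKl row_mxKr.
Unshelve. all: by end_near.
Qed.

(** Independence of the representative: by [ediff_tmap], the derivative of [tmap g] is the second
    half of [T2_hat] on [g]. *)
Lemma theta2_star X U (p : U -> X) (pp : plot p) (xi : T2_hat U) :
  theta2 (star pp xi) = star (F := T_hat) (Tplot_plot pp)
    (Tdom_join xi.1, row_mx xi.2.1 xi.2.2).
Proof.
apply: (@quot_lift _ _ _ (fun s : pelt T2_hat X =>
  star (F := T_hat) (Tplot_plot (pplot s))
    (Tdom_join (pval s).1, row_mx (pval s).2.1 (pval s).2.2) : tangent (tangent X))).
move=> [V q pq x] [W q' pq' x'] [g /= [sg e x'E]].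
have sT := esmooth_tmap sg.
have TE : Tplot pq = Tplot pq' \o tmap g.
  apply/funext => w; rewrite /Tplot /= /tmap Tdom_joinK.
  rewrite -(star_comp (F := T_hat) pq' (plot_comp sg pq') (Tdom_split w) sg).
  exact: star_eq.
rewrite (star_eq _ (plot_comp sT (Tplot_plot pq')) _ TE).
rewrite (star_comp (F := T_hat) (Tplot_plot pq') _ _ sT) x'E.
apply: (f_equal (star _)); apply: (f_equal2 pair); first by rewrite /= /tmap Tdom_joinK.
have := ediff_tmap x.1 x.2.1 x.2.2 sg; rewrite /= -surjective_pairing; exact.
Qed.

(** A plot of [tangent X] is locally [Tplot pp] after a smooth map [h]. The vector pushed forward
    along [h] splits into the components [v1] and [v01]. *)
Lemma theta2_surj X (z : tangent (tangent X)) : exists y, theta2 y = z.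
Proof.
have [U [q [pq [[u v] ->]]]] := starP z.
have [A [oA [Au [V [p [pp [g [[sg1 sg2] qE]]]]]]]] := pq u.
pose w : restr oA := @mkset _ (eset (restr oA)) _ (conj (epointP u) Au).
have wE : rincl w = u by exact: epoint_inj.
pose h (w : restr oA) := Tdom_join (g w).
have sh : esmooth h by apply: vsmooth_row_mx.
have pr : plot (fun w : restr oA => q (rincl w)) by exact: (plot_comp (@esmooth_rincl R _ _ oA) pq).
have TE : (fun w : restr oA => q (rincl w)) = Tplot pp \o h.
  by rewrite qE; apply/funext => x; rewrite /Tplot /h /= Tdom_joinK.
have -> : star pq ((u, v) : T_hat U) = star pr ((w, v) : T_hat (restr oA)).
  rewrite (star_comp (F := T_hat) pq pr _ (@esmooth_rincl R _ _ oA)) /= wE.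
  by congr star; congr pair; rewrite ediff_rincl.
rewrite (star_eq _ (plot_comp sh (Tplot_plot pp)) _ TE).
rewrite (star_comp (F := T_hat) (Tplot_plot pp) _ _ sh).
pose d : 'rV[R]_(edim V + edim V) := ediff h w v.
exists (star pp ((Tdom_split (h w), (lsubmx d, rsubmx d)) : T2_hat V)).
by rewrite theta2_star /= Tdom_splitK hsubmxK.
Qed.

Section InChart.
Context X (c : chart X).
Local Notation phi := (cphi c).
Local Notation G l p := (ext (fun u => l (phi (p u)))).

Lemma chart_smooth_on U (p : U -> X) (pp : plot p) l : cfun l ->
  smooth_on (@epoint R U @` (p @^-1` cD c)) (G l p).
Proof.
move=> hl; pose oB := cD_open (c := c) pp.
have sP : sm (fun x : dsub oB => phi (p (rincl x))).
  apply/(cphi_plot (c := c) (p := fun x : dsub oB => p (rincl x))); first by move=> x; exact: dsubP x.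
  exact: (plot_comp (@esmooth_rincl R _ _ oB) pp).
apply: (smooth_on_eq oB (f := ext (fun x : dsub oB => l (phi (p (rincl x)))))).
  move=> x [u Du <-]; rewrite extE.
  by rewrite -{1}[epoint u]/(epoint (dsub_in oB Du)) extE dsub_inK.
by move=> k; apply: kdiff_sub (sP l hl k) => x [u Du <-]; split; [exact: epointP|exists u].
Qed.

Variables (U : edom) (p : U -> X) (pp : plot p) (xi : T2_hat U).
Hypothesis Du : cD c (p xi.1.1).
Local Notation u := (epoint xi.1.1).

Lemma tproj_theta2 : tproj (theta2 (star pp xi)) = star (F := T_hat) pp xi.1.
Proof. by rewrite theta2_star tprojE /= /Tplot Tdom_joinK. Qed.

Lemma theta2_vec0 l : cfun l ->
  l (tvec c (tproj (theta2 (star pp xi)))) = 'D_(xi.1.2) (G l p) u.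
Proof.
move=> hl; rewrite tproj_theta2 /tvec (cvec_star (J := Tj) pp)//.
by rewrite cfun_dvecl//; exact: chart_lsm.
Qed.

Let tvecE : tvec (tchart c) (theta2 (star pp xi)) =
  dvec (fun w => cphi (tchart c) (Tplot pp w)) (Tdom_join xi.1) (row_mx xi.2.1 xi.2.2).
Proof.
rewrite theta2_star /tvec (cvec_star (J := Tj) (c := tchart c) (Tplot_plot pp))//.
by rewrite /= /Tplot Tdom_joinK tprojE.
Qed.

Let lsmT : lsm (fun w => cphi (tchart c) (Tplot pp w)) (Tdom_join xi.1).
Proof.
apply: (chart_lsm (c := tchart c) (Tplot_plot pp)).
by rewrite /= /Tplot Tdom_joinK tprojE.
Qed.

Lemma theta2_vec1 l : cfun l ->
  l (tvec (tchart c) (theta2 (star pp xi))).1 = 'D_(xi.2.1) (G l p) u.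
Proof.
move=> hl; rewrite tvecE -[LHS]/((l \o fst) _).
rewrite (cfun_dvecl _ lsmT); last exact: cfun_fst.
rewrite (_ : (fun w => _) = (fun u => l (phi (p u))) \o (fun w : Tdom U => (Tdom_split w).1)); last first.
  by apply/funext => w; rewrite /= /Tplot tprojE.
rewrite derive_ext_comp.
- by rewrite ediff_tfst row_mxKl Tdom_joinK.
- by apply: vsmooth_differentiable; exact: esmooth_tfst.
- rewrite Tdom_joinK; apply: (chart_smooth_on pp hl 1%N).1.
  by exists xi.1.1.
Qed.

(** The only coordinate in which [v0] and [v1] interact; its symmetry in them is what the flip
    requires. *)
Lemma theta2_vec2 l : cfun l ->
  l (tvec (tchart c) (theta2 (star pp xi))).2 =
  'D_(xi.2.1) ('D_(xi.1.2) (G l p)) u + 'D_(xi.2.2) (G l p) u.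
Proof.
move=> hl; rewrite tvecE -[LHS]/((l \o snd) _).
rewrite (cfun_dvecl _ lsmT); last exact: cfun_snd.
have oB := cD_open (c := c) pp.
have Bu : (@epoint R U @` (p @^-1` cD c)) u by exists xi.1.1.
rewrite -(derive_tangent xi.1.2 xi.2.1 xi.2.2 oB Bu (chart_smooth_on pp hl 2%N)).
apply: near_derive.
have nB : nbhs (row_mx u xi.1.2) [set w | (@epoint R U @` (p @^-1` cD c)) (lsubmx w)].
  apply: continuous_lsubmx; rewrite row_mxKl; exact: open_nbhs_nbhs.
apply: filterS nB => w /= [x Dx xw].
have Tw : eset (Tdom U) w by rewrite /= -xw; exact: epointP.
rewrite (extP _ Tw) /= /Tplot.
have E1 : (Tdom_split (@mkset _ (eset (Tdom U)) w Tw)).1 = x by apply: epoint_inj; rewrite xw.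
have D1 : cD c (p (Tdom_split (@mkset _ (eset (Tdom U)) w Tw)).1) by rewrite E1.
rewrite /tvec (cvec_star (J := Tj) pp ord0 D1) (cfun_dvecl _ (chart_lsm pp D1) hl) /=.
by [].
Qed.
End InChart.
End Theta2.

Lemma sm_ext (R : realType) (E : cvs (R := R)) (U : edom R) (P Q : U -> E) :
  (forall u, P u = Q u) -> sm P -> sm Q.
Proof. by move=> PQ; rewrite (funext PQ). Qed.

(** * Verification of the axioms *)

Section Elastic.
Context {R : realType}.
Local Notation edom := (edom R).
Implicit Types (U V W : edom) (X Y : diffspace R).

Lemma star_repr (F : efun (R := R)) X (z : LD F X) : star (pplot (repr z)) (pval (repr z)) = z.
Proof. by have := reprK z; rewrite /star; case: (repr z). Qed.

Local Notation base2 z := (tproj (tproj z)).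

Lemma base2_theta2 X U (p : U -> X) (pp : plot p) (xi : T2_hat U) :
  base2 (theta2 (star pp xi)) = p xi.1.1.
Proof. by rewrite tproj_theta2 tprojE. Qed.

Lemma base2_flip X (z : LD T2_hat X) : base2 (theta2 (Lnat flip_hat z)) = base2 (theta2 z).
Proof. by rewrite -[in RHS](star_repr z) !base2_theta2. Qed.

Lemma base2_tlift X (z : tangent X) : base2 (tlift z) = tproj z.
Proof. by rewrite base2_theta2 -[in RHS](star_repr z) tprojE. Qed.

Section InChart.
Context X (c : chart X).
Local Notation phi := (cphi c).

Lemma theta2_flip_star U (p : U -> X) (pp : plot p) (xi : T2_hat U) :
  let z := theta2 (star pp xi) in let z' := theta2 (star pp (flip_hat xi)) in
  cD c (p xi.1.1) ->
  tvec c (tproj z') = (tvec (tchart c) z).1 /\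
  tvec (tchart c) z' = (tvec c (tproj z), (tvec (tchart c) z).2).
Proof.
move=> z z' Du; have Du' : cD c (p (flip_hat xi).1.1) by [].
have kG l : cfun l -> kdiff 3 (@epoint R U @` (p @^-1` cD c)) (ext (fun u => l (phi (p u)))).
  by move=> hl; exact: chart_smooth_on.
have oB := cD_open (c := c) pp.
have Bu : (@epoint R U @` (p @^-1` cD c)) (epoint xi.1.1) by exists xi.1.1.
split; first by apply: cfun_ext => l hl; rewrite (theta2_vec0 pp Du' hl) (theta2_vec1 pp Du hl).
rewrite [LHS]surjective_pairing; apply: (f_equal2 pair); apply: cfun_ext => l hl.
  by rewrite (theta2_vec1 pp Du' hl) (theta2_vec0 pp Du hl).
have E := theta2_vec2 pp Du hl; have E' := theta2_vec2 pp Du' hl.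
have S := derive_swap xi.1.2 xi.2.1 oB Bu (kG l hl).
rewrite /= in E'; exact: (etrans E' (etrans (f_equal (fun a => a + _) S) (esym E))).
Qed.

Lemma theta2_flip (z : LD T2_hat X) : cD c (base2 (theta2 z)) ->
  tvec c (tproj (theta2 (Lnat flip_hat z))) = (tvec (tchart c) (theta2 z)).1 /\
  tvec (tchart c) (theta2 (Lnat flip_hat z)) =
    (tvec c (tproj (theta2 z)), (tvec (tchart c) (theta2 z)).2).
Proof.
rewrite /Lnat; move: (star_repr z); move: (repr z) => [U p pp xi] /= <-.
by rewrite base2_theta2; exact: theta2_flip_star.
Qed.

Lemma tlift_vec (z : tangent X) : cD c (tproj z) ->
  tvec c (tproj (tlift z)) = 0 /\ tvec (tchart c) (tlift z) = (0, tvec c z).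
Proof.
rewrite /tlift /Lnat; move: (star_repr z); move: (repr z) => [U p pp xi] /= <-.
rewrite tprojE => Du; have Du' : cD c (p (lift_hat xi).1.1) by [].
split; first by apply: cfun_ext => l hl; rewrite (theta2_vec0 pp Du' hl) derive0 cfun0.
rewrite [LHS]surjective_pairing; apply: (f_equal2 pair); apply: cfun_ext => l hl.
  by rewrite (theta2_vec1 pp Du' hl) derive0 cfun0.
rewrite (theta2_vec2 pp Du' hl) derive0 add0r.
rewrite /tvec (cvec_star (J := Tj) pp ord0 Du) (cfun_dvecl _ _ hl)//.
exact: chart_lsm.
Qed.
End InChart.

Lemma tchart2_plot X (c : chart X) U (q : U -> tangent (tangent X)) :
  (forall u, cD c (base2 (q u))) ->
  plot q <-> [/\ sm (fun u => cphi c (base2 (q u))), sm (fun u => tvec c (tproj (q u))),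
                 sm (fun u => (tvec (tchart c) (q u)).1) & sm (fun u => (tvec (tchart c) (q u)).2)].
Proof.
move=> D; apply: (iff_trans (cphi_plot (c := tchart (tchart c)) D)).
split=> [/sm_prod[/sm_prod[s1 s2] /sm_prod[s3 s4]]|[s1 s2 s3 s4]]; first by split.
by apply/sm_prod; split; apply/sm_prod.
Qed.

(** [tau] is defined through an arbitrary section of [theta2]. In coordinates it exchanges the two
    middle entries, so neither the section nor the representative matters. *)
Lemma flip_exists X : lconv X -> exists tau, @is_flip R X tau.
Proof.
move=> lX; have [s sK] := choice (@theta2_surj R X).
pose tau z := theta2 (Lnat flip_hat (s z)).
have tauP z : base2 (tau z) = base2 z by rewrite /tau base2_flip sK.
have tau_coord (c : chart X) z : cD c (base2 z) ->
    tvec c (tproj (tau z)) = (tvec (tchart c) z).1 /\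
    tvec (tchart c) (tau z) = (tvec c (tproj z), (tvec (tchart c) z).2).
  by move=> Dz; have := @theta2_flip X c (s z); rewrite sK; apply.
have stau : dsmooth tau.
  move=> U q pq; apply: plot_dlocal => u; have [c Du] := lX (base2 (q u)).
  have oB := cD_open (c := tchart (tchart c)) pq; exists _, oB; split=> //.
  have pr : plot (fun w : dsub oB => q (rincl w)) by exact: (plot_comp (@esmooth_rincl R _ _ oB) pq).
  have D (w : dsub oB) : cD c (base2 (q (rincl w))) by exact: (dsubP w).
  have D' (w : dsub oB) : cD c (base2 (tau (q (rincl w)))) by rewrite tauP; exact: D.
  have [s1 s2 s3 s4] := proj1 (tchart2_plot D) pr.
  apply: (proj2 (tchart2_plot D')); split.
  - by apply: sm_ext s1 => w; rewrite tauP.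
  - by apply: sm_ext s3 => w; rewrite (tau_coord c _ (D w)).1.
  - by apply: sm_ext s2 => w; rewrite (tau_coord c _ (D w)).2.
  - by apply: sm_ext s4 => w; rewrite (tau_coord c _ (D w)).2.
exists (Dmap stau) => z /=.
have [c Dz] := lX (base2 (theta2 z)).
have [h1 h2] := tau_coord c _ Dz; have [h3 h4] := theta2_flip Dz.
apply: (@cphi_inj _ _ (tchart (tchart c))).
- by rewrite /= tauP.
- by rewrite /= base2_flip.
- by rewrite /= tauP base2_flip h1 h2 h3 h4.
Qed.

(** In coordinates the lift is [(x, y) |-> (x, 0, 0, y)], and its inverse on the range reads off the
    outer entries. *)
Lemma tlift_induction X : lconv X -> induction (@tlift R X).
Proof.
move=> lX.
have inj : injective (@tlift R X).
  move=> z z' zz'.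
  have b : tproj z = tproj z' by rewrite -(base2_tlift z) zz' base2_tlift.
  have [c Dz] := lX (tproj z); have Dz' := Dz; rewrite b in Dz'.
  apply: (@tcoord_inj _ _ c _ _ Dz Dz'); first by rewrite b.
  have [_ h] := tlift_vec Dz; have [_ h'] := tlift_vec Dz'.
  by rewrite zz' h' in h; exact: esym (congr1 snd h).
have ex (w : subD (range (@tlift R X))) : exists z, tlift z = val w.
  by have [z _ zw] := set_valP w; exists z.
have [g gK] := choice ex.
exists g; split.
- by move=> z; apply: inj; rewrite gK.
- by move=> w; apply: val_inj; rewrite /= gK.
- move=> U q pq; apply: plot_dlocal => u; have [c Du] := lX (tproj (q u)).
  have oB := cD_open (c := tchart c) pq; exists _, oB; split=> //.
  have pr : plot (fun w : dsub oB => q (rincl w)) by exact: (plot_comp (@esmooth_rincl R _ _ oB) pq).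
  have D (w : dsub oB) : cD c (tproj (q (rincl w))) by exact: (dsubP w).
  have D' (w : dsub oB) : cD c (base2 (tlift (q (rincl w)))) by rewrite base2_tlift; exact: D.
  have /sm_prod[s1 s2] :=
    proj1 (cphi_plot (c := tchart c) (p := fun w : dsub oB => q (rincl w)) D) pr.
  have s0 : sm (fun _ : dsub oB => 0 : cE c) by exact: sm_cst.
  apply: (proj2 (tchart2_plot D')); split.
  - by apply: sm_ext s1 => w; rewrite base2_tlift.
  - by apply: sm_ext s0 => w; rewrite (tlift_vec (D w)).1.
  - by apply: sm_ext s0 => w; rewrite (tlift_vec (D w)).2.
  - by apply: sm_ext s2 => w; rewrite (tlift_vec (D w)).2.
- move=> U q pq; apply: plot_dlocal => u; have [c Du] := lX (tproj (g (q u))).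
  have pv : plot (fun u => val (q u)) by exact: pq.
  have Dv u' : cD c (base2 (val (q u'))) = cD c (tproj (g (q u'))) by rewrite -gK base2_tlift.
  have oB := cD_open (c := tchart (tchart c)) pv.
  exists _, oB; split; first by rewrite /preimage /= -gK base2_tlift.
  have pr : plot (fun w : dsub oB => val (q (rincl w))) by exact: (plot_comp (@esmooth_rincl R _ _ oB) pv).
  have D (w : dsub oB) : cD c (base2 (val (q (rincl w)))) by exact: (dsubP w).
  have D' (w : dsub oB) : cD c (tproj (g (q (rincl w)))) by have := D w; rewrite Dv.
  apply/(cphi_plot (c := tchart c) (p := fun w : dsub oB => g (q (rincl w))) D').
  have [s1 _ _ s4] := proj1 (tchart2_plot D) pr.
  apply/sm_prod; split.
  - by apply: sm_ext s1 => w; rewrite /= -(gK (q (rincl w))) base2_tlift.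
  - by apply: sm_ext s4 => w; rewrite /= -(gK (q (rincl w))) (tlift_vec (D' w)).2.
Qed.

Lemma tangent_map_base X Y (f : dmap X Y) (z : tangent X) :
  tproj (tangent_map f z) = f (tproj z).
Proof.
by have [U [p [pp [xi ->]]]] := starP z; rewrite [tangent_map _ _]LpushE !tprojE.
Qed.

Lemma tangent_map_vec X Y (f : dmap X Y) (c : chart X) (d : chart Y) (L : cE c -> cE d) :
  (forall l, cfun l -> cfun (l \o L)) ->
  (forall x, cD c x -> cD d (f x) /\ cphi d (f x) = L (cphi c x)) ->
  forall z : tangent X, cD c (tproj z) -> tvec d (tangent_map f z) = L (tvec c z).
Proof.
move=> hL fL z; have [U [p [pp [xi ->]]]] := starP z; rewrite tprojE => Du.
rewrite [tangent_map _ _]LpushE /tvec (cvec_star (J := Tj) (c := c) pp ord0 Du).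
rewrite (cvec_star (J := Tj) (c := d) (dmapP f pp)); last exact: (fL _ Du).1.
rewrite -(dvec_map _ hL); last exact: chart_lsm.
rewrite /dvec; congr xget; apply/seteqP.
have E (l : cE d -> R) (v : 'rV[R]_(edim U)) :
    'D_v (ext (fun u : U => l (cphi d ((f \o p) u)))) (epoint (jpt (j := Tj) xi)) =
    'D_v (ext (fun u : U => l (L (cphi c (p u))))) (epoint (jpt (j := Tj) xi)).
  have oB := cD_open (c := c) pp.
  have nB : nbhs (epoint (jpt (j := Tj) xi)) (@epoint R U @` (p @^-1` cD c)).
    by apply: open_nbhs_nbhs; split=> //; exists xi.1.
  apply: near_derive; apply: filterS nB => x [u' Du' <-].
  by rewrite !extE /= (fL _ Du').2.
by split=> y yP l hl; rewrite yP// E.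
Qed.

(** In charts the projections are [(x, y) |-> (x, y_i)]; they equal their own derivatives, and
    together they determine base point and vector. *)
Lemma nu_injective k X : lconv X -> (0 < k)%N -> injective (@nu R k X).
Proof.
case: k => // k lX _ z z' zz'.
have zi i : tangent_map (fprojD (@tproj R X) i) z = tangent_map (fprojD (@tproj R X) i) z'.
  by have := congr1 (fun w => fproj i w) zz'.
have [c Dz] := lX (tkbase (tproj z)).
have Li i := @tangent_map_vec _ _ (fprojD (@tproj R X) i) (tkchart c k) (tchart c)
  (fun e => (e.1, e.2 i)).
have {}Li i (w : tangent (tangentk k.+1 X)) : cD c (tkbase (tproj w)) ->
    tvec (tchart c) (tangent_map (fprojD (@tproj R X) i) w) =
    ((tvec (tkchart c k) w).1, (tvec (tkchart c k) w).2 i).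
  apply: Li => [l [[l1 hl1 ->]|[l2 hl2 ->]]|x Dx]; first by left; exists l1.
    right; exists (fun f : {ffun 'I_k.+1 -> cE c} => l2 (f i)) => //.
    by exists l2, i.
  rewrite /= tkbaseE; split=> //; congr pair; by rewrite ffunE.
have b : tproj z = tproj z'.
  by apply: tk_ext => i; have := congr1 (@tproj R (tangent X)) (zi i); rewrite !tangent_map_base.
have Dz' := Dz; rewrite b in Dz'.
apply: (@tcoord_inj _ _ (tkchart c k) _ _ Dz Dz'); first by rewrite b.
rewrite [LHS]surjective_pairing [RHS]surjective_pairing.
have E i := etrans (esym (Li i z Dz)) (etrans (congr1 (tvec (tchart c)) (zi i)) (Li i z' Dz')).
have E1 := congr1 fst (E ord0); have E2 i := congr1 snd (E i).
exact: (f_equal2 pair E1 (proj1 (ffunP _ _) E2)).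
Qed.

Lemma lconv_elastic14 X : lconv X -> elastic14 X.
Proof.
move=> lX; split.
- by move=> k; exact: theta_diffeo.
- exact: flip_exists.
- exact: tlift_induction.
- by move=> k; exact: nu_injective.
Qed.

Lemma lconv_elastic X : lconv X -> elastic X.
Proof.
move=> lX; split; first exact: lconv_elastic14.
move=> ks hks; apply: lconv_elastic14.
elim: ks hks => //= k ks IH /andP[k0 /IH]; by move/lconv_tangentk; apply.
Qed.
End Elastic.

(** * Convenient vector spaces *)

Section Curves.
Context {R : realType}.
Implicit Types E F : tvsType R.

Lemma tvs_cvgZ E T (G : set_system T) {FG : Filter G} (a : T -> R) (c : T -> E) (a0 : R) (c0 : E) :
  a @ G --> a0 -> c @ G --> c0 -> (fun x => a x *: c x) @ G --> a0 *: c0.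
Proof.
move=> ha hc.
apply: continuous2_cvg ha hc; exact: (@scale_continuous R E (a0, c0)).
Qed.

Lemma curve_derivative_near E (c c' : R -> E) t l : (\forall s \near t, c s = c' s) ->
  curve_derivative_at c t l -> curve_derivative_at c' t l.
Proof.
move=> cc'; rewrite /curve_derivative_at; apply: cvg_trans; apply: near_eq_cvg.
have := cc'; rewrite (near_shift 0) => n0; apply: nbhs_dnbhs.
by apply: filterS n0 => h /=; rewrite subr0 => ->; rewrite (nbhs_singleton cc').
Qed.

Lemma curve_derivative_comp E (c : R -> E) (a : R -> R) t a' l :
  curve_derivative_at c (a t) l -> is_derive t 1 a a' ->
  curve_derivative_at (c \o a) t (a' *: l).
Proof.
move=> dc [da ae].
(* The difference quotient of [c], completed by its limit, because [a (h + t) - a t] may vanish for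
   nonzero [h]. *)
pose q (h : R) := if h == 0 then l else h^-1 *: (c (h + a t) - c (a t)).
have cq : q @ (0 : R) --> l.
  move=> A nA; have := dc A nA; rewrite /= !nbhs_simpl /=.
  move=> nd; apply: filterS (nd : nbhs (0 : R) _) => h hA; rewrite /= /q.
  by case: eqVneq => [_|h0]; [exact: nbhs_singleton|exact: hA].
have ck : (fun h : R => a (h + t) - a t) @ (0 : R)^' --> (0 : R).
  have cs : (fun h : R => h + t) @ (0 : R)^' --> t.
    have c0 : (fun h : R => h + t) @ (0 : R) --> 0 + t.
      by apply: (@cvgD _ _ _ (nbhs (0 : R)) _ id (cst t)); [exact: cvg_id|exact: cvg_cst].
    by rewrite add0r in c0; exact: cvg_within_filter c0.
  have ca : a @ t --> a t by apply: differentiable_continuous; apply/derivable1_diffP.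
  have cas := cvg_comp (fun h : R => h + t) a cs ca.
  by have := cvgB cas (cvg_cst (a t)); rewrite subrr; exact.
have dk : (fun h : R => h^-1 * (a (h + t) - a t)) @ (0 : R)^' --> a'.
  have E1 : (fun h : R => h^-1 *: ((a \o shift t) (h *: 1) - a t)) =
      (fun h : R => h^-1 * (a (h + t) - a t)).
    by apply/funext => h; rewrite /= -[h *: 1]/(h * 1) mulr1.
  by rewrite -ae /derive -E1; exact: da.
rewrite /curve_derivative_at.
have <- : (fun h : R => (h^-1 * (a (h + t) - a t)) *: q (a (h + t) - a t)) =
    (fun h => h^-1 *: ((c \o a) (h + t) - (c \o a) t)).
  apply/funext => h; rewrite /= /q subr_eq0; case: eqVneq => [->|n].
    by rewrite subrr mulr0 scale0r subrr scaler0.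
  by rewrite scalerA -mulrA mulfV ?mulr1 ?subr_eq0// subrK.
apply: tvs_cvgZ dk _; exact: (cvg_comp _ _ ck cq).
Qed.

Lemma curve_derivative_lin E F (L : {linear E -> F}) (c : R -> E) t l : continuous L ->
  curve_derivative_at c t l -> curve_derivative_at (L \o c) t (L l).
Proof.
move=> cL dc; rewrite /curve_derivative_at.
have <- : (fun h : R => L (h^-1 *: (c (h + t) - c t))) =
    (fun h : R => h^-1 *: ((L \o c) (h + t) - (L \o c) t)).
  by apply/funext => h; rewrite /= linearZ linearB.
exact: (cvg_comp _ _ dc (cL l)).
Qed.

Lemma curve_deriveE E (c : R -> E) t l : hausdorff_space E ->
  curve_derivative_at c t l -> curve_derive c t = l.
Proof.
move=> hE dc; rewrite /curve_derive; case: xgetP => [y _ dy|/(_ l)//].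
exact: (cvg_unique (F := (fun h : R => h^-1 *: (c (h + t) - c t)) @ (0 : R)^') hE).
Qed.

Lemma curve_deriveP E (c : R -> E) t : curve_derivable c t ->
  curve_derivative_at c t (curve_derive c t).
Proof. by move=> [l dl]; rewrite /curve_derive; case: xgetP => [y _ //|/(_ l)]. Qed.

Lemma smooth_curve_derive E (c : R -> E) : smooth_curve c -> smooth_curve (curve_derive c).
Proof. by move=> sc k t; have := sc k.+1 t; rewrite iterSr. Qed.

Lemma smooth_curve_lin E F (L : {linear E -> F}) (c : R -> E) : hausdorff_space F ->
  continuous L -> smooth_curve c -> smooth_curve (L \o c).
Proof.
move=> hF cL sc k; elim: k c sc => [|k IH] c sc t.
  by have [l dl] := sc 0%N t; exists (L l); exact: curve_derivative_lin.
rewrite iterSr (_ : curve_derive (L \o c) = L \o curve_derive c).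
  exact/IH/smooth_curve_derive.
apply/funext => s; apply: curve_deriveE => //; apply: curve_derivative_lin => //.
exact/curve_deriveP/(sc 0%N).
Qed.

Lemma is_derive_curve (c : R -> R^o) t l : curve_derivative_at c t l ->
  is_derive t 1 (c : R -> R) l.
Proof.
rewrite /curve_derivative_at => dc.
have E : (fun h : R => h^-1 *: (c (h + t) - c t)) =
    (fun h : R => h^-1 *: (((c : R -> R) \o shift t) (h *: 1) - c t)).
  by apply/funext => h; rewrite /= -[h *: 1]/(h * 1) mulr1.
rewrite E in dc; apply: DeriveDef; first exact: cvgP dc.
exact: (cvg_lim _ dc).
Qed.

Lemma smooth_curve_scalar E (l : {linear E -> R^o}) (c : R -> E) : continuous l ->
  smooth_curve c -> smooth_on setT (l \o c : R -> R).
Proof.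
move=> cl sc k; elim: k c sc => [//|k IH] c sc.
apply: (@kdiff_real _ _ _ (l \o curve_derive c)); last exact/IH/smooth_curve_derive.
move=> t; apply: is_derive_curve; apply: curve_derivative_lin => //.
exact/curve_deriveP/(sc 0%N).
Qed.
End Curves.

Section Convenient.
Context {R : realType}.
Local Notation edom := (edom R).
Implicit Types (E F : tvsType R) (U : edom).

(* As the line through u may leave U, differentiate along u + d sin(t) v and
   substitute t = asin(s / d). *)
Lemma PiL_curve_derivative E (hE : convenient E) U (P : U -> E) u v (G : R -> E) : PiL P ->
  (forall t (w : U), epoint w = epoint u + t *: v -> G t = P w) ->
  exists y, curve_derivative_at G 0 y /\
    forall l : {linear E -> R^o}, continuous l -> l y = 'D_v (ext (fun u => l (P u))) (epoint u).
Proof.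
move=> pP GP; have /hE.2 Dp := pP.
have /nbhs_ballP[e /= e0 bU] : nbhs (epoint u) (eset U).
  by apply: open_nbhs_nbhs; split; [exact: eopen|exact: epointP].
(* Then [d] times the norm of [v] is below [e], also for [v = 0]. *)
pose d := e / (`|v| + 1); have v1 : 0 < `|v| + 1 by rewrite ltr_wpDl.
have d0 : 0 < d by exact: divr_gt0.
have bs s : `|s| <= d -> eset U (epoint u + s *: v).
  move=> sd; apply: bU; rewrite -ball_normE /ball_/= opprD addNKr normrN normrZ.
  apply: (@le_lt_trans _ _ (d * `|v|)); first by rewrite ler_wpM2r.
  by rewrite /d mulrAC ltr_pdivrMr// ltr_pM2l// ltrDl.
have dsin t : `|d * sin t| <= d.
  by rewrite normrM (gtr0_norm d0) ler_piMr ?(ltW d0)// ler_norml sin_geN1 sin_le1.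
pose c t : U := mkset (bs _ (dsin t)).
have sc : curve_smooth (fun t => epoint (c t)).
  move=> k; apply/kdiff_coord => [|i]; first exact: openT.
  apply: (@kdiff_eq _ _ _ _ _ (fun t => epoint u ord0 i + (d * sin t) * v ord0 i) _ openT).
    by move=> t _; rewrite /= !mxE.
  apply: kdiffD; [exact: openT|exact: kdiff_cst|].
  apply: kdiffM; [exact: openT| |exact: kdiff_cst].
  by apply: kdiffM; [exact: openT|exact: kdiff_cst|exact: (kdiff_sin_cos k).1].
have [y dy] := Dp c sc 0%N 0.
pose a (s : R) := asin (d^-1 * s).
have a0 : a 0 = 0 by rewrite /a mulr0 -[X in asin X]sin0 sinK// in_itv/= oppr_le0 divr_ge0// ?pi_ge0.
have da : is_derive (0 : R) 1 a d^-1.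
  have dl : is_derive (0 : R) 1 (fun s : R => d^-1 * s) d^-1.
    by apply: is_derive_eq; rewrite scaler1 // addr0.
  have da1 : is_derive (d^-1 * 0 : R) 1 (@asin R) 1.
    rewrite mulr0; have := @is_derive1_asin R 0; rewrite expr0n subr0 sqrtr1 invr1; apply.
    by rewrite ltrN10 ltr01.
  by have := @is_derive1_comp _ (@asin R) _ _ _ _ da1 dl; rewrite mul1r.
rewrite /= -a0 in dy; have dG := curve_derivative_comp dy da.
have nd : \forall s \near (0 : R), `|s| <= d.
  by apply: filterS (nbhsx_ballx (0 : R) d d0) => s; rewrite -ball_normE/= sub0r normrN => /ltW.
have {}dG : curve_derivative_at G 0 (d^-1 *: y).
  apply: curve_derivative_near dG; apply: filterS nd => s sd; apply/esym/GP => /=.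
  have as1 : sin (a s) = d^-1 * s.
    rewrite /a asinK// in_itv/= -ler_norml normrM normfV (gtr0_norm d0) mulrC ler_pdivrMr//.
    by rewrite mul1r.
  rewrite -[LHS]/(epoint u + (d * sin (a s)) *: v) as1 mulrA mulfV ?mul1r//.
  by rewrite gt_eqF.
exists (d^-1 *: y); split=> // l cl.
have [_ <-] := is_derive_curve (curve_derivative_lin cl dG).
rewrite -[RHS](@derive_line0 R 'rV[R]_(edim U) R).
apply: (@near_derive R R R (l \o G)); apply: filterS nd => s sd.
apply: (etrans _ (esym (extP (fun w : U => l (P w) : R) (bs s sd)))).
exact: (congr1 l (GP s (mkset (bs s sd)) erefl)).
Qed.

(* A function jumping from 0 to such an x is scalarwise constant, hence smooth. *)
Lemma convenient_sep E (hE : convenient E) (x : E) :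
  (forall l : {linear E -> R^o}, continuous l -> l x = 0) -> x = 0.
Proof.
move=> lx; have [hH hD] := hE.
pose P (u : rdom (R := R) 1) : E := if epoint u ord0 ord0 == 0 then 0 else x.
have /hD Dp : PiL P.
  move=> l cl; rewrite (_ : _ \o _ = fun=> 0); first exact: vsmooth_const.
  by apply/funext => u /=; rewrite /P; case: ifP; rewrite ?linear0 ?lx.
pose c (t : R) : rdom (R := R) 1 := @mkset _ (eset (rdom (R := R) 1)) (const_mx t) Logic.I.
have sc : curve_smooth (fun t => epoint (c t)).
  move=> k; apply/kdiff_coord => [|i]; first exact: openT.
  apply: (@kdiff_eq _ _ _ _ _ id _ openT) => [t _|]; first by rewrite /= mxE.
  by apply: (@kdiff_lin R R R k _ idfun) => t; exact: cvg_id.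
have [y dy] := Dp c sc 0%N 0; rewrite /= /curve_derivative_at in dy.
have d1 : (fun h : R => x) @ (0 : R)^' --> x by exact: cvg_cst.
(* For nonzero [h] this function is constantly [x], so its limit 0 must be [x]. *)
have d2 : (fun h : R => h *: (h^-1 *: ((P \o c) (h + 0) - (P \o c) 0))) @ (0 : R)^' --> (0 : R) *: y.
  apply: tvs_cvgZ dy; apply: cvg_within_filter; exact: cvg_id.
rewrite scale0r in d2; apply: (cvg_unique (F := (fun h : R => x) @ (0 : R)^') hH d1).
apply: cvg_trans d2; apply: near_eq_cvg; exists 1 => //= h _ h0.
by rewrite /P /= !mxE addr0 eqxx (negbTE h0) subr0 scalerA mulfV// scale1r.
Qed.

Definition tvs_cfun E : set (E -> R) :=
  [set l : E -> R | exists2 L : {linear E -> R^o}, continuous L & l = L].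

(** Convenience supplies both the separation of points and the existence of derivatives. *)
Program Definition cvs_of E (hE : convenient E) : cvs (R := R) := @Cvs R E (@tvs_cfun E) _ _ _.
Next Obligation. by move=> E hE l [L cL ->] a x y; rewrite linearP. Qed.
Next Obligation.
by move=> E hE x H; apply: convenient_sep => // l cl; apply: H; exists l.
Qed.
Next Obligation.
move=> E hE U P u v H.
have pP : PiL P by move=> l cl; apply: (H l); exists l.
(* The line may leave [U]; the value 0 there does not affect the derivative at [t = 0]. *)
pose G t := if pselect (eset U (epoint u + t *: v)) is left h then P (mkset h) else 0.
have [|y [_ yl]] := @PiL_curve_derivative E hE U P u v G pP.
  by move=> t w wE; rewrite /G; case: pselect => [h|[]]; [congr P; exact: epoint_inj|rewrite -wE; exact: epointP].
by exists y => l [L cL ->]; exact: yl.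
Qed.

Lemma sm_PiL E (hE : convenient E) U (P : U -> E) : sm (E := cvs_of hE) P <-> PiL P.
Proof.
by split=> [sP l cl|pP l [L cL ->]]; [apply: (sP l); exists l|exact: pP].
Qed.

Lemma sm_Dc E (hE : convenient E) U (P : U -> E) : sm (E := cvs_of hE) P <-> Dc P.
Proof. by split=> [/sm_PiL/hE.2//|/hE.2 pP]; apply/sm_PiL. Qed.

Lemma curve_derive_dvec E (hE : convenient E) U (P : U -> E) u v (G : R -> E) :
  sm (E := cvs_of hE) P -> (forall t (w : U), epoint w = epoint u + t *: v -> G t = P w) ->
  curve_derive G 0 = dvec (E := cvs_of hE) P u v.
Proof.
move=> sP GP; have [y [dy yl]] := PiL_curve_derivative hE (proj1 (sm_PiL hE P) sP) GP.
rewrite (curve_deriveE hE.1 dy); apply: esym; apply: (@dvecE R (cvs_of hE)) => l [L cL ->]; exact: yl.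
Qed.

Lemma kdiff_compR (V : normedModType R) k (A : set V) (a : V -> R) (f : R -> R) : open A ->
  kdiff k setT f -> kdiff k A a -> kdiff k A (f \o a).
Proof.
move=> oA; elim: k f => [//|k IH] f hf ha; have [df dkf] := hf; have [da dka] := ha.
have dfa x : A x -> differentiable (f \o a) x.
  by move=> Ax; apply: differentiable_comp; [exact: da|exact: df].
split=> // v; apply: (@kdiff_eq _ _ _ _ _ (fun x => 'D_v a x * ('D_1 f \o a) x) _ oA) => [x Ax|].
  rewrite [RHS](deriveE v (dfa x Ax)) diff_comp; [|exact: da|exact: df].
  rewrite /= -(deriveE v (da x Ax)) -[X in 'd f _ X]mulr1.
  rewrite -[X in 'd f _ X]/('D_v a x *: (1 : R)) linearZ /= -(deriveE (1 : R) (df (a x) Logic.I)).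
  by [].
apply: kdiffM => //; first exact: (dka v).
exact: (IH ('D_1 f) (dkf (1 : R)) (kdiffW ha)).
Qed.

(** One direction is the special curve lemma; for the other, a smooth curve is a smooth map on the
    domain [rdom 1]. *)
Lemma cinf_openP E (hE : convenient E) (A : set E) :
  cinf_open A <-> forall U (P : U -> E), sm (E := cvs_of hE) P -> dopen (P @^-1` A).
Proof.
split=> [oA U P /sm_Dc|H c sc]; first exact: cinf_preimage.
pose P (u : rdom (R := R) 1) : E := c (epoint u ord0 ord0).
have oP : dopen (P @^-1` A).
  apply: H => _ [l cl ->].
  apply: (@vsmooth_on R (rdom 1) R (fun x => (l \o c) (x ord0 ord0))).
  have kx k : kdiff k (setT : set 'rV[R]_1) (fun x : 'rV[R]_1 => x ord0 ord0).
    apply: (proj1 (kdiff_coord k (fun x : 'rV[R]_1 => x) openT)).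
    by apply: (@kdiff_lin R _ _ k _ idfun) => t; exact: cvg_id.
  by move=> k; exact: (kdiff_compR openT (smooth_curve_scalar cl sc k) (kx k)).
rewrite (_ : c @^-1` A = (fun t : R => const_mx t : 'rV[R]_1) @^-1` (@epoint R (rdom 1) @` (P @^-1` A))).
  apply: open_comp oP => t _; apply: differentiable_continuous.
  rewrite (_ : (fun t : R => _) = fun t => t *: const_mx 1 : 'rV[R]_1).
    exact: differentiableZl.
  by apply/funext => s; apply/rowP => i; rewrite !mxE mulr1.
apply/seteqP; split=> t /=; rewrite /P; last by move=> [u Au ut]; rewrite ut mxE in Au.
by move=> At; exists (rpt (const_mx t)); rewrite //= mxE.
Qed.

Lemma hausdorff_prod E F : hausdorff_space E -> hausdorff_space F ->
  hausdorff_space (E * F)%type.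
Proof.
move=> hE hF [p1 p2] [q1 q2] h; congr pair.
  apply: hE => A B nA nB; have [||z [Az Bz]] := h (fst @^-1` A) (fst @^-1` B).
  - exact: (cvg_fst (F := nbhs p1) (G := nbhs p2) nA).
  - exact: (cvg_fst (F := nbhs q1) (G := nbhs q2) nB).
  by exists z.1.
apply: hF => A B nA nB; have [||z [Az Bz]] := h (snd @^-1` A) (snd @^-1` B).
- exact: (cvg_snd (F := nbhs p1) (G := nbhs p2) nA).
- exact: (cvg_snd (F := nbhs q1) (G := nbhs q2) nB).
by exists z.2.
Qed.

Lemma curve_derivative_pair E F (c1 : R -> E) (c2 : R -> F) t l1 l2 :
  curve_derivative_at c1 t l1 -> curve_derivative_at c2 t l2 ->
  curve_derivative_at (fun t => (c1 t, c2 t) : (E * F)%type) t (l1, l2).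
Proof. by move=> d1 d2; exact: cvg_pair d1 d2. Qed.

Lemma smooth_curve_pair E F (c1 : R -> E) (c2 : R -> F) :
  hausdorff_space E -> hausdorff_space F -> smooth_curve c1 -> smooth_curve c2 ->
  smooth_curve (fun t => (c1 t, c2 t) : (E * F)%type).
Proof.
move=> hE hF s1 s2 k; elim: k c1 c2 s1 s2 => [|k IH] c1 c2 s1 s2 t.
  have [l1 d1] := s1 0%N t; have [l2 d2] := s2 0%N t.
  by exists (l1, l2); exact: curve_derivative_pair.
rewrite iterSr (_ : curve_derive _ = fun t => (curve_derive c1 t, curve_derive c2 t)).
  by apply: IH; exact: smooth_curve_derive.
apply/funext => s; apply: curve_deriveE; first exact: hausdorff_prod.
by apply: curve_derivative_pair; apply: curve_deriveP; [exact: (s1 0%N)|exact: (s2 0%N)].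
Qed.

Lemma fst_continuous E F : continuous (fst : (E * F)%type -> E).
Proof. by move=> [x y]; exact: (cvg_fst (F := nbhs x) (G := nbhs y)). Qed.

Lemma snd_continuous E F : continuous (snd : (E * F)%type -> F).
Proof. by move=> [x y]; exact: (cvg_snd (F := nbhs x) (G := nbhs y)). Qed.

Lemma Dc_prod E F U (P : U -> (E * F)%type) : hausdorff_space E -> hausdorff_space F ->
  Dc P <-> Dc (fst \o P) /\ Dc (snd \o P).
Proof.
move=> hE hF; split=> [DP|[D1 D2] c sc].
  by split=> c /DP sc; [exact: (smooth_curve_lin (L := fst) hE (@fst_continuous E F) sc)
                       |exact: (smooth_curve_lin (L := snd) hF (@snd_continuous E F) sc)].
have := smooth_curve_pair hE hF (D1 c sc) (D2 c sc).
by rewrite (_ : (fun t => _) = P \o c)//; apply/funext => t /=; rewrite -surjective_pairing.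
Qed.

(** A functional on the product is the sum of its restrictions, [l (x, y) = l (x, 0) + l (0, y)]. *)
Lemma PiL_prod E F U (P : U -> (E * F)%type) : PiL P <-> PiL (fst \o P) /\ PiL (snd \o P).
Proof.
split=> [pP|[p1 p2] l cl].
  split=> l cl.
    apply: (pP (l \o fst : {linear (E * F)%type -> R^o})) => z.
    by apply: continuous_comp; [exact: fst_continuous|exact: cl].
  apply: (pP (l \o snd : {linear (E * F)%type -> R^o})) => z.
  by apply: continuous_comp; [exact: snd_continuous|exact: cl].
have [l1 l1E] : exists l1 : {linear E -> R^o}, forall x, l1 x = l (x, 0).
  have [|l1 e] := @linear_bundle R E R^o (fun x => l (x, 0)); last by exists l1 => x; rewrite e.
  move=> a x y; rewrite -linearP; congr (l _).
  by rewrite [RHS]surjective_pairing /= scaler0 addr0.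
have [l2 l2E] : exists l2 : {linear F -> R^o}, forall x, l2 x = l (0, x).
  have [|l2 e] := @linear_bundle R F R^o (fun x => l (0, x)); last by exists l2 => x; rewrite e.
  move=> a x y; rewrite -linearP; congr (l _).
  by rewrite [RHS]surjective_pairing /= scaler0 addr0.
have c1 : continuous l1.
  move=> x; rewrite (_ : (l1 : E -> R^o) = (fun x => l (x, 0))); last exact/funext.
  apply: (@continuous_comp _ _ _ (fun x : E => (x, 0 : F)) l); last exact: cl.
  by apply: cvg_pair; [exact: cvg_id|exact: cvg_cst].
have c2 : continuous l2.
  move=> x; rewrite (_ : (l2 : F -> R^o) = (fun x => l (0, x))); last exact/funext.
  apply: (@continuous_comp _ _ _ (fun x : F => (0 : E, x)) l); last exact: cl.
  by apply: cvg_pair; [exact: cvg_cst|exact: cvg_id].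
have := vsmoothD (p1 l1 c1) (p2 l2 c2).
rewrite (_ : (fun u => _) = l \o P)//; apply/funext => u; rewrite /= l1E l2E.
by rewrite -linearD [in RHS](surjective_pairing (P u)); congr (l (_, _)); rewrite /= ?addr0 ?add0r.
Qed.

Lemma convenient_prod E F : convenient E -> convenient F -> convenient (E * F)%type.
Proof.
move=> hE hF; split; first exact: hausdorff_prod hE.1 hF.1.
move=> U P; apply: (iff_trans (Dc_prod P hE.1 hF.1)); apply: iff_trans (iff_sym (PiL_prod P)).
by split=> -[h1 h2]; split; [apply/hE.2|apply/hF.2|apply/hE.2|apply/hF.2].
Qed.

(** Reconciles the two models of the product: that of [kmS], with all continuous functionals, and
    that of [tchart], with the functionals of one factor. *)
Lemma sm_cvs_prod E F (hE : convenient E) (hF : convenient F) (hEF : convenient (E * F)%type) U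
    (P : U -> (E * F)%type) :
  sm (E := cvs_of hEF) P <-> sm (E := prodm (cvs_of hE) (cvs_of hF)) P.
Proof.
apply: (iff_trans (sm_PiL hEF P)); apply: (iff_trans (PiL_prod P)).
apply: iff_sym; apply: (iff_trans (@sm_prod R (cvs_of hE) (cvs_of hF) U P)).
by split=> -[h1 h2]; split; [exact/(sm_PiL hE)|exact/(sm_PiL hF)|exact/(sm_PiL hE)|exact/(sm_PiL hF)].
Qed.
End Convenient.

(** * Convenient manifolds *)

Section Manifolds.
Context {R : realType}.
Local Notation edom := (edom R).
Local Notation atlas := (atlas R).
Implicit Types (U V : edom) (M N : atlas).

Lemma dopen_dlocal U (B : set U) :
  (forall u, exists (C : set U) (oC : dopen C), C u /\ dopen [set w : dsub oC | B (rincl w)]) ->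
  dopen B.
Proof.
move=> H; apply: dopen_nbhs => u Bu; have [C [oC [Cu oB]]] := H u.
exists (@epoint R (dsub oC) @` [set w | B (rincl w)]); split=> //.
  by exists (dsub_in oC Cu) => //=; rewrite dsub_inK.
by move=> w [w' Bw' ww']; rewrite (_ : w = rincl w')//; apply: epoint_inj; rewrite -ww'.
Qed.

Lemma dopen_dsub U (B S : set U) (oB : dopen B) : S `<=` B ->
  dopen [set w : dsub oB | S (rincl w)] -> dopen S.
Proof.
move=> SB oS; apply: dopen_nbhs => u Su.
exists (@epoint R (dsub oB) @` [set w | S (rincl w)]); split=> //.
  by exists (dsub_in oB (SB u Su)) => //=; rewrite dsub_inK.
by move=> w [w' Sw' ww']; rewrite (_ : w = rincl w')//; apply: epoint_inj; rewrite -ww'.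
Qed.

Lemma plot_dopenP (X : diffspace R) U (p : U -> X) (B : set U) (oB : dopen B) : plot p ->
  plot (fun w : dsub oB => p (rincl w)).
Proof. by move=> pp; exact: (plot_comp (@esmooth_rincl R _ _ oB) pp). Qed.

Lemma manD_local M U (p : U -> manD M) : plot p -> forall u : U,
  exists (B : set U) (oB : dopen B) (i : aidx M), [/\ B u,
    forall w : dsub oB, adom M i (p (rincl w)) & Dc (fun w : dsub oB => achart M i (p (rincl w)))].
Proof.
move=> pp u; have [A [oA [Au [i [ip Dp]]]]] := pp u.
have oB : dopen [set w : U | A (epoint w)].
  by apply: dopen_nbhs => w Aw; exists A.
exists _, oB, i.
have wA (w : dsub oB) : A (epoint (rincl w)) := dsubP w.
pose g (w : dsub oB) : restr oA := @mkset _ (eset (restr oA)) _ (conj (epointP (rincl w)) (wA w)).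
have gE w : rincl (g w) = rincl w by exact: epoint_inj.
split=> // [w|]; first by rewrite -gE; exact: ip.
rewrite (_ : (fun w => _) = (fun w : restr oA => achart M i (p (rincl w))) \o g).
  by apply: Dc_comp Dp; exact: (@esmooth_rincl R _ _ oB).
by apply/funext => w /=; rewrite gE.
Qed.

Lemma manD_plot M i U (p : U -> manD M) : (forall u, adom M i (p u)) -> Dc (achart M i \o p) -> plot p.
Proof. by move=> ip Dp; apply: gen_plotW; [exact: chart_plot_comp|exists i]. Qed.

(** Stated under injectivity of the charts alone, so that it applies to [kmS M] while that is still
    being shown to be a manifold. *)
Lemma local_rep_inj M N (f : M -> N) i j m :
  (forall x y, adom M i x -> adom M i y -> achart M i x = achart M i y -> x = y) ->
  adom M i m -> adom N j (f m) ->
  @local_rep R M N f i j (achart M i m) = achart N j (f m).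
Proof.
move=> inj im jfm; rewrite /local_rep; case: xgetP => [y _ [m' [im' _ mm' <-]]|/(_ (achart N j (f m)))].
  by rewrite (inj _ _ im' im mm').
by case; exists m.
Qed.

Lemma local_repE M N (f : M -> N) i j m : is_convman M -> adom M i m -> adom N j (f m) ->
  @local_rep R M N f i j (achart M i m) = achart N j (f m).
Proof. by move=> hM; apply: local_rep_inj => x y; exact: cm_inj. Qed.

Lemma man_open_dopen M (A : set M) U (p : U -> manD M) : is_convman M -> man_open A -> plot p -> dopen (p @^-1` A).
Proof.
move=> hM oA pp; apply: dopen_dlocal => u; have [B [oB [i [Bu ip Dp]]]] := manD_local pp u.
exists B, oB; split=> //; apply: dopen_eq (cinf_preimage (oA i) Dp).
apply/seteqP; split=> w /=; last by move=> Aw; exists (p (rincl w)) => //; split=> //; exact: ip.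
move=> [m [Am im] e]; rewrite -(cm_inj hM im (ip w) e)//.
Qed.

Section OneManifold.
Context M (hM : is_convman M).

Lemma adom_open i : man_open (adom M i).
Proof. by move=> j; rewrite setIC; exact: cm_overlap. Qed.

Program Definition mchart (i : aidx M) : chart (manD M) :=
  @Chart R (manD M) (cvs_of (cm_model hM i)) (adom M i) (achart M i) _ _ _ _.
Next Obligation. by move=> i U p pp; exact: (man_open_dopen hM (@adom_open i) pp). Qed.
Next Obligation. by move=> i x y; exact: cm_inj. Qed.
Next Obligation. by move=> i U P /sm_Dc DP; exact: cinf_preimage (cm_open hM (i:=i)) DP. Qed.
Next Obligation.
move=> i U p ip; split=> [pp|/sm_Dc Dp]; last exact: manD_plot Dp.
apply: sm_local => u; have [B [oB [j [Bu jp Dp]]]] := manD_local pp u.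
exists _, oB; split; first by exists u.
apply/sm_Dc.
have Ap (w : dsub oB) : (achart M j @` (adom M j `&` adom M i)) (achart M j (p (rincl w))).
  by exists (p (rincl w)).
have := cm_transition hM Ap Dp.
rewrite (_ : _ \o _ = fun w : dsub oB => achart M i (p (rincl w))).
  exact.
by apply/funext => w; rewrite /= [LHS](local_repE hM (jp w)).
Qed.

Lemma lconv_manD : lconv (manD M).
Proof. by move=> x; have [i ix] := acover x; exists (mchart i). Qed.
End OneManifold.

Lemma convman_dsmooth M N (hM : is_convman M) (hN : is_convman N) (f : M -> N) :
  convman_smooth f -> dsmooth (f : manD M -> manD N).
Proof.
move=> sf U p pp; apply: plot_dlocal => u.
have [B [oB [i [Bu ip Dp]]]] := manD_local pp u; have [j ju] := acover (f (p u)).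
have [oA sA] := sf i j.
pose p1 (w : dsub oB) := p (rincl w).
have E (w : dsub oB) : (achart M i @` (adom M i `&` f @^-1` adom N j)) (achart M i (p1 w)) <->
    adom N j (f (p1 w)).
  split=> [[m [im jm] e]|jw]; first by rewrite /p1 -(cm_inj hM im (ip w) e).
  by exists (p1 w) => //; split=> //; exact: ip.
have oC := cinf_preimage oA Dp.
have oB' : dopen [set w : U | B w /\ adom N j (f (p w))].
  apply: (dopen_dsub (oB := oB)) => [w []//|]; apply: dopen_eq oC.
  apply/seteqP; split=> w H; last exact: (proj2 (E w) H.2).
  by split; [exact: dsubP|exact: (proj1 (E w) H)].
exists _, oB'; split; first by split.
have Bw (w : dsub oB') : B (rincl w) := (dsubP w).1.
have jw (w : dsub oB') : adom N j (f (p (rincl w))) := (dsubP w).2.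
pose g (w : dsub oB') := dsub_in oB (Bw w).
have gE w : rincl (g w) = rincl w by exact: dsub_inK.
have sg : esmooth g by exact: (@esmooth_rincl R _ _ oB').
have pP w : p1 (g w) = p (rincl w) by rewrite /p1 gE.
apply: (@manD_plot N j (dsub oB') (fun w => f (p (rincl w)))) => //.
have Ap (w : dsub oB') : (achart M i @` (adom M i `&` f @^-1` adom N j))
    (((fun w => achart M i (p1 w)) \o g) w).
  by apply/E; rewrite pP; exact: jw.
have := sA _ _ Ap (Dc_comp sg Dp).
rewrite (_ : _ \o (_ \o g) = achart N j \o (fun w => f (p (rincl w)))).
  exact.
apply/funext => w; rewrite /= -/(p1 (g w)) pP local_repE//.
by rewrite -pP; exact: ip.
Qed.
End Manifolds.

(** * Tangent vectors as derivatives of lines in a chart *)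

Section TangentCoordinates.
Context {R : realType}.
Local Notation edom := (edom R).
Local Notation atlas := (atlas R).
Implicit Types (U V : edom) (M N : atlas).

Lemma tangent_map_id (X : diffspace R) (h : dsmooth (id : X -> X)) (z : tangent X) :
  tangent_map (Dmap h) z = z.
Proof.
by have [U [p [pp [xi ->]]]] := starP z; rewrite [tangent_map _ _]LpushE; exact: star_eq.
Qed.

Lemma tvec_star X (c : chart X) U (p : U -> X) (pp : plot p) (xi : T_hat U) : cD c (p xi.1) ->
  tvec c (star pp xi) = dvec (fun u => cphi c (p u)) xi.1 xi.2.
Proof. by move=> Du; rewrite /tvec (cvec_star (J := Tj) pp ord0 Du). Qed.

Lemma curve_derive_line (E : tvsType R) (x v : E) : convenient E -> curve_derive (fun t => x + t *: v) 0 = v.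
Proof.
move=> hE; apply: curve_deriveE hE.1 _; rewrite /curve_derivative_at.
have c : (fun h : R => v) @ (0 : R)^' --> v by exact: cvg_cst.
apply: cvg_trans c; apply: near_eq_cvg; exists 1 => //= h _ h0.
by rewrite addr0 scale0r addr0 addrC addKr scalerA mulVf// scale1r.
Qed.

(** The bridge between the two tangent functors. The line [x + t v] in chart [i] lifts to a plot of
    [M] on the open set of parameters where it stays in [A]. Its class at 0 with the unit vector is
    [z], and [f] carries it to a plot whose derivative in chart [j] is the curve derivative. *)
Lemma tvec_curve M N (hM : is_convman M) (hN : is_convman N) (f : M -> N)
    (hf : dsmooth (f : manD M -> manD N)) i j (z : tangent (manD M)) :
  adom M i (tproj z) -> adom N j (f (tproj z)) ->
  cinf_open (achart M i @` (adom M i `&` f @^-1` adom N j)) ->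
  tvec (mchart hN j) (tangent_map (Dmap hf) z) =
  curve_derive (fun t => @local_rep R M N f i j
    (achart M i (tproj z) + t *: (tvec (mchart hM i) z : amod i))) 0.
Proof.
move=> iz jz oA; set A := _ @` _ in oA; set x := achart M i (tproj z).
set v : amod i := tvec (mchart hM i) z.
pose P (s : rdom (R := R) 1) : cvs_of (cm_model hM i) := x + epoint s ord0 ord0 *: v.
have sP : sm P.
  apply: (@smD _ (cvs_of (cm_model hM i))); first exact: sm_cst.
  by apply: (@smZ _ (cvs_of (cm_model hM i))); [exact: vsmooth_ecoord|exact: sm_cst].
have oV := proj1 (cinf_openP (cm_model hM i) A) oA _ P sP.
have ex (w : dsub oV) : exists m : M, [/\ adom M i m, adom N j (f m) & achart M i m = P (rincl w)].
  by have [m [im jm] mP] := dsubP w; exists m.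
have [p pP] := choice ex.
have pp : plot (p : _ -> manD M).
  apply: (@manD_plot _ M i) => [w|]; first by have [] := pP w.
  rewrite (_ : _ \o _ = fun w : dsub oV => P (rincl w)).
    by apply/(sm_Dc (cm_model hM i)); apply: sm_comp sP; exact: (@esmooth_rincl R _ _ oV).
  by apply/funext => w /=; have [_ _] := pP w.
have P0 : P (rpt 0) = x by rewrite /P /= mxE scale0r addr0.
have A0 : A (P (rpt 0)) by rewrite P0; exists (tproj z).
pose w0 := dsub_in oV A0; pose xi : T_hat (dsub oV) := (w0, const_mx 1).
have pw0 : p w0 = tproj z.
  by have [h1 _ h2] := pP w0; apply: (cm_inj hM h1 iz); rewrite h2 dsub_inK P0.
have epw t (w : dsub oV) : epoint w = epoint w0 + t *: const_mx 1 -> P (rincl w) = x + t *: v.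
  move=> wE; rewrite /P epoint_rincl wE !mxE.
  by rewrite add0r mulr1.
have zE : z = star pp xi.
  have iw0 : cD (mchart hM i) (p w0) by have [] := pP w0.
  have b : tproj (star pp xi) = tproj z by rewrite tprojE.
  have Dz' : cD (mchart hM i) (tproj (star pp xi)) by rewrite b.
  have sPw : sm (E := cvs_of (cm_model hM i)) (fun w : dsub oV => achart M i (p w)).
    exact: (proj1 (@cphi_plot _ _ (mchart hM i) _ p (fun w => let: And3 h _ _ := pP w in h)) pp).
  have vv : tvec (mchart hM i) (star pp xi) = v.
    apply: (etrans (tvec_star (c := mchart hM i) pp (xi := xi) iw0)).
    apply: etrans (curve_derive_line x v (cm_model hM i)).
    apply: esym; apply: (curve_derive_dvec sPw) => t w wE.
    by have [_ _ ->] := pP w; rewrite (epw _ _ wE).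
  exact: (@tcoord_inj _ _ (mchart hM i) _ _ iz Dz' (congr1 (achart M i) (esym b)) (esym vv)).
rewrite [in LHS]zE [tangent_map _ _]LpushE.
have jw0 : cD (mchart hN j) (f (p w0)) by have [] := pP w0.
have sQ : sm (E := cvs_of (cm_model hN j)) (fun w : dsub oV => achart N j (f (p w))).
  exact: (proj1 (@cphi_plot _ _ (mchart hN j) _ (fun w => f (p w))
    (fun w => let: And3 _ h _ := pP w in h)) (hf _ _ pp)).
apply: (etrans (tvec_star (c := mchart hN j) (hf _ _ pp) (xi := xi) jw0)).
(* Only parameters in the domain of [p] enter, so the default values of [local_rep] are harmless. *)
apply: esym; apply: (curve_derive_dvec sQ) => t w wE.
have [h1 h2 h3] := pP w; rewrite -(epw _ _ wE) -h3.
exact: local_repE.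
Qed.
End TangentCoordinates.

(** * The Kriegl-Michor tangent bundle *)

Section KM.
Context {R : realType}.
Local Notation edom := (edom R).
Local Notation atlas := (atlas R).
Implicit Types (U V : edom) (M N : atlas).

Section Iso.
Context M (hM : is_convman M).
Local Notation tM := (tangent (manD M)).
Local Notation mc i := (mchart hM i).

Lemma tangent_ex i (m : set_type (adom M i)) (v : amod i) :
  exists z : tM, tproj z = val m /\ tvec (mc i) z = v.
Proof.
have im : adom M i (val m) := set_valP m.
have [z [h1 h2 h3]] := @tcoord_ex _ _ (mc i) _ v (imageP (achart M i) im).
by exists z; split=> //; exact: (cm_inj hM h1 im h2).
Qed.

(** The vector over [m] with coordinate [v] in chart [i]; [tangent_ext] makes it unique. *)
Definition kmtan_pre (s : spre M) : tM :=
  let: existT i (m, v) := s in projT1 (cid (@tangent_ex i m v)).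

Definition kmtan (z : kmS M) : tM := kmtan_pre (repr z).

Lemma kmtan_preP i (m : set_type (adom M i)) (v : amod i) :
  tproj (kmtan_pre (existT _ i (m, v))) = val m /\ tvec (mc i) (kmtan_pre (existT _ i (m, v))) = v.
Proof. by rewrite /=; case: cid. Qed.

Lemma tangent_ext i (z z' : tM) : adom M i (tproj z) -> tproj z = tproj z' ->
  tvec (mc i) z = tvec (mc i) z' -> z = z'.
Proof.
move=> iz b; have iz' := iz; rewrite b in iz'.
by apply: (@tcoord_inj _ _ (mc i) _ _ iz iz'); rewrite b.
Qed.

(** [tvec_curve] for the identity, whose local representative is the transition map: coordinates on
    [T M] obey the gluing law of [S M]. *)
Lemma tvec_transition i j (z : tM) : adom M i (tproj z) -> adom M j (tproj z) ->
  tvec (mc j) z = (S_hat (@transition R M i j) (achart M i (tproj z), tvec (mc i) z : amod i)).2.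
Proof.
move=> iz jz; have hid : dsmooth (id : manD M -> manD M) by [].
by rewrite -[in LHS](tangent_map_id hid z) (tvec_curve hM hM hid iz jz)//; exact: cm_overlap.
Qed.

Lemma kmtan_pre_rel (s s' : spre M) : srel s s' -> kmtan_pre s = kmtan_pre s'.
Proof.
case: s s' => i [m v] [j [m' v']] [mm' [e1 e2]].
have [b1 t1] := @kmtan_preP i m v; have [b2 t2] := @kmtan_preP j m' v'.
have im : adom M i (tproj (kmtan_pre (existT _ i (m, v)))) by rewrite b1; exact: set_valP.
have jm : adom M j (tproj (kmtan_pre (existT _ i (m, v)))) by rewrite b1 mm'; exact: set_valP.
apply: (tangent_ext jm); first by rewrite b1 b2.
by rewrite t2 -e2 (tvec_transition im jm) t1 b1.
Qed.

Lemma kmtan_svec i (m : set_type (adom M i)) (v : amod i) :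
  tproj (kmtan (svec m v)) = val m /\ tvec (mc i) (kmtan (svec m v)) = v.
Proof. by rewrite /kmtan /svec (quot_lift _ kmtan_pre_rel); exact: kmtan_preP. Qed.

Lemma svec_phi i (z : kmS M) (im : adom M i (tproj (kmtan z))) :
  z = svec (mkset im) (tvec (mc i) (kmtan z)).
Proof.
have E : kmtan z = kmtan_pre (repr z) by [].
rewrite -[LHS]reprK; apply: cls_eq; move: E im; case: (repr z) => j [m v] E im.
have [b1 t1] := @kmtan_preP j m v; rewrite -E in b1 t1.
have jm : adom M j (tproj (kmtan z)) by rewrite b1; exact: set_valP.
split; first by rewrite -b1.
rewrite [LHS]surjective_pairing (tvec_transition jm im) t1 -b1; congr pair.
exact: (@local_repE R M M id j i _ hM jm im).
Qed.

Lemma sdomP i (z : kmS M) : sdom i z <-> adom M i (tproj (kmtan z)).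
Proof.
split=> [[[m v] ->]|im]; first by rewrite (kmtan_svec m v).1; exact: set_valP.
by exists (mkset im, tvec (mc i) (kmtan z) : amod i); exact: svec_phi.
Qed.

Lemma schartE i (z : kmS M) : sdom i z ->
  schart i z = (achart M i (tproj (kmtan z)), tvec (mc i) (kmtan z)).
Proof.
move=> zi; have [s zs] := zi; rewrite /schart; case: xgetP => [w _ [[m v] -> ->]|].
  by have [-> ->] := kmtan_svec m v.
by move/(_ (achart M i (val s.1), s.2)); case; exists s.
Qed.

Lemma kmtan_inj : injective kmtan.
Proof.
move=> z z' zz'; have [i im] := acover (tproj (kmtan z)); have im' := im; rewrite zz' in im'.
rewrite (svec_phi im) (svec_phi im').
have -> : mkset im = mkset im' by apply: val_inj; rewrite /= zz'.
by rewrite zz'.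
Qed.

Lemma kmtan_surj (w : tM) : exists z, kmtan z = w.
Proof.
have [i im] := acover (tproj w); exists (svec (mkset im) (tvec (mc i) w)).
have [b t] := kmtan_svec (mkset im) (tvec (mc i) w : amod i).
by apply: (@tangent_ext i) => //; rewrite b.
Qed.

(** On the open set where it meets the chart image, a smooth [P] into [E x E] lifts to a plot of
    [T M], on which [S] can be tested. *)
Lemma kmS_open j (S : set tM) : (forall U (q : U -> tM), plot q -> dopen (q @^-1` S)) ->
  cinf_open (@schart R M j @` (kmtan @^-1` S `&` @sdom R M j)).
Proof.
move=> oS; apply/(cinf_openP (convenient_prod (cm_model hM j) (cm_model hM j))) => U P sP.
have sP' := proj1 (sm_cvs_prod (cm_model hM j) (cm_model hM j) _ P) sP.
have oB := cimg_open (c := tchart (mc j)) sP'.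
set O := _ @` _ in oB.
have ex (w : dsub oB) : exists z : tM,
    adom M j (tproj z) /\ (achart M j (tproj z), tvec (mc j) z) = P (rincl w).
  by have [z jz zP] := dsubP w; exists z.
have [q qP] := choice ex.
have pq : plot q.
  apply/(@cphi_plot _ _ (tchart (mc j)) _ q (fun w => (qP w).1)).
  rewrite (_ : (fun w => _) = fun w : dsub oB => P (rincl w)); last first.
    by apply/funext => w; exact: (qP w).2.
  by apply: sm_comp sP'; exact: (@esmooth_rincl R _ _ oB).
have oC := oS _ q pq.
have E w : S (q w) <-> (@schart R M j @` (kmtan @^-1` S `&` @sdom R M j)) (P (rincl w)).
  split=> [Sq|[z [Sz jz] e]].
    have [z zq] := kmtan_surj (q w); have jz : sdom j z by apply/sdomP; rewrite zq; exact: (qP w).1.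
    exists z; first by split=> //=; rewrite zq.
    by rewrite schartE// zq; exact: (qP w).2.
  rewrite (_ : q w = kmtan z)//.
  apply: (@cphi_inj _ _ (tchart (mc j))); [exact: (qP w).1|exact/sdomP|].
  by rewrite [LHS](qP w).2 -e schartE.
apply: (dopen_dsub (oB := oB)) => [u [z [_ jz] e]|].
  by exists (kmtan z); [exact/sdomP|rewrite -e schartE].
by apply: dopen_eq oC; apply/seteqP; split=> w H; [exact: (proj1 (E w) H)|exact: (proj2 (E w) H)].
Qed.

Lemma tproj_dopen (A : set M) : man_open A ->
  forall U (q : U -> tM), plot q -> dopen (q @^-1` [set z : tM | A (tproj z)]).
Proof. by move=> oA U q pq; exact: (man_open_dopen hM oA (tproj_smooth pq)). Qed.

Lemma vsmooth_open U (f : U -> R) (A : set R) : vsmooth f -> open A -> dopen (f @^-1` A).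
Proof.
move=> sf oA; apply: dopen_nbhs => u Au.
exists (eset U `&` ext f @^-1` A); split.
- rewrite openE => x [Ux Ax]; apply: filterI.
    by apply: open_nbhs_nbhs; split=> //; exact: eopen.
  by apply: (smooth_on_continuous sf Ux); apply: open_nbhs_nbhs.
- by split; [exact: epointP|rewrite /= extE].
- by move=> w [_]; rewrite /= extE.
Qed.

Lemma tvec_dopen i (l : amod i -> R) (A : set R) : @cfun R (cE (mc i)) l -> open A ->
  forall U (q : U -> tM), plot q ->
    dopen (q @^-1` [set z : tM | adom M i (tproj z) /\ A (l (tvec (mc i) z))]).
Proof.
move=> hl oA U q pq; have oB := cD_open (c := tchart (mc i)) pq.
have pr := plot_dopenP oB pq.
have /sm_prod[_ s2] := proj1 (@cphi_plot _ _ (tchart (mc i)) _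
  (fun w : dsub oB => q (rincl w)) (@dsubP _ _ _ oB)) pr.
apply: (dopen_dsub (oB := oB)) => [w []//|]; apply: dopen_eq (vsmooth_open (s2 l hl) oA).
by apply/seteqP; split=> w; [move=> Aw; split=> //; exact: (dsubP w)|case].
Qed.

Lemma schart_inj i (z z' : kmS M) : sdom i z -> sdom i z' -> schart i z = schart i z' -> z = z'.
Proof.
move=> iz iz' e; rewrite (schartE iz) (schartE iz') in e; apply: kmtan_inj.
by apply: (@cphi_inj _ _ (tchart (mc i))) e; exact/sdomP.
Qed.

Lemma kmtan_man_open (S : set tM) : (forall U (q : U -> tM), plot q -> dopen (q @^-1` S)) ->
  man_open (kmtan @^-1` S : set (kmS M)).
Proof. by move=> oS j; exact: kmS_open. Qed.

(** Distinct base points are separated in [M]. Over a common base point a functional of the model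
    space separates the vector coordinates. *)
Lemma kmS_hausdorff (x y : kmS M) : x <> y -> exists A B : set (kmS M),
  [/\ man_open A, man_open B, A x, B y & A `&` B = set0].
Proof.
move=> xy; have [b|b] := pselect (tproj (kmtan x) = tproj (kmtan y)); last first.
  have [A [B [oA oB Ax By AB]]] := cm_hausdorff hM b.
  exists (kmtan @^-1` [set z : tM | A (tproj z)]), (kmtan @^-1` [set z : tM | B (tproj z)]); split=> //.
  - exact/kmtan_man_open/tproj_dopen.
  - exact/kmtan_man_open/tproj_dopen.
  - by rewrite -subset0 => z [h1 h2]; have : (A `&` B) (tproj (kmtan z)) by []; rewrite AB.
have [i ix] := acover (tproj (kmtan x)); have iy := ix; rewrite b in iy.
have [l hl lxy] : exists2 l, @cfun R (cE (mc i)) l & l (tvec (mc i) (kmtan x)) != l (tvec (mc i) (kmtan y)).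
  apply: contrapT => H; apply: xy; apply: kmtan_inj; apply: (tangent_ext ix b).
  apply: (@cfun_ext R (cE (mc i))) => l hl; apply: contrapT => /eqP n; by apply: H; exists l.
have := @Rhausdorff R; rewrite open_hausdorff => /(_ _ _ lxy)[[A B] /= [/set_mem Ax /set_mem By] [oA oB /eqP AB]].
exists (kmtan @^-1` [set z : tM | adom M i (tproj z) /\ A (l (tvec (mc i) z))]),
  (kmtan @^-1` [set z : tM | adom M i (tproj z) /\ B (l (tvec (mc i) z))]); split=> //.
- by apply: kmtan_man_open => U q pq; exact: tvec_dopen hl oA U q pq.
- by apply: kmtan_man_open => U q pq; exact: tvec_dopen hl oB U q pq.
- rewrite -subset0 => z [[_ h1] [_ h2]].
  by have : (A `&` B) (l (tvec (mc i) (kmtan z))) by []; rewrite AB.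
Qed.

(** A smooth map in chart [i] becomes a plot of [T M], and plots are smooth in chart [j]. *)
Lemma kmS_transition (i j : aidx M) : Dc_smooth_on
  (achart (kmS M) i @` (adom (kmS M) i `&` adom (kmS M) j)) (@transition R (kmS M) i j).
Proof.
move=> U P HP DP; have hi := convenient_prod (cm_model hM i) (cm_model hM i).
have hj := convenient_prod (cm_model hM j) (cm_model hM j).
have ex (u : U) : exists z : kmS M, [/\ sdom i z, sdom j z & schart i z = P u].
  by have [z [iz jz] e] := HP u; exists z.
have [z zP] := choice ex.
have Di u : cD (tchart (mc i)) (kmtan (z u)) by have [/sdomP] := zP u.
have Dj u : cD (tchart (mc j)) (kmtan (z u)) by have [_ /sdomP] := zP u.
have pq : plot (fun u => kmtan (z u)).
  apply/(@cphi_plot _ _ (tchart (mc i)) _ (fun u => kmtan (z u)) Di).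
  rewrite (_ : (fun w => _) = P).
    exact/(sm_cvs_prod (cm_model hM i) (cm_model hM i) hi)/sm_Dc.
  by apply/funext => u; have [iz _ <-] := zP u; rewrite schartE.
have sj := proj1 (@cphi_plot _ _ (tchart (mc j)) _ (fun u => kmtan (z u)) Dj) pq.
have {sj}/(sm_Dc hj) := proj2 (sm_cvs_prod (cm_model hM j) (cm_model hM j) hj _) sj.
rewrite (_ : (fun w => _) = @transition R (kmS M) i j \o P)//.
apply/funext => u; have [iz jz e] := zP u; rewrite [RHS]/= -e.
apply: (etrans (esym (schartE jz))); apply: esym.
exact: (@local_rep_inj R (kmS M) (kmS M) id i j (z u) (@schart_inj i) iz jz).
Qed.

Lemma kmS_convman : is_convman (kmS M).
Proof.
split.
- by move=> i; apply: convenient_prod; exact: cm_model.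
- exact: schart_inj.
- move=> i; have := @kmS_open i [set z : tM | adom M i (tproj z)] (tproj_dopen (adom_open hM (i := i))).
  rewrite (_ : _ `&` _ = adom (kmS M) i)//.
  by apply/seteqP; split=> z; [case|move=> iz; split=> //; exact/sdomP].
- move=> i j; have := @kmS_open i [set z : tM | adom M j (tproj z)] (tproj_dopen (adom_open hM (i := j))).
  rewrite (_ : _ `&` _ = adom (kmS M) i `&` adom (kmS M) j)//.
  by apply/seteqP; split=> z [h1 h2]; split=> //; exact/sdomP.
- exact: kmS_transition.
- exact: kmS_hausdorff.
Qed.
End Iso.
End KM.

(** * The diffeological structure maps in coordinates *)

Section Operations.
Context {R : realType}.
Implicit Types (X : diffspace R).

Lemma dvec0 (E : cvs (R := R)) (U : edom R) (P : U -> E) u : dvec P u 0 = 0.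
Proof. by apply: dvecE => l hl; rewrite cfun0// derive0. Qed.

Lemma tzero_vec X (c : chart X) (x : X) : cD c x -> tvec c (tzero x) = 0.
Proof. by move=> Dx; rewrite /tzero tvec_star// dvec_cst. Qed.

Lemma tproj_tzero X (x : X) : tproj (tzero x) = x.
Proof. by rewrite /tzero tprojE. Qed.

Lemma tscale_vec X (c : chart X) t (z : tangent X) : cD c (tproj z) ->
  tvec c (tscale t z) = t *: tvec c z.
Proof.
rewrite /tscale /Lnat; move: (star_repr z); move: (repr z) => [U p pp xi] /= <-.
rewrite tprojE => Du; rewrite !tvec_star//=.
have := dvec_linl t xi.2 0 (chart_lsm pp Du); rewrite !addr0 => ->.
by rewrite dvec0 addr0.
Qed.

Lemma tproj_tscale X t (z : tangent X) : tproj (tscale t z) = tproj z.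
Proof.
rewrite /tscale /Lnat; move: (star_repr z); move: (repr z) => [U p pp xi] /= <-.
by rewrite !tprojE.
Qed.

(** Writing [w] as [theta] of its chosen preimage turns the claim into linearity of the
    derivative. *)
Lemma tadd_vec X (hX : elastic X) (w : tangentk 2 X) :
  tproj (tadd hX w) = tproj (fproj ord0 w) /\
  forall c : chart X, cD c (tproj (fproj ord0 w)) ->
    tvec c (tadd hX w) = tvec c (fproj ord0 w) + tvec c (fproj ord_max w).
Proof.
rewrite /tadd; case: cid => g [_ gK _ _] /=; have := gK w.
move: (g w) => y <-; rewrite /theta /Lnat /fproj /=.
move: (repr y) => [U p pp xi] /=; rewrite !tprojE; split=> // c Du.
rewrite !tvec_star//=; have := dvec_linl 1 (xi.2 ord0) (xi.2 ord_max) (chart_lsm pp Du).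
by rewrite !scale1r.
Qed.

(** As [theta2] is surjective, every flip has these coordinates, including the one chosen in
    [tflip]. *)
Lemma is_flip_vec X (tau : dmap (tangent (tangent X)) (tangent (tangent X))) : is_flip tau ->
  forall z, tproj (tproj (tau z)) = tproj (tproj z) /\
  forall c : chart X, cD c (tproj (tproj z)) ->
    tvec c (tproj (tau z)) = (tvec (tchart c) z).1 /\
    tvec (tchart c) (tau z) = (tvec c (tproj z), (tvec (tchart c) z).2).
Proof.
move=> tauP z; have [y <-] := theta2_surj z; rewrite tauP; split; first exact: base2_flip.
by move=> c Dz; exact: theta2_flip.
Qed.

Lemma tangent2_ext X (c : chart X) (z z' : tangent (tangent X)) : cD c (tproj (tproj z)) ->
  tproj (tproj z) = tproj (tproj z') -> tvec c (tproj z) = tvec c (tproj z') ->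
  tvec (tchart c) z = tvec (tchart c) z' -> z = z'.
Proof.
move=> Dz b h1 h2; have Dz' := Dz; rewrite b in Dz'.
apply: (@tcoord_inj _ _ (tchart c) _ _ Dz Dz') h2.
exact: (f_equal2 pair (congr1 (cphi c) b) h1).
Qed.
End Operations.

(** * The identification and its compatibility with the structure maps *)

Section Identification.
Context {R : realType}.
Local Notation edom := (edom R).
Local Notation atlas := (atlas R).
Implicit Types (U V : edom) (M N : atlas).

Section PhiMap.
Context M (hM : is_convman M).
Local Notation tM := (tangent (manD M)).
Local Notation hS := (kmS_convman hM).
Local Notation phi := (kmtan hM).

Lemma kmtan_plot_on i U (p : U -> manD (kmS M)) : (forall u, sdom i (p u)) ->
  plot p <-> plot (fun u => phi (p u)).
Proof.
move=> ip; have ip' u : cD (tchart (mchart hM i)) (phi (p u)) by exact/sdomP.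
apply: (iff_trans (@cphi_plot _ _ (mchart hS i) _ p ip)).
apply: iff_trans (iff_sym (@cphi_plot _ _ (tchart (mchart hM i)) _ (fun u => phi (p u)) ip')).
apply: (iff_trans (sm_cvs_prod (cm_model hM i) (cm_model hM i) (cm_model hS i) _)).
rewrite (_ : (fun u => _) = fun u => cphi (tchart (mchart hM i)) (phi (p u)))//.
by apply/funext => u; rewrite [LHS](schartE hM).
Qed.

Lemma kmtan_plot U (p : U -> manD (kmS M)) : plot p <-> plot (fun u => phi (p u)).
Proof.
split=> pp; apply: plot_dlocal => u; have [i iu] := acover (tproj (phi (p u))).
  have oB := cD_open (c := mchart hS i) pp; exists _, oB; split; first exact/(sdomP hM).
  by apply/(@kmtan_plot_on i _ (fun w : dsub oB => p (rincl w))); [exact: dsubP|exact: plot_dopenP].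
have oB := cD_open (c := tchart (mchart hM i)) pp; exists _, oB; split=> //.
apply/(@kmtan_plot_on i _ (fun w : dsub oB => p (rincl w))); last exact: plot_dopenP oB pp.
by move=> w; apply/(sdomP hM); exact: (dsubP w).
Qed.

Definition kmtanD : dmap (manD (kmS M)) tM :=
  @Dmap R (manD (kmS M)) tM phi (fun U p => proj1 (@kmtan_plot U p)).

Lemma kmtan_diffeo : diffeo kmtanD.
Proof.
have [g gK] := choice (kmtan_surj hM); exists g; split=> //.
- by move=> z; apply: (@kmtan_inj _ _ hM); rewrite gK.
- exact: (dmapP kmtanD).
- move=> U p pp; apply/kmtan_plot; rewrite (_ : (fun u => _) = p)//.
  by apply/funext => u; rewrite /= gK.
Qed.

Lemma kmtan_sproj z : tproj (phi z) = sproj z.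
Proof. by rewrite /kmtan /sproj; move: (repr z) => [i [m v]]; exact: (kmtan_preP hM m v).1. Qed.

Lemma kmtan_szero m : phi (szero m) = tzero (m : manD M).
Proof.
rewrite /szero; set s := choose_chart m; have [b t] := kmtan_svec hM (projT2 s) 0.
have im : adom M (projT1 s) m := projT2 (cid (acover m)).
apply: (@tangent_ext _ _ hM (projT1 s)); first by rewrite b.
  by rewrite b tproj_tzero.
by rewrite t (tzero_vec (c := mchart hM (projT1 s)) im).
Qed.

Lemma kmtan_sscale t z : phi (sscale t z) = tscale t (phi z).
Proof.
rewrite {2}/kmtan /sscale; move: (repr z) => [i [m v]].
have [b1 t1] := kmtan_svec hM m (t *: v); have [b2 t2] := kmtan_preP hM m v.
have im : adom M i (val m) := set_valP m.
have D2 : cD (mchart hM i) (tproj (kmtan_pre hM (existT _ i (m, v)))) by rewrite b2.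
apply: (@tangent_ext _ _ hM i); first by rewrite b1.
  by rewrite b1 tproj_tscale b2.
by rewrite t1 (tscale_vec t D2) t2.
Qed.

Lemma kmtan_sadd (hE : elastic (manD M)) (w : kmS2 M) (w' : tangentk 2 (manD M)) :
  (forall i, fproj i w' = phi (fproj i w)) -> phi (sadd w) = tadd hE w'.
Proof.
move=> ww'; have [bA tA] := tadd_vec hE w'.
have b01 : tproj (phi (fproj ord_max w)) = tproj (phi (fproj ord0 w)).
  by rewrite !kmtan_sproj; exact: (set_valP w).
move: bA tA; rewrite !ww' => bA tA.
rewrite /sadd; move: bA tA b01; rewrite {1 2 3 6}/kmtan; case: (repr _) => [i [m v0]] bA tA b01.
have [b0 t0] := kmtan_preP hM m v0.
have im : adom M i (val m) := set_valP m.
have iw : sdom i (fproj ord_max w : kmS M) by apply/(sdomP hM); rewrite b01 b0.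
have [b t] := kmtan_svec hM m (v0 + (achart (kmS M) i (fproj ord_max w)).2).
have D0 : cD (mchart hM i) (tproj (kmtan_pre hM (existT _ i (m, v0)))) by rewrite b0.
have tA' := tA (mchart hM i) D0; rewrite t0 in tA'.
have E : (achart (kmS M) i (fproj ord_max w)).2 = tvec (mchart hM i) (phi (fproj ord_max w)).
  exact: (congr1 snd (schartE hM iw)).
rewrite E in b t *.
apply: (@tangent_ext _ _ hM i); first by rewrite b.
  exact: (etrans b (esym (etrans bA b0))).
exact: (etrans t (esym tA')).
Qed.

(** The two charts have the same values in models with different functionals. [tangent_map_vec]
    applies with the identity as [L], since functionals of one factor are continuous on the
    product. *)
Lemma kmtan_tangent_vec i (y : tangent (manD (kmS M))) : sdom i (tproj y) ->
  tvec (tchart (mchart hM i)) (tangent_map kmtanD y) =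
  tvec (mchart hS i) y :> (amod i * amod i)%type.
Proof.
move=> iy.
apply: (@tangent_map_vec _ _ _ kmtanD (mchart hS i) (tchart (mchart hM i)) id) => //.
  move=> l [[l1 [L cL ->] ->]|[l2 [L cL ->] ->]].
    exists (L \o fst : {linear (amod i * amod i)%type -> R^o}) => // z.
    by apply: continuous_comp; [exact: fst_continuous|exact: cL].
  exists (L \o snd : {linear (amod i * amod i)%type -> R^o}) => // z.
  by apply: continuous_comp; [exact: snd_continuous|exact: cL].
move=> x ix; split; first exact/sdomP.
by rewrite [RHS](schartE hM ix).
Qed.

(* An element of S^2 M and its image in T^2 M have the same coordinates (u, v0, v1, v01). *)
Lemma kmtan2_svec i (m : set_type (adom M i)) (v0 v1 v01 : amod i) :
  let z := tangent_map kmtanD (kmtan hS (@svec R (kmS M) i (mkset (svec_dom m v0)) (v1, v01))) in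
  [/\ tproj (tproj z) = val m, tvec (mchart hM i) (tproj z) = v0 &
      tvec (tchart (mchart hM i)) z = (v1, v01)].
Proof.
move=> z; have [b t] := kmtan_svec hS (mkset (svec_dom m v0)) (v1, v01).
have [b0 t0] := kmtan_svec hM m v0.
have bz : tproj z = phi (svec m v0) by rewrite tangent_map_base b.
split; [by rewrite bz|by rewrite bz|].
rewrite [LHS]kmtan_tangent_vec; first exact: t.
by rewrite b; exact: svec_dom.
Qed.

Lemma kmtan_sflip (tau : dmap (tangent tM) (tangent tM)) (z : kmS (kmS M)) : is_flip tau ->
  tangent_map kmtanD (kmtan hS (sflip z)) = tau (tangent_map kmtanD (kmtan hS z)).
Proof.
move=> tauP; rewrite -{2}(reprK z) /sflip; case: (repr z) => i [y [v1 v01]].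
(* [sflip] reads [y] through a chosen pair [(m, v0)], for which [y] is [svec m v0]. *)
case: cid => -[m v0] /= ye.
have -> : y = mkset (svec_dom m v0) by apply: val_inj.
have [b1 t1 w1] := kmtan2_svec m v0 v1 v01; have [b2 t2 w2] := kmtan2_svec m v1 v0 v01.
have [b tv] := is_flip_vec tauP (tangent_map kmtanD (kmtan hS (@svec R (kmS M) i (mkset (svec_dom m v0)) (v1, v01)))).
have Dz : cD (mchart hM i) (val m) by exact: set_valP.
have [t3 w3] := tv (mchart hM i) (eq_ind_r (cD (mchart hM i)) Dz b1).
apply: (@tangent2_ext _ _ (mchart hM i)).
- by rewrite b2.
- by rewrite b2; apply: esym; exact: etrans b b1.
- by rewrite t2; apply: esym; apply: (etrans t3); rewrite w1.
- by rewrite w2; apply: esym; apply: (etrans w3); rewrite t1 w1.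
Qed.

Lemma kmtan_slift (z : kmS M) :
  tangent_map kmtanD (kmtan hS (slift z)) = tlift (phi z).
Proof.
rewrite {2}/kmtan /slift; case: (repr z) => i [m v].
have [b0 t0] := kmtan_preP hM m v; have [b t w] := kmtan2_svec m 0 0 v.
have Dz : cD (mchart hM i) (val m) by exact: set_valP.
have [t1 w1] := tlift_vec (eq_ind_r (cD (mchart hM i)) Dz b0).
apply: (@tangent2_ext _ _ (mchart hM i)).
- by rewrite b.
- by rewrite b base2_tlift b0.
- by rewrite t t1.
- by rewrite w w1 t0.
Qed.
End PhiMap.

(** Over the chosen charts, [S_hat] of the local representative is the right-hand side of
    [tvec_curve]. *)
Lemma kmtan_smap M N (hM : is_convman M) (hN : is_convman N) (f : M -> N)
    (hf : dsmooth (f : manD M -> manD N)) (z : kmS M) : convman_smooth f ->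
  kmtan hN (smap f z) = tangent_map (Dmap hf) (kmtan hM z).
Proof.
move=> sf; rewrite {2}/kmtan /smap; case: (repr z) => i [m v].
case E : (choose_chart (f (val m))) => [j n].
have nE : val n = f (val m) by have := congr1 (fun s : {j : aidx N & set_type (adom N j)} => val (projT2 s)) E.
have [b t] := kmtan_svec hN n (S_hat (@local_rep R M N f i j) (achart M i (val m), v)).2.
have [b0 t0] := kmtan_preP hM m v.
have im : adom M i (val m) := set_valP m; have jn : adom N j (val n) := set_valP n.
apply: (@tangent_ext _ _ hN j); first by rewrite b.
  by rewrite b tangent_map_base b0.
rewrite t (@tvec_curve _ _ _ hM hN f hf i j) ?b0 -?nE//; last exact: (sf i j).1.
by rewrite t0.
Qed.
End Identification.

Theorem proposition4p33 (R : realType) :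
  exists (hE : forall M : atlas R, is_convman M -> elastic (manD M))
         (hS : forall M : atlas R, is_convman M -> is_convman (kmS M))
         (Phi : forall M : atlas R, is_convman M ->
                dmap (manD (kmS M)) (tangent (manD M))),
    (forall (M N : atlas R) (hM : is_convman M) (hN : is_convman N) (f : M -> N),
       convman_smooth f ->
       exists hf : dsmooth (f : manD M -> manD N),
         forall z : kmS M,
           Phi N hN (smap f z) = tangent_map (Dmap hf) (Phi M hM z)) /\
    (forall (M : atlas R) (hM : is_convman M),
       diffeo (Phi M hM) /\
       (forall z : kmS M, tproj (Phi M hM z) = sproj z) /\
       (forall m : M, Phi M hM (szero m) = tzero (m : manD M)) /\
       (forall (t : R) (z : kmS M),
          Phi M hM (sscale t z) = tscale t (Phi M hM z)) /\
       (forall (w : kmS2 M) (w' : tangentk 2 (manD M)),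
          (forall i, fproj i w' = Phi M hM (fproj i w)) ->
          Phi M hM (sadd w) = tadd (hE M hM) w') /\
       (forall z : kmS (kmS M),
          tangent_map (Phi M hM) (Phi (kmS M) (hS M hM) (sflip z)) =
          tflip (hE M hM) (tangent_map (Phi M hM) (Phi (kmS M) (hS M hM) z))) /\
       (forall z : kmS M,
          tangent_map (Phi M hM) (Phi (kmS M) (hS M hM) (slift z)) =
          tlift (Phi M hM z))).
Proof.
exists (fun M hM => lconv_elastic (lconv_manD hM)), (@kmS_convman R), (@kmtanD R).
split=> [M N hM hN f sf|M hM].
  by exists (convman_dsmooth hM hN sf) => z; exact: kmtan_smap.
split; first exact: kmtan_diffeo.
split; first exact: kmtan_sproj.
split; first exact: kmtan_szero.
split; first exact: kmtan_sscale.
split; first exact: kmtan_sadd.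
split=> z; last exact: kmtan_slift.
by apply: kmtan_sflip; rewrite /tflip; case: cid.
Qed.
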